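(* The family $(R^\ast_\lambda)_{\lambda>0}$ is a selfadjoint pseudo-resolvent on $H$; i.e. the operators $R^\ast_\lambda$ are selfadjoint bounded linear operators on $H$ and $$(\mu-\lambda)R^\ast_\lambda R^\ast_\mu=R^\ast_\lambda-R^\ast_\mu\qquad\text{for all }\lambda,\mu>0.$$
   Context: Setting. $(M,g)$ is a compact oriented $d$-dimensional Riemannian manifold without boundary, $U\in C^1(M)$ is such that $\pi(dx)=e^{-U(x)}\mathrm{vol}(dx)$ is a probability measure, $\langle f,h\rangle=\int_M fh\,d\pi$, and $v\cdot w$ denotes the Riemannian inner product of tangent vectors. $A$ is the Friedrichs extension in $L^2(M,\pi)$ of $f\mapsto\Delta f-\nabla U\cdot\nabla f$ on $C^\infty(M)$ ($\Delta$ has spectrum in $(-\infty,0]$). It is assumed that $A$ has discrete spectrum $0=\lambda_0>-\lambda_1\ge-\lambda_2\ge\dots$ with $\lambda_n\to\infty$ and a complete orthonormal basis of eigenvectors $\phi_0,\phi_1,\dots$ of $L^2(M,\pi)$, $A\phi_n=-\lambda_n\phi_n$, with $\phi_0$ spanning the constants. Sobolev spaces: $H^m=\{\varphi=\sum_{k\ge1}a_k\phi_k:\ \sum_{k\ge1}|a_k|^2\lambda_k^m<\infty\}$ and $H:=H^0$ (the orthogonal complement of the constants in $L^2(M,\pi)$). On $H^1$: $\langle f,h\rangle_{H^1}=\int_M\nabla f\cdot\nabla h\,d\pi$. The operator $A$ restricted to $H$ has domain $H^2$. $b$ is a $C^1$ vector field on $M$ with $\mathrm{div}(e^{-U}b)=0$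 and $H^1\subset\mathrm{Dom}(b\cdot\nabla)$. $B:H^1\to H$ is the continuous extension of $f\mapsto b\cdot\nabla f$ from smooth functions; it is antisymmetric. For $c\in\mathbb{R}$, $A_c:=A+cB$ with domain $H^2$, and for $\lambda>0$, $R^{(c)}_\lambda:=-(A_c-\lambda)^{-1}$ on $H$. $R^\ast_\lambda g:=-P_{1,\lambda}(A-\lambda)^{-1}g$ for $g\in H$, $\lambda>0$, where $P_{1,\lambda}$ is the orthogonal projection of $H^1$ onto $\mathrm{Ker}(B)\cap H^1=\{\varphi\in H^1:B\varphi=0\}$ with respect to $\langle\psi,\varphi\rangle_{1,\lambda}=\langle\psi,\varphi\rangle_{H^1}+\lambda\langle\psi,\varphi\rangle$. ($R^\ast_\lambda g$ is the limit in $H^1$ of $R^{(c)}_\lambda g$ as $|c|\to\infty$.) *)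

(* Defs.v *)
From HB Require Import structures.
From mathcomp Require Import all_boot all_order all_algebra.
From mathcomp Require Import all_classical all_reals all_analysis.

Set Implicit Arguments.
Unset Strict Implicit.
Unset Printing Implicit Defensive.
Import Order.TTheory GRing.Theory Num.Theory.
Import numFieldNormedType.Exports.
Local Open Scope classical_set_scope.
Local Open Scope ring_scope.

Section Euclidean.
Variable R : realType.

Definition pderiv d (k : 'I_d) (f : 'rV[R]_d -> R) (y : 'rV[R]_d) : R :=
  'D_(delta_mx 0 k) f y.

(* [f] is of class C^n on [W]; only used for open [W]. *)
Fixpoint class_C (n d : nat) (W : set 'rV[R]_d) (f : 'rV[R]_d -> R) : Prop :=
  (forall y, W y -> {for y, continuous f}) /\
  match n with
  | 0 => True
  | n'.+1 => forall k : 'I_d,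
      (forall y, W y -> derivable f y (delta_mx 0 k)) /\
      class_C n' W (pderiv k f)
  end.

(* d-dimensional Lebesgue integral of a nonnegative Borel function, written
   (Tonelli) as an iterated one-dimensional integral. *)
Fixpoint lebesgue_iint (d : nat) : ('rV[R]_d -> \bar R) -> \bar R :=
  match d with
  | 0 => fun f => f 0
  | d'.+1 => fun f =>
      (\int[lebesgue_measure]_t
         lebesgue_iint (fun y : 'rV[R]_d' => f (row_mx (const_mx t : 'rV_1) y)))%E
  end.

End Euclidean.

(* A positively oriented smooth atlas. Charts are indexed by the points of M,
   the chart of index [p] being defined around [p]; choosing one chart around
   each point turns any atlas into one of this form with the same smooth
   structure. *)
Record oriented_atlas (R : realType) (d : nat) (M : ptopologicalType) := {
  dom : M -> set M;
  chart : M -> M -> 'rV[R]_d;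
  chart_inv : M -> 'rV[R]_d -> M;
  dom_center : forall p, dom p p;
  dom_open : forall i, open (dom i);
  img_open : forall i, open (chart i @` dom i);
  chartK : forall i p, dom i p -> chart_inv i (chart i p) = p;
  chart_continuous : forall i p, dom i p -> {for p, continuous (chart i)};
  chart_inv_continuous : forall i y,
    (chart i @` dom i) y -> {for y, continuous (chart_inv i)};
  transition_smooth : forall i j (k : 'I_d) n,
    class_C n (chart i @` (dom i `&` dom j))
      (fun y => chart j (chart_inv i y) 0 k);
  transition_oriented : forall i j p, dom i p -> dom j p ->
    0 < \det (jacobian (chart j \o chart_inv i) (chart i p)) }.

Arguments dom {R d M} _ _ _ : assert.
Arguments chart {R d M} _ _ _ : assert.
Arguments chart_inv {R d M} _ _ _ : assert.

(* Component convention: row vectors act on the left of the Jacobian, so that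
   the components of a tangent vector in the charts i and j satisfy
   v_j = v_i *m J and the matrices of a bilinear form g_i = J *m g_j *m J^T. *)
Definition transition_jacobian (R : realType) (d : nat) (M : ptopologicalType)
    (X : oriented_atlas R d M) (i j p : M) : 'M[R]_d :=
  jacobian (chart X j \o chart_inv X i) (chart X i p).

(* [metric i p] : matrix of the metric at [p] in the chart [i]. *)
Record riemannian_metric (R : realType) (d : nat) (M : ptopologicalType)
    (X : oriented_atlas R d M) := {
  metric : M -> M -> 'M[R]_d;
  metric_sym : forall i p, dom X i p -> (metric i p)^T = metric i p;
  metric_pos : forall i p (v : 'rV[R]_d), dom X i p -> v != 0 ->
    0 < (v *m metric i p *m v^T) 0 0;
  metric_smooth : forall i (k l : 'I_d) n,
    class_C n (chart X i @` dom X i)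
      (fun y => metric i (chart_inv X i y) k l);
  metric_compat : forall i j p, dom X i p -> dom X j p ->
    metric i p = transition_jacobian X i j p *m metric j p
                 *m (transition_jacobian X i j p)^T }.

Arguments metric {R d M X} _ _ _ : assert.

Definition borel (M : ptopologicalType) := g_sigma_algebraType (@open M).

Section Calculus.
Context (R : realType) (d : nat) (M : ptopologicalType).
Variables (X : oriented_atlas R d M) (g : riemannian_metric X).

Definition fun_C (n : nat) (f : M -> R) : Prop :=
  forall i, class_C n (chart X i @` dom X i) (f \o chart_inv X i).

Definition smooth (f : M -> R) : Prop := forall n, fun_C n f.

(* [v i p] : components at [p] of the vector field in the chart [i];
   only meaningful for [p] in the domain of the chart. *)
Definition vfield := M -> M -> 'rV[R]_d.

Definition is_vfield (v : vfield) : Prop :=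
  forall i j p, dom X i p -> dom X j p ->
    v j p = v i p *m transition_jacobian X i j p.

Definition vfield_C (n : nat) (v : vfield) : Prop :=
  is_vfield v /\
  forall i (k : 'I_d),
    class_C n (chart X i @` dom X i) (fun y => v i (chart_inv X i y) 0 k).

Definition vfield_borel (v : vfield) : Prop :=
  is_vfield v /\
  forall i (k : 'I_d),
    measurable_fun (dom X i : set (borel M)) (fun p : borel M => v i p 0 k).

Definition vdot (v w : vfield) (p : M) : R :=
  (v p p *m metric g p p *m (w p p)^T) 0 0.

Definition sqrt_det (i p : M) : R := Num.sqrt (\det (metric g i p)).

Definition grad (f : M -> R) : vfield := fun i p =>
  (\row_k pderiv k (f \o chart_inv X i) (chart X i p)) *m invmx (metric g i p).

Definition divergence (v : vfield) (p : M) : R :=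
  (sqrt_det p p)^-1 *
  \sum_(k < d) pderiv k
    (fun y => sqrt_det p (chart_inv X p y) * v p (chart_inv X p y) 0 k)
    (chart X p p).

Definition laplacian (f : M -> R) (p : M) : R := divergence (grad f) p.

Definition is_riemannian_volume (vol : {measure set (borel M) -> \bar R}) : Prop :=
  forall i (A : set (borel M)), measurable A -> A `<=` dom X i ->
    vol A = lebesgue_iint (fun y : 'rV[R]_d =>
      (\1_(chart X i @` A) y * sqrt_det i (chart_inv X i y))%:E).

Definition is_gibbs (vol : {measure set (borel M) -> \bar R}) (U : M -> R)
    (pi : probability (borel M) R) : Prop :=
  forall A : set (borel M), measurable A ->
    pi A = (\int[vol]_(p in A) (expR (- U p))%:E)%E.

Definition generator (U : M -> R) (f : M -> R) (p : M) : R :=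
  laplacian f p - vdot (grad U) (grad f) p.

End Calculus.

(* Elements of L^2 are square-integrable Borel functions; equality in L^2 is
   equality almost everywhere. *)
Definition L2 (R : realType) (M : ptopologicalType)
    (pi : probability (borel M) R) := LfunType pi (lee1n 2).

Section L2_theory.
Context (R : realType) (d : nat) (M : ptopologicalType).
Variables (X : oriented_atlas R d M) (g : riemannian_metric X) (U : M -> R).
Variable pi : probability (borel M) R.
Local Notation L2 := (L2 pi).

Definition inner (f h : M -> R) : R := (\int[pi]_p (f p * h p))%R.

Definition l2cvg (f : nat -> M -> R) (u : M -> R) : Prop :=
  ('N[pi]_2%:E[EFin \o (f n \- u)%R])%E @[n --> \oo] --> 0%E.

(* Closure in L^2(pi) of the gradient on smooth functions. *)
Definition is_weak_grad (u : L2) (v : vfield R d M) : Prop :=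
  vfield_borel X v /\
  exists f : nat -> L2,
    [/\ forall n, smooth X (f n), l2cvg f u &
        (\int[pi]_p (let w := grad g (f n) \- v in vdot g w w p)%:E)%E
          @[n --> \oo] --> 0%E].

Definition weak_grad (u : L2) : vfield R d M :=
  xget (fun _ _ => 0) [set v | is_weak_grad u v].

Definition h1_inner (u h : L2) : R :=
  (\int[pi]_p vdot g (weak_grad u) (weak_grad h) p)%R.

(* Domain of the closure of the form (f, h) |-> <- generator f, h> on C^oo. *)
Definition form_domain (u : L2) : Prop :=
  exists f : nat -> L2,
    [/\ forall n, smooth X (f n), l2cvg f u &
        forall e : R, 0 < e -> exists N, forall m n, (N <= m)%N -> (N <= n)%N ->
          inner (\- generator g U (f m - f n)) (f m - f n) < e].

(* Graph of the Friedrichs extension A : the restriction of the adjoint of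
   [generator] on C^oo to the domain of the closed form. *)
Definition friedrichs (u w : L2) : Prop :=
  form_domain u /\
  forall f : L2, smooth X f -> inner u (generator g U f) = inner w f.

Definition drift_domain (b : vfield R d M) (u : L2) : Prop :=
  exists (f : nat -> L2) (w : L2),
    [/\ forall n, smooth X (f n), l2cvg f u &
        l2cvg (fun n => vdot g b (grad g (f n))) w].

Section Spectral.
Variables (lambda : nat -> R) (phi : nat -> L2).

Definition discrete_spectrum : Prop :=
  [/\ [/\ lambda 0%N = 0, 0 < lambda 1%N, {homo lambda : m n / (m <= n)%N >-> m <= n}
        & lambda n @[n --> \oo] --> +oo],
      forall i j, inner (phi i) (phi j) = (i == j)%:R,
      forall u : L2, l2cvg (fun n => \sum_(0 <= k < n) inner u (phi k) *: phi k) u,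
      forall n, friedrichs (phi n) (- lambda n *: phi n) &
      exists2 c : R, c != 0 & (phi 0%N : M -> R) = cst c %[ae pi]].

Definition Hs (m : nat) (u : L2) : Prop :=
  exists a : nat -> R,
    l2cvg (fun n => \sum_(1 <= k < n) a k *: phi k) u /\
    (\sum_(1 <= k <oo) (a k ^+ 2 * lambda k ^+ m)%:E < +oo)%E.

(* Graph of A restricted to H, with domain H^2. *)
Definition A_H (u w : L2) : Prop := Hs 2 u /\ friedrichs u w.

(* (A - l)^-1 on H; the preimage is unique in L^2 and [xget] picks a
   representative of it, as it does below for the projection [P1]. *)
Definition A_inv (l : R) (h : L2) : L2 :=
  xget 0 [set u | exists2 w, A_H u w & (w - l *: u : M -> R) = h %[ae pi]].

(* [B] is the continuous extension H^1 -> H of f |-> b . grad f. *)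
Definition is_drift_operator (b : vfield R d M) (B : L2 -> L2) : Prop :=
  [/\ forall u, Hs 1 u -> Hs 0 (B u),
      forall (a : R) u v, Hs 1 u -> Hs 1 v ->
        (B (a *: u + v) : M -> R) = a *: B u + B v %[ae pi],
      exists C : R, forall u, Hs 1 u ->
        ('N[pi]_2%:E[EFin \o B u] <= (C * Num.sqrt (h1_inner u u))%:E)%E &
      forall f : L2, Hs 1 f -> smooth X f ->
        (B f : M -> R) = vdot g b (grad g f) %[ae pi]].

Variable B : L2 -> L2.

Definition kerB (u : L2) : Prop := Hs 1 u /\ (B u : M -> R) = cst 0 %[ae pi].

Definition inner1 (l : R) (u v : L2) : R := h1_inner u v + l * inner u v.

(* Orthogonal projection of H^1 onto Ker B for [inner1 l]. *)
Definition P1 (l : R) (u : L2) : L2 :=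
  xget 0 [set w | kerB w /\ forall v, kerB v -> inner1 l (u - w) v = 0].

Definition Rstar (l : R) (h : L2) : L2 := - P1 l (A_inv l h).

Definition selfadjoint_bounded_on_H (T : L2 -> L2) : Prop :=
  [/\ forall u, Hs 0 u -> Hs 0 (T u),
      forall (a : R) u v, Hs 0 u -> Hs 0 v ->
        (T (a *: u + v) : M -> R) = a *: T u + T v %[ae pi],
      exists C : R, forall u, Hs 0 u ->
        ('N[pi]_2%:E[EFin \o T u] <= C%:E * 'N[pi]_2%:E[EFin \o u])%E &
      forall u v, Hs 0 u -> Hs 0 v -> inner (T u) v = inner u (T v)].

End Spectral.
End L2_theory.

(* Main.v *)
Require Import Defs.
From HB Require Import structures.
From mathcomp Require Import all_boot all_order perm all_algebra.
From mathcomp Require Import all_classical all_reals all_analysis.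
From mathcomp Require Import measurable_realfun.
From mathcomp Require Import ring lra.

Set Implicit Arguments.
Unset Strict Implicit.
Unset Printing Implicit Defensive.
Import Order.TTheory GRing.Theory Num.Theory.
Import numFieldNormedType.Exports.
Local Open Scope classical_set_scope.
Local Open Scope ring_scope.

(* The constants are eigenfunctions of A with eigenvalue 0, so the definition of
   A by duality gives ∫ L f dπ = 0 for every smooth f, L being the differential
   operator. Applied to a product, with L(fh) = f Lh + h Lf + 2 ∇f·∇h, this
   replaces Green's formula: expanding in the basis (φ_k), the integral of
   ∇f·∇h is Σ λ_k f_k h_k, first for smooth f and h and then, by closure, on
   H^1. Consequently (A - λ)^-1 acts diagonally, and r = R*_λ g is the unique
   element of Ker B with <r, v>_{1,λ} = <g, v> for all v in Ker B. Symmetry of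
   <.,.>_{1,λ} gives selfadjointness, and for s = R*_μ g, t = R*_λ s the element
   (μ - λ) t + s satisfies the equation that characterises R*_λ g. *)

(** * Calculus of several variables *)

(** Two features of the definitions shape the proof. The divergence at [p] is read in the chart
    indexed by [p], which moves with [p]; even the continuity of L f for smooth f therefore rests on
    invariance under change of charts, whence the symmetry of second derivatives and Jacobi's
    formula for determinants. Compactness then bounds L f, which puts it in L^2 and gives it
    coefficients. Secondly, the eigenfunctions are only known to lie in the domain of the closed
    form, and the weak gradient is a choice among fields. Finite expansions are therefore
    approximated in energy by smooth functions, completeness of the square-integrable fields
    supplies a weak gradient to choose, and multiplication of the coefficients by √λ_k turns
    pairings of gradients into L^2 products, where limits are easy. Elements of [L2] are functions
    and [B] is linear only almost everywhere, so identities between them are checked on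
    coefficients, which do not see null sets. *)

Section LineEstimate.
Context (R : realType) (V : normedModType R).

Lemma is_derive_line (f : V -> R) (y v : V) (s : R) :
  derivable f (y + s *: v) v ->
  is_derive s 1 (fun r : R => f (y + r *: v)) ('D_v f (y + s *: v)).
Proof.
rewrite /derivable => h.
have E : (fun h => h^-1 *: (((fun r : R => f (y + r *: v)) \o shift s) (h *: (1:R)) - f (y + s *: v)))
   = (fun h => h^-1 *: ((f \o shift (y + s *: v)) (h *: v) - f (y + s *: v))).
  apply/funext => r /=; rewrite [_ *: 1]mulr1 scalerDl.
  by rewrite addrCA.
split; first by rewrite /derivable E.
by rewrite /derive E.
Qed.

(** The mean value theorem along the line through [y], on the segment from 0 to [t] or from [t] to 0
    according to the sign of [t]. It serves both for differentiability and for mixed second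
    differences. *)
Lemma line_estimate (f : V -> R) (y v : V) (c e t : R) :
  (forall s, `|s| <= `|t| ->
     derivable f (y + s *: v) v /\ `|'D_v f (y + s *: v) - c| <= e) ->
  `|f (y + t *: v) - f y - t * c| <= e * `|t|.
Proof.
move=> H; pose p (r : R) := f (y + r *: v).
have dp (s : R) : `|s| <= `|t| -> is_derive s 1 p ('D_v f (y + s *: v)).
  by move=> /H[+ _]; exact: is_derive_line.
have cp (s : R) : `|s| <= `|t| -> {for s, continuous p}.
  by move=> /dp[+ _] => /derivable1_diffP; exact: differentiable_continuous.
have p0 : p 0 = f y by rewrite /p scale0r addr0.
have [t0|t0] := leP 0 t.
  have st (s : R) : s \in `[0, t] -> `|s| <= `|t|.
    by rewrite in_itv/= => /andP[s0 st]; rewrite !ger0_norm.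
  have [||s /st sI] := @MVT_segment _ p (fun s => 'D_v f (y + s *: v)) _ _ t0.
  - by move=> s sI; apply: dp; apply: st; exact: subset_itv_oo_cc.
  - apply: continuous_in_subspaceT => s /set_mem sI; apply: cp; exact: st.
  rewrite p0 subr0 -/(p t) => ->; rewrite [t * _]mulrC -mulrBl normrM.
  by apply: ler_wpM2r => //; case: (H _ sI).
have st (s : R) : s \in `[t, 0] -> `|s| <= `|t|.
  by rewrite in_itv/= => /andP[ts s0]; rewrite !ler0_norm ?lerN2// ltW.
have [||s /st sI] := @MVT_segment _ p (fun s => 'D_v f (y + s *: v)) _ _ (ltW t0).
- by move=> s sI; apply: dp; apply: st; exact: subset_itv_oo_cc.
- apply: continuous_in_subspaceT => s /set_mem sI; apply: cp; exact: st.
rewrite p0 sub0r mulrN -/(p t) => E.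
have -> : p t - f y = 'D_v f (y + s *: v) * t by lra.
rewrite [t * _]mulrC -mulrBl normrM.
by apply: ler_wpM2r => //; case: (H _ sI).
Qed.

End LineEstimate.

(** * Differentiability from continuous partial derivatives *)

Section Differentiability.
Context (R : realType) (d : nat).
Implicit Types (f : 'rV[R]_d -> R) (y : 'rV[R]_d).

Definition row_form (c : 'I_d -> R) (h : 'rV[R]_d) : R := \sum_k h 0 k * c k.

Lemma row_form_is_linear (c : 'I_d -> R) : linear (row_form c).
Proof.
move=> a u v; rewrite /row_form scaler_sumr -big_split/=.
by apply: eq_bigr => k _; rewrite !mxE mulrDl scalerAl.
Qed.

HB.instance Definition _ (c : 'I_d -> R) :=
  GRing.isLinear.Build R 'rV[R]_d R _ (row_form c) (row_form_is_linear c).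

Lemma row_form_continuous (c : 'I_d -> R) : continuous (row_form c).
Proof.
have -> : row_form c = \sum_(k < d) (fun h : 'rV[R]_d => h 0 k * c k).
  by apply/funext => h; rewrite fct_sumE.
move=> y; apply: differentiable_continuous; apply: differentiable_sum => k.
by apply: differentiableM => //; exact: differentiable_coord.
Qed.

Lemma ler_rV_norm (v : 'rV[R]_d) k : `|v 0 k| <= `|v|.
Proof. by rewrite [leRHS]mx_normrE; apply: (le_bigmax _ _ (0, k)). Qed.

Lemma rV_norm_le (v : 'rV[R]_d) (e : R) : 0 <= e ->
  (forall k, `|v 0 k| <= e) -> `|v| <= e.
Proof.
move=> e0 H; rewrite [leLHS]mx_normrE; apply: bigmax_le => //= -[i j] _ /=.
by rewrite ord1.
Qed.

(** The corners of the staircase from 0 to [h] whose steps are parallel to the axes. *)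
Definition head_row (m : nat) (h : 'rV[R]_d) : 'rV[R]_d :=
  \row_k (if (k < m)%N then h 0 k else 0).

Lemma head_row0 h : head_row 0 h = 0.
Proof. by apply/rowP => k; rewrite !mxE. Qed.

Lemma head_row_all h : head_row d h = h.
Proof. by apply/rowP => k; rewrite !mxE ltn_ord. Qed.

Lemma head_rowS (k : 'I_d) h :
  head_row k.+1 h = head_row k h + h 0 k *: delta_mx 0 k.
Proof.
apply/rowP => j; rewrite !mxE eqxx/= ltnS leq_eqVlt.
have [<-|jk] := eqVneq j k; first by rewrite eqxx ltnn add0r mulr1.
by rewrite eqE/= in jk; rewrite (negbTE jk)/= mulr0 addr0.
Qed.

Lemma near_ball_line (P : 'rV[R]_d -> Prop) y : (\forall z \near y, P z) ->
  exists2 r : R, 0 < r & forall z, `|z - y| < r -> P z.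
Proof.
move=> /nbhs_ballP[r r0 H]; exists r => // z zy; apply: H.
by rewrite -ball_normE/= distrC.
Qed.

(** The increment from [y] to [y + h] is split along the staircase [head_row]; each of the [d] steps
    follows one axis and costs at most [e / d * |h|] by [line_estimate]. *)
Lemma partial_differentiable f y :
  (\forall z \near y, forall k, derivable f z (delta_mx 0 k)) ->
  (forall k : 'I_d, {for y, continuous (pderiv k f)}) -> differentiable f y.
Proof.
move=> df cf; pose c k := pderiv k f y.
have key (e : R) : 0 < e -> \forall h \near (0 : 'rV[R]_d),
    `|f (h + y) - (f y + row_form c h)| <= e * `|h|.
  (* In dimension 0 the quotient [e / d] would be 0, so the only vector is treated apart. *)
  move=> e0; have [d0|d0] := posnP d.
    near=> h.
    have -> : h = 0.
      apply/matrixP => i k; exfalso; have := ltn_ord k.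
      by move: (nat_of_ord k) => n; rewrite d0 ltn0.
    by rewrite add0r normr0 mulr0 linear0 addr0 subrr normr0.
  have de0 : 0 < e / d%:R by rewrite divr_gt0// ltr0n.
  have : \forall z \near y, forall k, derivable f z (delta_mx 0 k) /\
      `|pderiv k f z - c k| <= e / d%:R.
    near=> z => k; split; first by move: k; near: z.
    move: k; near: z; apply: filter_forall => k.
    have /cvgrPdist_le/(_ _ de0) := cf k.
    by apply: filterS => z; rewrite distrC.
  move=> /near_ball_line[r r0 H].
  near=> h.
  have hr : `|h| < r.
    near: h; apply/nbhs_ballP; exists r => // z.
    by rewrite -ball_normE/= sub0r normrN.
  have step (k : 'I_d) : `|f (y + head_row k.+1 h) - f (y + head_row k h)
      - h 0 k * c k| <= e / d%:R * `|h|.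
    rewrite head_rowS addrA.
    apply: (@le_trans _ _ (e / d%:R * `|h 0 k|)); last first.
      by rewrite ler_wpM2l ?ler_rV_norm// ltW.
    apply: line_estimate => s hs; apply: H.
    apply: le_lt_trans hr.
    rewrite -(addrA y) addrAC subrr add0r; apply: rV_norm_le => // j; rewrite !mxE eqxx/=.
    have [->|jk] := eqVneq j k.
      by rewrite ltnn add0r mulr1 (le_trans hs)// ler_rV_norm.
    by rewrite mulr0 addr0; case: ifP => _; rewrite ?normr0// ler_rV_norm.
  have tele : f (y + h) - f y - row_form c h =
      \sum_(k < d) (f (y + head_row k.+1 h) - f (y + head_row k h) - h 0 k * c k).
    rewrite sumrB/=; congr (_ - _).
    rewrite -(big_mkord xpredT (fun k => f (y + head_row k.+1 h) - f (y + head_row k h))).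
    by rewrite telescope_sumr// head_row0 addr0 head_row_all.
  rewrite opprD addrA [h + y]addrC tele.
  apply: (le_trans (ler_norm_sum _ _ _)).
  apply: (@le_trans _ _ (\sum_(k < d) e / d%:R * `|h|)); first exact: ler_sum.
  rewrite sumr_const card_ord -[leLHS]mulr_natr mulrAC divfK//.
  by rewrite pnatr_eq0 -lt0n.
have E : 'd f y = row_form c :> (_ -> _).
  apply: diff_unique; first exact: row_form_continuous.
  by apply/eqaddoP => e /key; apply: filterS => h.
apply/diff_locallyP; rewrite E; split; first exact: row_form_continuous.
by apply/eqaddoP => e /key; apply: filterS => h.
Unshelve. all: by end_near. Qed.

End Differentiability.

(** * Functions of class C^n and symmetry of second derivatives *)

Section Schwarz.
Context (R : realType) (d : nat).
Implicit Types (f g : 'rV[R]_d -> R) (y : 'rV[R]_d) (W : set 'rV[R]_d).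

Lemma class_C_continuous n W f y :
  class_C n W f -> W y -> {for y, continuous f}.
Proof. by case: n => [|n] [H _]; exact: H. Qed.

Lemma class_C_derivable n W f y k :
  class_C n.+1 W f -> W y -> derivable f y (delta_mx 0 k).
Proof. by move=> [_ H]; have [+ _] := H k; exact. Qed.

Lemma class_C_pderiv n W f k : class_C n.+1 W f -> class_C n W (pderiv k f).
Proof. by move=> [_ H]; have [_] := H k. Qed.

Lemma class_CW n W f : class_C n.+1 W f -> class_C n W f.
Proof.
elim: n f => [|n IH] f; first by move=> [H _].
move=> [H1 H2]; split=> // k; have [Ha Hb] := H2 k.
by split => //; exact: IH.
Qed.

Lemma class_C_le m n W f : (m <= n)%N -> class_C n W f -> class_C m W f.
Proof.
move=> /subnK <-; elim: (n - m)%N => [//|p IH]; rewrite addSn.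
by move=> /class_CW.
Qed.

Lemma class_C_eq n W f g : open W -> (forall y, W y -> f y = g y) ->
  class_C n W f -> class_C n W g.
Proof.
move=> oW; elim: n f g => [|n IH] f g fg [H1 H2].
all: have nfg y : W y -> {near y, f =1 g}
  by move=> Wy; near=> z; apply: fg; near: z; exact: open_nbhs_nbhs (conj oW Wy).
all: have cg y : W y -> {for y, continuous g}
  by move=> Wy; have := H1 _ Wy; rewrite /prop_for/continuous_at (fg _ Wy) => fy;
     apply: cvg_trans fy; apply: (@near_eq_cvg _ _ (nbhs y)); exact: (nfg _ Wy).
- by split.
- split => // k; have [Ha Hb] := H2 k; split.
    move=> y Wy; apply: near_eq_derivable (Ha _ Wy); exact: nfg.
  by apply: IH Hb => y Wy; apply: near_eq_derive; exact: nfg.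
Unshelve. all: by end_near. Qed.

Lemma class_C_near_derivable n W f y : open W -> class_C n.+1 W f -> W y ->
  \forall z \near y, forall k, derivable f z (delta_mx 0 k).
Proof.
move=> oW H Wy.
near=> z => k; apply: class_C_derivable H _.
by near: z; exact: open_nbhs_nbhs (conj oW Wy).
Unshelve. all: by end_near. Qed.

Lemma class_C_differentiable n W f y : open W -> class_C n.+1 W f -> W y ->
  differentiable f y.
Proof.
move=> oW H Wy; apply: partial_differentiable.
  exact: class_C_near_derivable H Wy.
by move=> k; apply: class_C_continuous Wy; exact: class_C_pderiv H.
Qed.

Lemma norm_delta (k : 'I_d) : `|delta_mx 0 k : 'rV[R]_d| <= 1.
Proof.
apply: rV_norm_le => // j; rewrite mxE eqxx/=.
by case: (_ == _); rewrite ?normr1 ?normr0.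
Qed.

Lemma is_derive_translate f y w v : derivable f (y + w) v ->
  is_derive y v (fun z => f (z + w)) ('D_v f (y + w)).
Proof.
rewrite /derivable => h.
have E : (fun h => h^-1 *: (((fun z => f (z + w)) \o shift y) (h *: v) - f (y + w)))
   = (fun h => h^-1 *: ((f \o shift (y + w)) (h *: v) - f (y + w))).
  by apply/funext => r /=; rewrite addrA.
split; first by rewrite /derivable E.
by rewrite /derive E.
Qed.

(** Two uses of [line_estimate]: along [k] for the map z ↦ f (z + t e_l) - f z, whose derivative is
    an increment of [pderiv k f], and then along [l] for that increment. *)
Lemma second_difference W f y k l e : open W -> class_C 2 W f -> W y -> 0 < e ->
  exists2 r : R, 0 < r & forall s t, `|s| < r -> `|t| < r ->
  `|f (y + s *: delta_mx 0 k + t *: delta_mx 0 l) - f (y + s *: delta_mx 0 k)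
    - (f (y + t *: delta_mx 0 l) - f y) - s * (t * pderiv l (pderiv k f) y)|
  <= e * `|t| * `|s|.
Proof.
move=> oW fC Wy e0; set c := pderiv l (pderiv k f) y.
have : \forall z \near y, W z /\ `|pderiv l (pderiv k f) z - c| <= e.
  apply: filterI; first exact: (open_nbhs_nbhs (conj oW Wy)).
  have /cvgrPdist_le/(_ _ e0) : {for y, continuous (pderiv l (pderiv k f))}.
    by apply: class_C_continuous Wy; do 2 apply: class_C_pderiv; exact: fC.
  by apply: filterS => z h; rewrite distrC; exact: h.
(* Half the radius, because the displacements along both axes add up. *)
move=> /near_ball_line[r r0 H]; exists (r / 2); first by rewrite divr_gt0.
move=> s t sr tr.
pose ek : 'rV[R]_d := delta_mx 0 k; pose el : 'rV[R]_d := delta_mx 0 l.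
have small (a b : R) : `|a| <= `|s| -> `|b| <= `|t| ->
    `|(y + a *: ek + b *: el) - y| < r.
  move=> as_ bt; rewrite -(addrA y) addrAC subrr add0r.
  rewrite (le_lt_trans (ler_normD _ _))// !normrZ.
  rewrite [ltRHS]splitr ltrD//.
    by apply: le_lt_trans sr; rewrite (le_trans _ as_)// ler_piMr// norm_delta.
  by apply: le_lt_trans tr; rewrite (le_trans _ bt)// ler_piMr// norm_delta.
have smallk (a : R) : `|a| <= `|s| -> `|(y + a *: ek) - y| < r.
  by move=> as_; have := small a 0 as_; rewrite scale0r addr0; apply; rewrite normr0.
pose p z := f (z + t *: el) - f z.
have -> : f (y + s *: ek + t *: el) - f (y + s *: ek) - (f (y + t *: el) - f y) =
   p (y + s *: ek) - p y by [].
apply: line_estimate => a as_.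
have [Wz _] := H _ (smallk a as_).
have [Wzt _] := H _ (small a t as_ (lexx _)).
have dz : derivable f (y + a *: ek) ek := class_C_derivable fC Wz.
have dzt : derivable f (y + a *: ek + t *: el) ek := class_C_derivable fC Wzt.
have dp : is_derive (y + a *: ek) ek p
    ('D_ek f (y + a *: ek + t *: el) - 'D_ek f (y + a *: ek)).
  apply: is_deriveB; first exact: is_derive_translate.
  exact: derivableP.
split; first by case: dp.
have [_ ->] := dp.
apply: (@line_estimate _ _ (pderiv k f) (y + a *: ek) el c e t) => b bt.
have [Wb Hb] := H _ (small a b as_ bt); split; last exact: Hb.
by apply: class_C_derivable Wb; exact: class_C_pderiv fC.
Qed.

(** For [s = t] the second difference is symmetric in [k] and [l], so it lies within
    [e / 2 * t ^+ 2] of [t ^+ 2] times either mixed derivative; dividing by [t ^+ 2] bounds their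
    distance by [e]. *)
Lemma pderiv_comm W f y k l : open W -> class_C 2 W f -> W y ->
  pderiv l (pderiv k f) y = pderiv k (pderiv l f) y.
Proof.
move=> oW fC Wy; apply/eqP; rewrite -subr_eq0 -normr_le0.
apply/ler_addgt0Pl => e e0; rewrite addr0.
have e20 : 0 < e / 2 by rewrite divr_gt0.
have [r r0 H] := @second_difference W f y k l _ oW fC Wy e20.
have [r' r'0 H'] := @second_difference W f y l k _ oW fC Wy e20.
pose t := Num.min r r' / 2.
have m0 : 0 < Num.min r r' by rewrite lt_min r0.
have t0 : 0 < t by rewrite divr_gt0.
have tm : t < Num.min r r' by rewrite ltr_pdivrMr// ltr_pMr// ltr1n.
have := tm; rewrite lt_min => /andP[tr tr'].
have := H t t; have := H' t t; rewrite !(ger0_norm (ltW t0)).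
move=> /(_ tr' tr') + /(_ tr tr).
rewrite -(addrA y) [t *: _ + _]addrC !addrA.
set a := f (y + _ + _); set a1 := f (y + _); set a2 := f (y + _).
set c1 := pderiv _ _ _; set c2 := pderiv _ _ _.
clearbody a a1 a2 c1 c2; move: (f y) => a0 h1 h2.
have tt0 : 0 < t * t by rewrite mulr_gt0.
rewrite -(@ler_pM2r _ (t * t))// -[X in _ * X <= _](gtr0_norm tt0) -normrM.
move: h1 h2; rewrite !ler_norml => /andP[h1 h2] /andP[h3 h4].
by apply/andP; split; nra.
Qed.

End Schwarz.

(** * Stability of the classes C^n under algebraic operations *)

Section ClassCClosure.
Context (R : realType) (d : nat).
Implicit Types (f g : 'rV[R]_d -> R) (y : 'rV[R]_d) (W : set 'rV[R]_d).

Lemma class_C_is_derive n W f y k : class_C n.+1 W f -> W y ->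
  is_derive y (delta_mx 0 k) f (pderiv k f y).
Proof. by move=> fC Wy; apply: derivableP; exact: class_C_derivable fC Wy. Qed.

(** Formulas for derivatives hold only on [W], whereas [class_C] recurs on [pderiv k f] as a global
    function; this rule lets inductions on [n] work with the formula [df]. *)
Lemma class_CS n W f (df : 'I_d -> 'rV[R]_d -> R) : open W ->
  (forall y, W y -> {for y, continuous f}) ->
  (forall k y, W y -> is_derive y (delta_mx 0 k) f (df k y)) ->
  (forall k, class_C n W (df k)) -> class_C n.+1 W f.
Proof.
move=> oW cf dff dfC; split => // k; split.
  by move=> y Wy; have [] := dff k _ Wy.
apply: class_C_eq (dfC k) => // y Wy.
by have [_ <-] := dff k _ Wy.
Qed.

Lemma class_C_cst n W (c : R) : open W -> class_C n W (fun=> c).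
Proof.
move=> oW; elim: n c => [|n IH] c; first by split => // y _; exact: cst_continuous.
apply: (@class_CS _ _ _ (fun _ _ => 0)) => // y _; exact: cst_continuous.
Qed.

Lemma class_CD n W f g : open W -> class_C n W f -> class_C n W g ->
  class_C n W (fun y => f y + g y).
Proof.
move=> oW; elim: n f g => [|n IH] f g fC gC.
  by split => // y Wy; exact: (continuousD (class_C_continuous fC Wy) (class_C_continuous gC Wy)).
apply: (@class_CS _ _ _ (fun k y => pderiv k f y + pderiv k g y)) => //.
- by move=> y Wy; exact: (continuousD (class_C_continuous fC Wy) (class_C_continuous gC Wy)).
- by move=> k y Wy; exact: (is_deriveD (class_C_is_derive k fC Wy) (class_C_is_derive k gC Wy)).
- by move=> k; apply: IH; apply: class_C_pderiv.
Qed.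

Lemma class_CM n W f g : open W -> class_C n W f -> class_C n W g ->
  class_C n W (fun y => f y * g y).
Proof.
move=> oW; elim: n f g => [|n IH] f g fC gC.
  by split => // y Wy; exact: (continuousM (class_C_continuous fC Wy) (class_C_continuous gC Wy)).
apply: (@class_CS _ _ _ (fun k y => f y * pderiv k g y + g y * pderiv k f y)) => //.
- by move=> y Wy; exact: (continuousM (class_C_continuous fC Wy) (class_C_continuous gC Wy)).
- by move=> k y Wy; exact: (is_deriveM (class_C_is_derive k fC Wy) (class_C_is_derive k gC Wy)).
- by move=> k; apply: class_CD => //; apply: IH; do ?[exact: class_CW|exact: class_C_pderiv].
Qed.

Lemma class_CN n W f : open W -> class_C n W f -> class_C n W (fun y => - f y).
Proof.
move=> oW fC; have := class_CM oW (class_C_cst n (-1) oW) fC.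
by apply: class_C_eq => // y _; rewrite mulN1r.
Qed.

Lemma class_C_sum n W (I : Type) (r : seq I) (P : pred I)
    (F : I -> 'rV[R]_d -> R) : open W ->
  (forall i, class_C n W (F i)) -> class_C n W (fun y => \sum_(i <- r | P i) F i y).
Proof.
move=> oW FC; elim: r => [|i r IH].
  by under eq_fun do rewrite big_nil; exact: class_C_cst.
under eq_fun do rewrite big_cons.
by case: (P i) => //; apply: class_CD.
Qed.

Lemma class_C_prod n W (I : Type) (r : seq I) (P : pred I)
    (F : I -> 'rV[R]_d -> R) : open W ->
  (forall i, class_C n W (F i)) -> class_C n W (fun y => \prod_(i <- r | P i) F i y).
Proof.
move=> oW FC; elim: r => [|i r IH].
  by under eq_fun do rewrite big_nil; exact: class_C_cst.
under eq_fun do rewrite big_cons.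
by case: (P i) => //; apply: class_CM.
Qed.

Lemma is_derive_comp1 (h : R -> R) f y v (dh : R) :
  differentiable f y -> is_derive (f y) 1 h dh ->
  is_derive y v (h \o f) (dh * 'D_v f y).
Proof.
move=> df [dh1 dhE].
have dfh : differentiable h (f y) by apply/derivable1_diffP.
have dc : differentiable (h \o f) y by exact: differentiable_comp.
split; first exact: diff_derivable.
rewrite deriveE// diff_comp//=.
transitivity ('d h (f y) ('D_v f y *: (1 : R))).
  by rewrite [_ *: _]mulr1 (deriveE _ df).
by rewrite linearZ/= -deriveE// dhE mulrC.
Qed.

Lemma class_CV n W f : open W -> (forall y, W y -> f y != 0) ->
  class_C n W f -> class_C n W (fun y => (f y)^-1).
Proof.
move=> oW f0; elim: n => [|n IH] fC.
  by split => // y Wy; exact: (continuousV (f0 _ Wy) (class_C_continuous fC Wy)).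
have fV := IH (class_CW fC).
apply: (@class_CS _ _ _ (fun k y => - ((f y)^-1 * (f y)^-1) * pderiv k f y)) => //.
- by move=> y Wy; exact: (continuousV (f0 _ Wy) (class_C_continuous fC Wy)).
- move=> k y Wy; have dk := class_C_is_derive k fC Wy.
  split; first by apply: derivableV; [exact: f0|case: dk].
  rewrite [LHS](@deriveV _ _ f _ _ (f0 _ Wy)); last by case: dk.
  by rewrite -[_ *: _]/(_ * _) expr2 invfM.
- move=> k; apply: class_CM => //; last exact: class_C_pderiv.
  by apply: class_CN => //; exact: class_CM.
Qed.

Lemma class_C_sqrt n W f : open W -> (forall y, W y -> 0 < f y) ->
  class_C n W f -> class_C n W (fun y => Num.sqrt (f y)).
Proof.
move=> oW f0.
have cs y : {for y, continuous f} -> {for y, continuous (fun y => Num.sqrt (f y))}.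
  by move=> cf; apply: (@continuous_comp _ _ _ f Num.sqrt) => //; exact: sqrt_continuous.
elim: n => [|n IH] fC.
  by split => // y Wy; exact: (cs _ (class_C_continuous fC Wy)).
have fV := IH (class_CW fC).
apply: (@class_CS _ _ _ (fun k y => (2 * Num.sqrt (f y))^-1 * pderiv k f y)) => //.
- by move=> y Wy; exact: (cs _ (class_C_continuous fC Wy)).
- move=> k y Wy; apply: (@is_derive_comp1 Num.sqrt f).
    exact: class_C_differentiable fC Wy.
  by apply: is_derive1_sqrt; exact: f0.
- move=> k; apply: class_CM => //; last exact: class_C_pderiv.
  apply: class_CV => //.
    by move=> y Wy; rewrite mulf_neq0// gt_eqF// sqrtr_gt0; exact: f0.
  by apply: class_CM => //; exact: class_C_cst.
Qed.

Lemma class_C_det m n W (A : 'rV[R]_d -> 'M[R]_m) : open W ->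
  (forall i j, class_C n W (fun y => A y i j)) -> class_C n W (fun y => \det (A y)).
Proof.
move=> oW AC; apply: class_C_sum => // s.
by apply: class_CM => //; [exact: class_C_cst|exact: class_C_prod].
Qed.

(** By Cramer's rule the entries of the inverse are polynomials in those of [A] divided by the
    determinant. *)
Lemma class_C_invmx m n W (A : 'rV[R]_d -> 'M[R]_m) i j : open W ->
  (forall y, W y -> A y \in unitmx) ->
  (forall i j, class_C n W (fun y => A y i j)) ->
  class_C n W (fun y => invmx (A y) i j).
Proof.
move=> oW A0 AC.
apply: (@class_C_eq _ _ _ _ (fun y => (\det (A y))^-1 * cofactor (A y) j i)) => //.
  by move=> y Wy; rewrite /invmx A0// !mxE.
apply: class_CM => //.
  apply: class_CV => //; last exact: class_C_det.
  by move=> y Wy; have := A0 _ Wy; rewrite unitmxE unitfE.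
apply: class_CM => //; first exact: class_C_cst.
apply: class_C_det => // k l.
by under eq_fun do rewrite !mxE; exact: AC.
Qed.

End ClassCClosure.

(** * Chain rule in several variables *)

Section ChainRule.
Context (R : realType) (d : nat).
Implicit Types (tau : 'rV[R]_d -> 'rV[R]_d) (y : 'rV[R]_d).

Lemma differentiable_row tau y :
  (forall k, differentiable (fun z => tau z 0 k) y) -> differentiable tau y.
Proof.
move=> H.
have -> : tau = \sum_(k < d) (fun z => tau z 0 k *: (delta_mx 0 k : 'rV[R]_d)).
  by apply/funext => z; rewrite fct_sumE [LHS]row_sum_delta.
by apply: differentiable_sum => k; exact: differentiableZl.
Qed.

Lemma derive_row tau y v k : differentiable tau y ->
  'D_v tau y 0 k = 'D_v (fun z => tau z 0 k) y.
Proof.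
move=> /diff_derivable dt; rewrite derive_mx ?mxE//.
Qed.

Lemma jacobianE tau y k l :
  (forall k, differentiable (fun z => tau z 0 k) y) ->
  jacobian tau y k l = pderiv k (fun z => tau z 0 l) y.
Proof.
move=> /differentiable_row dt; rewrite /pderiv -derive_row// deriveEjacobian//.
by rewrite -rowE [RHS]mxE.
Qed.

Lemma pderiv_comp (f : 'rV[R]_d -> R) tau y k :
  (forall k, differentiable (fun z => tau z 0 k) y) ->
  differentiable f (tau y) ->
  pderiv k (f \o tau) y = \sum_l jacobian tau y k l * pderiv l f (tau y).
Proof.
move=> dtau df; have dt := differentiable_row dtau.
rewrite /pderiv deriveE; last exact: differentiable_comp.
rewrite diff_comp//=.
have -> : 'd tau y (delta_mx 0 k) = \sum_l jacobian tau y k l *: delta_mx 0 l.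
  rewrite [LHS]row_sum_delta; apply: eq_bigr => l _; congr (_ *: _).
  by rewrite -deriveE// derive_row// jacobianE.
by rewrite linear_sum/=; apply: eq_bigr => l _; rewrite linearZ/= -deriveE.
Qed.

End ChainRule.

(** * Derivative of a determinant *)

Lemma leibniz_cons (K : comNzRingType) (I : eqType) (f df : I -> K) a r :
  a \notin r ->
  f a * (\sum_(i <- r) df i * \prod_(j <- r | j != i) f j) + (\prod_(j <- r) f j) * df a
  = \sum_(i <- a :: r) df i * \prod_(j <- a :: r | j != i) f j.
Proof.
move=> ar; rewrite [RHS]big_cons [in X in _ = X + _]big_cons eqxx/= addrC.
congr (_ + _).
  rewrite mulrC; congr (_ * _).
  rewrite big_seq [RHS]big_seq_cond; apply: eq_bigl => i.
  by have [->|] := eqVneq i a; rewrite ?(negbTE ar)// andbT.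
rewrite big_distrr/= !(big_seq_cond (fun i => true)).
apply: eq_bigr => i; rewrite andbT => ir.
rewrite [in RHS]big_cons ifT; first by rewrite mulrCA.
by apply: contraNneq ar => ->.
Qed.

Section Jacobi.
Context (R : realType) (V : normedModType R).

Lemma is_derive_prod (I : finType) (F : I -> V -> R) (dF : I -> R) (y v : V) :
  (forall i, is_derive y v (F i) (dF i)) ->
  is_derive y v (fun z => \prod_i F i z) (\sum_i dF i * \prod_(j | j != i) F j y).
Proof.
move=> H.
(* Without repetitions in [r], the condition [j != i] removes exactly one factor. *)
have key (r : seq I) : uniq r -> is_derive y v (fun z => \prod_(i <- r) F i z)
    (\sum_(i <- r) dF i * \prod_(j <- r | j != i) F j y).
  elim: r => [_|a r IH /= /andP[ar ur]].
    under eq_fun do rewrite big_nil; rewrite big_nil; exact: is_derive_cst.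
  under eq_fun do rewrite big_cons.
  refine (is_derive_eq (is_deriveM (H a) (IH ur)) _).
  transitivity (F a y * (\sum_(i <- r) dF i * \prod_(j <- r | j != i) F j y)
     + \prod_(j <- r) F j y * dF a) => //.
  exact: leibniz_cons.
have := key (index_enum I) (index_enum_uniq I); exact.
Qed.

Definition subst_row m (A : 'M[R]_m) (i : 'I_m) (u : 'rV[R]_m) : 'M[R]_m :=
  \matrix_(k, l) if k == i then u 0 l else A k l.

(** Jacobi's formula. Differentiating the expansion over permutations gives a sum of determinants,
    each with one row replaced by its derivative; expansion along that row produces the
    cofactors. *)
Lemma is_derive_det m (A : V -> 'M[R]_m) (dA : 'M[R]_m) (y v : V) :
  (forall i j, is_derive y v (fun z => A z i j) (dA i j)) ->
  is_derive y v (fun z => \det (A z)) (\sum_i \sum_j dA i j * \adj (A y) j i).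
Proof.
move=> H; rewrite /determinant.
have -> : (fun z => \sum_(s : 'S_m) (-1) ^+ s * \prod_i A z i (s i)) =
   \sum_(s : 'S_m) (fun z => (-1) ^+ s * \prod_i A z i (s i)).
  by apply/funext => z; rewrite fct_sumE.
have key (s : 'S_m) : is_derive y v (fun z => (-1) ^+ s * \prod_i A z i (s i))
    ((-1) ^+ s * \sum_i (dA i (s i) * \prod_(j | j != i) A y j (s j))).
  exact: (is_deriveZ (f := fun z => \prod_i A z i (s i)) _
     (is_derive_prod (fun i => H i (s i)))).
have sumd (r : seq 'S_m) : is_derive y v
    (\sum_(s <- r) (fun z => (-1) ^+ s * \prod_i A z i (s i)))
    (\sum_(s <- r) (-1) ^+ s * \sum_i (dA i (s i) * \prod_(j | j != i) A y j (s j))).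
  elim: r => [|s r IH]; first by rewrite !big_nil; exact: is_derive_cst.
  by rewrite !big_cons; exact: is_deriveD.
refine (is_derive_eq (sumd (index_enum _)) _).
transitivity (\sum_i \det (subst_row (A y) i (row i dA))).
  rewrite /determinant exchange_big/=; apply: eq_bigr => s _.
  rewrite mulr_sumr; apply: eq_bigr => i _; congr (_ * _).
  rewrite [RHS](bigD1 i)//= !mxE eqxx; congr (_ * _).
  by apply: eq_bigr => j /negbTE ji; rewrite mxE ji.
apply: eq_bigr => i _; rewrite (expand_det_row _ i); apply: eq_bigr => j _.
rewrite !mxE eqxx; congr (_ * _); rewrite /cofactor; congr (_ * \det _).
by apply/matrixP => a c; rewrite !mxE eq_sym (negbTE (neq_lift _ _)).
Qed.

Lemma is_derive_det_unit m (A : V -> 'M[R]_m) (dA : 'M[R]_m) (y v : V) :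
  A y \in unitmx ->
  (forall i j, is_derive y v (fun z => A z i j) (dA i j)) ->
  is_derive y v (fun z => \det (A z))
    (\det (A y) * \sum_i \sum_j dA i j * invmx (A y) j i).
Proof.
move=> uA /is_derive_det H; refine (is_derive_eq H _).
rewrite mulr_sumr; apply: eq_bigr => i _; rewrite mulr_sumr; apply: eq_bigr => j _.
rewrite mulrCA /invmx uA !mxE; congr (_ * _); rewrite mulrA divff ?mul1r//.
by rewrite -unitfE -unitmxE.
Qed.

End Jacobi.

(** * Change of charts *)

(** The algebra behind the invariance of the divergence: [T] stands for the Jacobian matrix, [N] for
    its inverse, [D] for its determinant. The terms in [dT] match by the symmetry of second
    derivatives, those in [da] because [T *m N] is the identity. *)
Lemma divergence_algebra (K : fieldType) d (T N : 'M[K]_d) (D : K) (a : 'I_d -> K)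
    (da : 'I_d -> 'I_d -> K) (dT : 'I_d -> 'I_d -> 'I_d -> K) :
  T *m N = 1%:M -> (forall m l k, dT m l k = dT l m k) ->
  \sum_l (D * da l l + a l * (D * \sum_m \sum_k dT l m k * N k m)) =
  D * \sum_k \sum_m N k m * \sum_l (a l * dT m l k + T l k * da l m).
Proof.
move=> TN dTC.
have -> : \sum_k \sum_m N k m * \sum_l (a l * dT m l k + T l k * da l m) =
    \sum_l \sum_m \sum_k (N k m * a l * dT m l k + N k m * T l k * da l m).
  rewrite exchange_big/= [RHS]exchange_big/=; apply: eq_bigr => m _.
  rewrite [RHS]exchange_big/=; apply: eq_bigr => k _.
  by rewrite mulr_sumr; apply: eq_bigr => l _; rewrite mulrDr !mulrA.
rewrite mulr_sumr; apply: eq_bigr => l _.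
under [in RHS]eq_bigr do rewrite big_split/=.
rewrite big_split/= mulrDr [LHS]addrC; congr (_ + _).
  rewrite mulrCA; congr (_ * _); rewrite mulr_sumr; apply: eq_bigr => m _.
  by rewrite mulr_sumr; apply: eq_bigr => k _; rewrite dTC; ring.
congr (_ * _).
transitivity (\sum_m (T *m N) l m * da l m).
  rewrite TN (bigD1 l)//= big1 ?addr0 ?mxE ?eqxx ?mul1r// => m /negbTE ml.
  by rewrite mxE eq_sym ml mul0r.
apply: eq_bigr => m _; rewrite mxE mulr_suml; apply: eq_bigr => k _; ring.
Qed.

(** * Positive definite matrices *)

Section PositiveDefinite.
Context (K : rcfType) (n : nat).
Implicit Type G : 'M[K]_n.

Definition posdef G := forall v : 'rV[K]_n, v != 0 -> 0 < (v *m G *m v^T) 0 0.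

Lemma posdef_unitmx G : posdef G -> G \in unitmx.
Proof.
move=> G0; rewrite -row_free_unit -kermx_eq0.
apply: contraT => /rowV0Pn[v /sub_kermxP v0 vn0].
by have := G0 _ vn0; rewrite v0 mul0mx mxE ltxx.
Qed.

Lemma posdef1 : posdef 1%:M.
Proof.
move=> v vn0; rewrite mulmx1 mxE lt_neqAle eq_sym; apply/andP; split; last first.
  by apply: sumr_ge0 => k _; rewrite mxE -expr2 sqr_ge0.
apply: contraNneq vn0 => /eqP; rewrite psumr_eq0 => [/allP H|k _]; last first.
  by rewrite mxE -expr2 sqr_ge0.
apply/eqP/rowP => k; have := H k (mem_index_enum _).
by rewrite !mxE mulf_eq0 orbb => /eqP.
Qed.

(* The segment from G to 1 stays positive definite, hence invertible. *)
Lemma posdef_det_gt0 G : posdef G -> 0 < \det G.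
Proof.
move=> G0; rewrite ltNge; apply/negP => d0.
pose p : {poly K} := \det (map_mx polyC G + 'X *: map_mx polyC (1%:M - G)).
have pE s : p.[s] = \det (G + s *: (1%:M - G)).
  rewrite -horner_evalE -det_map_mx; congr (\det _).
  by apply/matrixP => k l; rewrite mxE -[LHS]/(horner _ s) !mxE !hornerE.
have [|s /andP[s0 s1]] := @poly_ivt _ p 0 1 ler01.
  by rewrite !pE scale0r addr0 d0 scale1r addrC subrK det1 ler01.
rewrite rootE pE => /eqP ds.
suff /posdef_unitmx : posdef (G + s *: (1%:M - G)) by rewrite unitmxE ds unitr0.
move=> v vn0; have -> : G + s *: (1%:M - G) = (1 - s) *: G + s *: 1%:M.
  by rewrite scalerBr scalerBl scale1r addrAC addrA.
rewrite mulmxDr mulmxDl -!scalemxAr -!scalemxAl.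
have := G0 _ vn0; have := posdef1 vn0.
move: (v *m G *m v^T) (v *m 1%:M *m v^T) => A C C0 A0; rewrite !mxE.
have [->|s_neq1] := eqVneq s 1.
  by rewrite subrr mul0r add0r mul1r.
rewrite ltr_pwDl//; first by rewrite mulr_gt0// subr_gt0 lt_neqAle s_neq1.
by rewrite mulr_ge0// ltW.
Qed.

End PositiveDefinite.

(** * Transformation of gradients, densities and divergences *)

Section Charts.
Context (R : realType) (d : nat) (M : ptopologicalType).
Variables (X : oriented_atlas R d M) (g : riemannian_metric X).
Implicit Types (f h : M -> R) (v w : vfield R d M) (i j p q : M).

Definition overlap i j := chart X i @` (dom X i `&` dom X j).
Definition transition i j := chart X j \o chart_inv X i.

Lemma chart_inv_img i y : (chart X i @` dom X i) y ->
  dom X i (chart_inv X i y) /\ chart X i (chart_inv X i y) = y.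
Proof. by move=> [p ip <-]; rewrite chartK. Qed.

Lemma overlapP i j y : overlap i j y <->
  (chart X i @` dom X i) y /\ dom X j (chart_inv X i y).
Proof.
split; first by move=> [p [ip jp] <-]; rewrite chartK//; split => //; exists p.
move=> [[p ip <-]]; rewrite chartK// => jp; by exists p.
Qed.

Lemma overlap_open i j : open (overlap i j).
Proof.
rewrite openE => y /overlapP[Wy jy]; rewrite /interior.
have n1 : nbhs y (chart X i @` dom X i) by apply: open_nbhs_nbhs; split => //; exact: img_open.
have n2 : nbhs y (chart_inv X i @^-1` dom X j).
  by apply: (chart_inv_continuous Wy); apply: open_nbhs_nbhs; split => //; exact: dom_open.
by near=> z; apply/overlapP; split; near: z.
Unshelve. all: by end_near. Qed.

Lemma overlap_sub i j : overlap i j `<=` chart X i @` dom X i.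
Proof. by move=> y /overlapP[]. Qed.

Lemma chart_nbhs i p : dom X i p -> nbhs (chart X i p) (chart X i @` dom X i).
Proof. by move=> ip; apply: open_nbhs_nbhs; split; [exact: img_open|exists p]. Qed.

Lemma overlap_nbhs i j p : dom X i p -> dom X j p -> nbhs (chart X i p) (overlap i j).
Proof.
move=> ip jp; apply: open_nbhs_nbhs; split; first exact: overlap_open.
by exists p.
Qed.

Lemma transition_chart i j p : dom X i p -> transition i j (chart X i p) = chart X j p.
Proof. by move=> ip; rewrite /transition/= chartK. Qed.

Lemma chart_inv_transition i j y : overlap i j y ->
  chart_inv X j (transition i j y) = chart_inv X i y.
Proof. by move=> /overlapP[_ jy]; rewrite /transition/= chartK. Qed.

Lemma transition_class_C i j k n : class_C n (overlap i j) (fun y => transition i j y 0 k).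
Proof. exact: transition_smooth. Qed.

Lemma transition_differentiable i j y k : overlap i j y ->
  differentiable (fun y => transition i j y 0 k) y.
Proof.
by apply: class_C_differentiable; [exact: overlap_open|exact: (@transition_class_C i j k 1)].
Qed.

Lemma transition_jacobianE i j y k l : overlap i j y ->
  jacobian (transition i j) y k l = pderiv k (fun y => transition i j y 0 l) y.
Proof. by move=> oy; apply: jacobianE => m; exact: transition_differentiable. Qed.

Lemma transition_det_gt0 i j p : dom X i p -> dom X j p ->
  0 < \det (transition_jacobian X i j p).
Proof. exact: transition_oriented. Qed.

Lemma transition_unit i j p : dom X i p -> dom X j p ->
  transition_jacobian X i j p \in unitmx.
Proof.
by move=> ip jp; rewrite unitmxE unitfE gt_eqF// transition_det_gt0.
Qed.

Lemma fun_C_differentiable n f i p : fun_C X n.+1 f -> dom X i p ->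
  differentiable (f \o chart_inv X i) (chart X i p).
Proof.
move=> fC ip; apply: class_C_differentiable (fC i) _; first exact: img_open.
by exists p.
Qed.

Lemma pderiv_transition f i j p k : dom X i p -> dom X j p ->
  differentiable (f \o chart_inv X j) (chart X j p) ->
  pderiv k (f \o chart_inv X i) (chart X i p) =
  \sum_l transition_jacobian X i j p k l * pderiv l (f \o chart_inv X j) (chart X j p).
Proof.
move=> ip jp df.
have E : \forall y \near chart X i p,
    (f \o chart_inv X i) y = (f \o chart_inv X j \o transition i j) y.
  near=> y; rewrite /= chart_inv_transition//.
  by near: y; exact: overlap_nbhs.
transitivity (pderiv k (f \o chart_inv X j \o transition i j) (chart X i p)).
  exact: near_eq_derive E.
rewrite pderiv_comp.
- by rewrite transition_chart.
- by move=> m; apply: transition_differentiable; exists p.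
- by rewrite transition_chart.
Unshelve. all: by end_near. Qed.

Lemma metric_unit i p : dom X i p -> metric g i p \in unitmx.
Proof.
by move=> ip; apply: posdef_unitmx => v; exact: metric_pos.
Qed.

Lemma invmx_metric_compat i j p : dom X i p -> dom X j p ->
  invmx (metric g j p) = (transition_jacobian X i j p)^T *m invmx (metric g i p)
    *m transition_jacobian X i j p.
Proof.
move=> ip jp; have uJ := transition_unit ip jp.
have uJT : (transition_jacobian X i j p)^T \in unitmx by rewrite unitmx_tr.
have uj := metric_unit jp; have ui := metric_unit ip.
set J := transition_jacobian _ _ _ _ in uJ uJT *.
apply: (can_inj (mulKmx uj)); rewrite mulmxV//.
have -> : metric g j p = invmx J *m metric g i p *m invmx J^T.
  by rewrite (metric_compat g ip jp) -/J !mulmxA mulVmx// mul1mx mulmxK.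
by rewrite !mulmxA mulmxKV// mulmxK// mulVmx.
Qed.

Lemma grad_is_vfield n f : fun_C X n.+1 f -> is_vfield X (grad g f).
Proof.
move=> fC i j p ip jp; rewrite /grad (invmx_metric_compat ip jp) !mulmxA.
congr (_ *m _ *m _); apply/rowP => k; rewrite !mxE.
rewrite (pderiv_transition _ ip jp); last exact: fun_C_differentiable fC jp.
by apply: eq_bigr => l _; rewrite !mxE mulrC.
Qed.

(** [vdot] uses the chart indexed by [p]; regularity and measurability in [p] require a chart that
    stays fixed. *)
Lemma vdot_chart v w i p : is_vfield X v -> is_vfield X w -> dom X i p ->
  vdot g v w p = (v i p *m metric g i p *m (w i p)^T) 0 0.
Proof.
move=> Hv Hw ip; have pp := dom_center X p.
rewrite /vdot (Hv _ _ _ ip pp) (Hw _ _ _ ip pp) (metric_compat g ip pp).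
by rewrite trmx_mul !mulmxA.
Qed.

Lemma metric_det_gt0 i p : dom X i p -> 0 < \det (metric g i p).
Proof. by move=> ip; apply: posdef_det_gt0 => v; exact: metric_pos. Qed.

Lemma sqrt_det_gt0 i p : dom X i p -> 0 < sqrt_det g i p.
Proof. by move=> ip; rewrite sqrtr_gt0 metric_det_gt0. Qed.

Lemma sqrt_det_chart i j p : dom X i p -> dom X j p ->
  sqrt_det g i p = \det (transition_jacobian X i j p) * sqrt_det g j p.
Proof.
move=> ip jp; rewrite /sqrt_det (metric_compat g ip jp) !det_mulmx det_tr mulrAC.
rewrite -expr2 sqrtrM ?sqr_ge0// sqrtr_sqr ger0_norm// ltW//.
exact: transition_det_gt0.
Qed.

Lemma sqrt_det_class_C n i :
  class_C n (chart X i @` dom X i) (sqrt_det g i \o chart_inv X i).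
Proof.
have oW := @img_open _ _ _ X i.
apply: class_C_sqrt => //.
  by move=> y /chart_inv_img[iy _]; exact: metric_det_gt0.
by apply: class_C_det => // k l; exact: metric_smooth.
Qed.

(** The components of [v] weighted by the volume density of the chart [i], as functions of the
    coordinates. *)
Definition flux i v (k : 'I_d) (y : 'rV[R]_d) :=
  sqrt_det g i (chart_inv X i y) * v i (chart_inv X i y) 0 k.

Definition chart_div i v p :=
  (sqrt_det g i p)^-1 * \sum_(k < d) pderiv k (flux i v k) (chart X i p).

Lemma flux_class_C n i v k : vfield_C X n v ->
  class_C n (chart X i @` dom X i) (flux i v k).
Proof.
move=> [_ vC]; apply: class_CM; [exact: img_open|exact: sqrt_det_class_C|exact: vC].
Qed.

(** The Jacobian matrix of the transition map, given by partial derivatives at every [y], so that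
    its entries can be differentiated again as functions. *)
Definition transition_mx i j (y : 'rV[R]_d) : 'M[R]_d :=
  \matrix_(k, l) pderiv k (fun y => transition i j y 0 l) y.

Lemma transition_mxE i j y : overlap i j y ->
  transition_mx i j y = transition_jacobian X i j (chart_inv X i y).
Proof.
move=> oy; have [_ yE] := chart_inv_img (overlap_sub oy).
rewrite /transition_jacobian yE; apply/matrixP => k l; rewrite [LHS]mxE.
by symmetry; exact: (transition_jacobianE k l oy).
Qed.

(* By Jacobi's formula the derivative of the density contributes the second
   derivatives of the transition map, and these are symmetric. *)
Lemma chart_divE i j v p : vfield_C X 1 v -> dom X i p -> dom X j p ->
  chart_div i v p = chart_div j v p.
Proof.
move=> vC ip jp; have [vV vC1] := vC.
set y0 := chart X i p; set x0 := chart X j p.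
have oy0 : overlap i j y0 by exists p.
have x0E : transition i j y0 = x0 by exact: transition_chart.
have pE : chart_inv X i y0 = p by exact: chartK.
pose tau := transition i j.
pose T := transition_mx i j.
have TE y : overlap i j y -> T y = transition_jacobian X i j (chart_inv X i y).
  exact: transition_mxE.
have TK k l : (fun y => T y k l) = pderiv k (fun y => tau y 0 l).
  by apply/funext => y; rewrite [LHS]mxE.
clearbody T.
have T0E : T y0 = transition_jacobian X i j p by rewrite (TE _ oy0) pE.
have uT : T y0 \in unitmx by rewrite T0E transition_unit.
(* Components in the chart [i] with the density of the chart [j]: near [y0] the flux in [i] is
   [\det T] times [a], and the flux in [j], composed with [tau], is the row [a] times [T]. *)
pose a l y := sqrt_det g j (chart_inv X j (tau y)) * v i (chart_inv X i y) 0 l.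
have aE l y : overlap i j y ->
    a l y = sqrt_det g j (chart_inv X i y) * v i (chart_inv X i y) 0 l.
  by move=> oy; rewrite /a /tau (chart_inv_transition oy).
have sdiff : differentiable (sqrt_det g j \o chart_inv X j \o tau) y0.
  apply: differentiable_comp.
    by apply: differentiable_row => k; exact: transition_differentiable.
  rewrite /tau x0E; apply: class_C_differentiable (sqrt_det_class_C 1 j) _.
    exact: img_open.
  by exists p.
have da l m : is_derive y0 (delta_mx 0 m) (a l) (pderiv m (a l) y0).
  apply: derivableP; apply: diff_derivable; apply: differentiableM => //.
  apply: class_C_differentiable (vC1 i l) _; first exact: img_open.
  by exists p.
have dT k l m : is_derive y0 (delta_mx 0 m) (fun y => T y k l)
    (pderiv m (fun y => T y k l) y0).
  rewrite TK.
  apply: (class_C_is_derive (n := 0) (W := overlap i j)) => //.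
  exact: class_C_pderiv (transition_class_C i j l 2).
have dTC m l k : pderiv m (fun y => T y l k) y0 = pderiv l (fun y => T y m k) y0.
  rewrite !TK; apply: (pderiv_comm _ _ (overlap_open (i := i) (j := j))) => //.
  exact: transition_class_C.
have dFi l : pderiv l (flux i v l) y0 = \det (T y0) * pderiv l (a l) y0 +
   a l y0 * (\det (T y0) * \sum_m \sum_k pderiv l (fun y => T y m k) y0 * invmx (T y0) k m).
  have E : \forall y \near y0, flux i v l y = ((fun y => \det (T y)) * a l) y.
    near=> y.
    have oy : overlap i j y by near: y; exact: overlap_nbhs.
    transitivity (\det (T y) * a l y) => //.
    rewrite (aE _ _ oy) /flux mulrA; congr (_ * _).
    have [iy jy] := (overlapP i j y).1 oy.
    by rewrite (sqrt_det_chart (proj1 (chart_inv_img iy)) jy) (TE _ oy).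
  transitivity ('D_(delta_mx 0 l) ((fun y => \det (T y)) * a l) y0).
    exact: near_eq_derive E.
  pose dd := \matrix_(m, k) pderiv l (fun y => T y m k) y0.
  have dA m k : is_derive y0 (delta_mx 0 l) (fun y => T y m k) (dd m k).
    by rewrite mxE; exact: dT.
  have [_ ->] := is_deriveM (is_derive_det_unit uT dA) (da l l).
  congr (_ + _ *: (_ * _)); apply: eq_bigr => m _; apply: eq_bigr => k _.
  by rewrite mxE.
have dFj k m : \sum_l T y0 m l * pderiv l (flux j v k) x0 =
   \sum_l (a l y0 * pderiv m (fun y => T y l k) y0 + T y0 l k * pderiv m (a l) y0).
  have E : \forall y \near y0, (flux j v k \o tau) y = (\sum_l (a l * (fun y => T y l k))) y.
    near=> y.
    have oy : overlap i j y by near: y; exact: overlap_nbhs.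
    have [iy jy] := (overlapP i j y).1 oy.
    rewrite /= /flux chart_inv_transition// fct_sumE.
    rewrite (vV i j _ (proj1 (chart_inv_img iy)) jy) -(TE _ oy) mxE mulr_sumr.
    by apply: eq_bigr => l _; transitivity (a l y * T y l k) => //; rewrite (aE _ _ oy) mulrA.
  have dd : is_derive y0 (delta_mx 0 m) (\sum_l (a l * (fun y => T y l k)))
     (\sum_l (a l y0 *: pderiv m (fun y => T y l k) y0 + T y0 l k *: pderiv m (a l) y0)).
    by apply: is_derive_sum => l; exact: (is_deriveM (da l m) (dT l k m)).
  have [_ <-] := dd; transitivity (pderiv m (flux j v k \o tau) y0); last first.
    exact: near_eq_derive E.
  rewrite pderiv_comp.
  - rewrite /tau x0E; apply: eq_bigr => l _; congr (_ * _).
    by rewrite [RHS](transition_jacobianE m l oy0) -[RHS]/(pderiv m (fun y => tau y 0 l) y0) -TK.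
  - by move=> l; exact: transition_differentiable.
  - rewrite /tau x0E; apply: class_C_differentiable (flux_class_C j k vC) _.
      exact: img_open.
    by exists p.
(* The chain rule gave [T y0] applied to the wanted derivatives; the inverse matrix isolates
   them. *)
have dFj' k : pderiv k (flux j v k) x0 = \sum_m invmx (T y0) k m *
   \sum_l (a l y0 * pderiv m (fun y => T y l k) y0 + T y0 l k * pderiv m (a l) y0).
  under eq_bigr do rewrite -dFj.
  pose c := \col_l pderiv l (flux j v k) x0.
  transitivity ((invmx (T y0) *m (T y0 *m c)) k 0); first by rewrite mulKmx// mxE.
  rewrite mxE; apply: eq_bigr => m _; congr (_ * _); rewrite mxE.
  by apply: eq_bigr => l _; rewrite mxE.
rewrite /chart_div -/y0 -/x0 (eq_bigr _ (fun l _ => dFi l)) (eq_bigr _ (fun k _ => dFj' k)).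
have /= -> := @divergence_algebra _ _ (T y0) (invmx (T y0)) (\det (T y0))
   (fun l => a l y0) (fun l m => pderiv m (a l) y0)
   (fun m l k => pderiv m (fun y => T y l k) y0) (mulmxV uT) dTC.
rewrite mulrA (sqrt_det_chart ip jp) T0E; congr (_ * _).
by rewrite invfM mulrAC mulVf ?mul1r// gt_eqF// transition_det_gt0.
Unshelve. all: by end_near. Qed.

End Charts.

Lemma laplacian_mul_algebra (K : fieldType) d (s a c : K) (F H u v : 'I_d -> K) :
  s != 0 ->
  s^-1 * \sum_k (a * H k + c * F k + s * (u k + v k)) =
  a * (s^-1 * \sum_k H k) + c * (s^-1 * \sum_k F k) + (\sum_k u k + \sum_k v k).
Proof.
move=> s0; rewrite !big_split/= -!mulr_sumr big_split/=.
by field.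
Qed.

(** * Regularity of the differential operators and product rules *)

Section Regularity.
Context (R : realType) (d : nat) (M : ptopologicalType).
Variables (X : oriented_atlas R d M) (g : riemannian_metric X).
Implicit Types (f h U : M -> R) (v w : vfield R d M) (i j p q : M).

Lemma fun_C_le m n f : (m <= n)%N -> fun_C X n f -> fun_C X m f.
Proof. by move=> mn fC i; apply: class_C_le (fC i). Qed.

Lemma fun_C_cst n (c : R) : fun_C X n (fun=> c).
Proof. by move=> i; apply: class_C_cst; exact: img_open. Qed.

Lemma fun_CD n f h : fun_C X n f -> fun_C X n h -> fun_C X n (fun p => f p + h p).
Proof. by move=> fC hC i; apply: class_CD (fC i) (hC i); exact: img_open. Qed.

Lemma fun_CM n f h : fun_C X n f -> fun_C X n h -> fun_C X n (fun p => f p * h p).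
Proof. by move=> fC hC i; apply: class_CM (fC i) (hC i); exact: img_open. Qed.

Lemma fun_CN n f : fun_C X n f -> fun_C X n (fun p => - f p).
Proof. by move=> fC i; apply: class_CN (fC i); exact: img_open. Qed.

Lemma class_C_chart_continuous i (G : 'rV[R]_d -> R) p :
  class_C 0 (chart X i @` dom X i) G -> dom X i p ->
  {for p, continuous (G \o chart X i)}.
Proof.
move=> GC ip; apply: (@continuous_comp _ _ _ (chart X i) G).
  exact: chart_continuous.
by apply: class_C_continuous GC _; exists p.
Qed.

Lemma fun_C_continuous_dom i f p : fun_C X 0 f -> dom X i p -> {for p, continuous f}.
Proof.
move=> fC ip; have := class_C_chart_continuous (fC i) ip.
rewrite /prop_for /continuous_at /= chartK//; apply: cvg_trans.
apply: near_eq_cvg; near=> q; rewrite /= chartK//.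
by near: q; apply: open_nbhs_nbhs; split => //; exact: dom_open.
Unshelve. all: by end_near. Qed.

Lemma fun_C_continuous f : fun_C X 0 f -> continuous f.
Proof. by move=> fC p; apply: fun_C_continuous_dom (dom_center X p). Qed.

(** A sum of products of scalar functions, through which C^n regularity, measurability and limits
    all pass. *)
Definition metric_form i v w p :=
  \sum_l (\sum_k v i p 0 k * metric g i p k l) * w i p 0 l.

Lemma vdot_form v w i p : is_vfield X v -> is_vfield X w -> dom X i p ->
  vdot g v w p = metric_form i v w p.
Proof.
move=> Hv Hw ip; rewrite (vdot_chart g Hv Hw ip) /metric_form mxE.
by apply: eq_bigr => l _; rewrite !mxE.
Qed.

Lemma vdot_fun_C n v w : vfield_C X n v -> vfield_C X n w -> fun_C X n (vdot g v w).
Proof.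
move=> [Hv vC] [Hw wC] i; have oW := @img_open _ _ _ X i.
apply: (@class_C_eq _ _ _ _ (metric_form i v w \o chart_inv X i)) => //.
  by move=> y /chart_inv_img[iy _]; rewrite /= (vdot_form Hv Hw iy).
apply: class_C_sum => // l; apply: class_CM => //; apply: class_C_sum => // k.
by apply: class_CM => //; exact: metric_smooth.
Qed.

Lemma grad_vfield_C n f : fun_C X n.+1 f -> vfield_C X n (grad g f).
Proof.
move=> fC; split; first exact: grad_is_vfield fC.
move=> i k; have oW := @img_open _ _ _ X i.
apply: (@class_C_eq _ _ _ _ (fun y => \sum_l pderiv l (f \o chart_inv X i) y *
    invmx (metric g i (chart_inv X i y)) l k)) => //.
  move=> y /chart_inv_img[iy yE]; rewrite /grad mxE.
  by apply: eq_bigr => l _; rewrite mxE yE.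
apply: class_C_sum => // l; apply: class_CM => //; first exact: class_C_pderiv.
apply: class_C_invmx => //; first by move=> y /chart_inv_img[iy _]; exact: metric_unit.
by move=> a c; exact: metric_smooth.
Qed.

Lemma divergenceE v p : divergence g v p = chart_div g p v p.
Proof. by []. Qed.

(** Invariance replaces the chart indexed by the moving point by the fixed chart [i], where the
    expression is visibly continuous. *)
Lemma divergence_fun_C v : vfield_C X 1 v -> fun_C X 0 (divergence g v).
Proof.
move=> vC i; have oW := @img_open _ _ _ X i.
apply: (@class_C_eq _ _ _ _ (fun y => (sqrt_det g i (chart_inv X i y))^-1 *
    \sum_k pderiv k (flux g i v k) y)) => //.
  move=> y /chart_inv_img[iy yE]; rewrite /= divergenceE.
  by rewrite -(chart_divE g vC iy (dom_center X _)) /chart_div yE.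
apply: class_CM => //.
  apply: class_CV => //; last exact: sqrt_det_class_C.
  by move=> y /chart_inv_img[iy _]; rewrite gt_eqF// sqrt_det_gt0.
apply: class_C_sum => // k; apply: class_C_pderiv; exact: flux_class_C.
Qed.

Lemma generator_fun_C U f : fun_C X 1 U -> fun_C X 2 f ->
  fun_C X 0 (generator g U f).
Proof.
move=> UC fC; have f1 := fun_C_le (leqnSn 1) fC.
apply: fun_CD; first by apply: divergence_fun_C; exact: grad_vfield_C.
by apply: fun_CN; apply: vdot_fun_C; exact: grad_vfield_C.
Qed.

Lemma vdotC v w p : vdot g v w p = vdot g w v p.
Proof.
have E (A : 'M[R]_1) : A 0 0 = A^T 0 0 by rewrite mxE.
by rewrite /vdot E !trmx_mul trmxK (@Defs.metric_sym _ _ _ _ g _ _ (dom_center X p)) mulmxA.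
Qed.

Lemma vdotBr v w w' p : vdot g v (w \- w') p = vdot g v w p - vdot g v w' p.
Proof. by rewrite /vdot [(_ \- _) p p]/(_ - _) linearB/= mulmxBr !mxE. Qed.

Lemma vdotBl v v' w p : vdot g (v \- v') w p = vdot g v w p - vdot g v' w p.
Proof. by rewrite vdotC vdotBr ![vdot g w _ p]vdotC. Qed.

Lemma vdot_ge0 v p : 0 <= vdot g v v p.
Proof.
rewrite /vdot; have [->|v0] := eqVneq (v p p) 0; first by rewrite !mul0mx mxE.
by apply/ltW/metric_pos => //; exact: dom_center.
Qed.

Lemma vdot_gradl f v p : vdot g (grad g f) v p =
  \sum_k pderiv k (f \o chart_inv X p) (chart X p p) * v p p 0 k.
Proof.
rewrite /vdot /grad mulmxKV; last exact: (metric_unit g (dom_center X p)).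
rewrite mxE.
by apply: eq_bigr => k _; rewrite !mxE.
Qed.

Lemma fun_C_is_derive n i f p k : fun_C X n.+1 f -> dom X i p ->
  is_derive (chart X i p) (delta_mx 0 k) (f \o chart_inv X i)
    (pderiv k (f \o chart_inv X i) (chart X i p)).
Proof. by move=> fC ip; apply: class_C_is_derive (fC i) _; exists p. Qed.

Lemma grad_mul f h i p : fun_C X 1 f -> fun_C X 1 h -> dom X i p ->
  grad g (f \* h) i p = f p *: grad g h i p + h p *: grad g f i p.
Proof.
move=> fC hC ip; rewrite /grad !scalemxAl -mulmxDl; congr (_ *m _).
apply/rowP => k; rewrite !mxE.
have [_] := is_deriveM (fun_C_is_derive k fC ip) (fun_C_is_derive k hC ip).
by rewrite /= chartK.
Qed.

Lemma flux_grad_mul f h i k y : fun_C X 1 f -> fun_C X 1 h ->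
  (chart X i @` dom X i) y ->
  flux g i (grad g (f \* h)) k y =
  f (chart_inv X i y) * flux g i (grad g h) k y +
  h (chart_inv X i y) * flux g i (grad g f) k y.
Proof.
move=> fC hC /chart_inv_img[iy _].
rewrite /flux grad_mul// !mxE; ring.
Qed.

(** The flux of the gradient of a product is [f] times the flux of [grad g h] plus [h] times that of
    [grad g f]. Each of the two, differentiated once more, contributes one copy of the inner product
    of the gradients. *)
Lemma laplacian_mul f h p : fun_C X 2 f -> fun_C X 2 h ->
  laplacian g (f \* h) p = f p * laplacian g h p + h p * laplacian g f p
    + 2 * vdot g (grad g f) (grad g h) p.
Proof.
move=> fC hC; have f1 := fun_C_le (leqnSn 1) fC; have h1 := fun_C_le (leqnSn 1) hC.
have pp := dom_center X p.
rewrite /laplacian !divergenceE /chart_div.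
have dflux u k : fun_C X 2 u -> is_derive (chart X p p) (delta_mx 0 k)
    (flux g p (grad g u) k) (pderiv k (flux g p (grad g u) k) (chart X p p)).
  move=> uC; apply: class_C_is_derive (flux_class_C g p k (grad_vfield_C uC)) _.
  by exists p.
have E k : pderiv k (flux g p (grad g (f \* h)) k) (chart X p p) =
   f p * pderiv k (flux g p (grad g h) k) (chart X p p)
   + h p * pderiv k (flux g p (grad g f) k) (chart X p p)
   + sqrt_det g p p * (pderiv k (f \o chart_inv X p) (chart X p p) * grad g h p p 0 k
   + pderiv k (h \o chart_inv X p) (chart X p p) * grad g f p p 0 k).
  transitivity ('D_(delta_mx 0 k) ((f \o chart_inv X p) * flux g p (grad g h) k
      + (h \o chart_inv X p) * flux g p (grad g f) k) (chart X p p)).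
    apply: near_eq_derive; near=> y; rewrite (flux_grad_mul _ f1 h1)//.
    by near: y; exact: chart_nbhs.
  have [_ H] := is_deriveD
    (is_deriveM (fun_C_is_derive k f1 pp) (dflux h k hC))
    (is_deriveM (fun_C_is_derive k h1 pp) (dflux f k fC)).
  rewrite [LHS]H {H}.
  have fluxE v : flux g p v k (chart X p p) = sqrt_det g p p * v p p 0 k.
    by rewrite /flux chartK.
  have -> : (f \o chart_inv X p) (chart X p p) = f p by rewrite /= chartK.
  have -> : (h \o chart_inv X p) (chart X p p) = h p by rewrite /= chartK.
  rewrite !fluxE.
  move: (pderiv k (flux _ _ (grad g f) k) _) (pderiv k (flux _ _ (grad g h) k) _).
  move: (pderiv k (f \o _) _) (pderiv k (h \o _) _) (grad g f p p 0 k) (grad g h p p 0 k).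
  move=> a1 a2 a3 a4 a5 a6.
  transitivity (f p * a6 + sqrt_det g p p * a4 * a1 + (h p * a5 + sqrt_det g p p * a3 * a2)) => //.
  ring.
have s0 : sqrt_det g p p != 0 by rewrite gt_eqF// sqrt_det_gt0.
apply: (etrans (congr1 (fun z => (sqrt_det g p p)^-1 * z) (eq_bigr _ (fun k _ => E k)))).
refine (etrans (laplacian_mul_algebra _ _ _ _ _ _ s0) _).
rewrite mulr_natl mulr2n [in X in _ = _ + (_ + X)]vdotC !vdot_gradl.
reflexivity.
Unshelve. all: by end_near. Qed.

(** The drift term is a derivation, so the cross term is that of the Laplacian. *)
Lemma generator_mul U f h p : fun_C X 2 f -> fun_C X 2 h ->
  generator g U (f \* h) p = f p * generator g U h p + h p * generator g U f p
    + 2 * vdot g (grad g f) (grad g h) p.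
Proof.
move=> fC hC; have f1 := fun_C_le (leqnSn 1) fC; have h1 := fun_C_le (leqnSn 1) hC.
rewrite /generator laplacian_mul//.
have -> : vdot g (grad g U) (grad g (f \* h)) p =
    f p * vdot g (grad g U) (grad g h) p + h p * vdot g (grad g U) (grad g f) p.
  rewrite /vdot grad_mul//; last exact: dom_center.
  move: (grad g f p p) (grad g h p p) (grad g U p p) => A C u.
  by rewrite linearD/= !linearZ/= mulmxDr -!scalemxAr !mxE.
move: (laplacian g h p) (laplacian g f p) (vdot g (grad g f) (grad g h) p).
move: (vdot g (grad g U) (grad g h) p) (vdot g (grad g U) (grad g f) p).
by move=> a1 a2 a3 a4 a5; ring.
Qed.

End Regularity.

(** * Borel measurability and boundedness on the compact manifold *)

Section BorelMeasurability.
Context (R : realType) (d : nat) (M : ptopologicalType).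
Variables (X : oriented_atlas R d M) (g : riemannian_metric X).
Implicit Types (f : M -> R) (v w : vfield R d M) (i p : M).

Lemma open_measurable_borel (A : set M) : open A -> measurable (A : set (borel M)).
Proof. by move=> oA; exact: sub_sigma_algebra. Qed.

Lemma continuous_measurable_borel (D : set M) f : open D ->
  (forall p, D p -> {for p, continuous f}) ->
  measurable_fun (D : set (borel M)) (f : borel M -> R).
Proof.
move=> oD cf mD; apply: (measurability _ (measurable_realfun.RGenOpens.measurableE R)) => //.
move=> _ [_ [a [b ->] <-]]; apply: open_measurable_borel.
rewrite openE => p [Dp fp]; rewrite /interior.
apply: filterI; first exact: open_nbhs_nbhs.
apply: (cf _ Dp); apply: open_nbhs_nbhs; split => //; exact: interval_open.
Qed.

Hypothesis M_compact : compact [set: M].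

Lemma measurable_dom i : measurable (dom X i : set (borel M)).
Proof. by apply: open_measurable_borel; exact: dom_open. Qed.

Lemma finite_chart_cover :
  exists s : seq M, \big[setU/set0]_(i <- s) dom X i = setT.
Proof.
have : compact [set: M] := M_compact.
rewrite compact_cover => /(_ _ setT (dom X)).
case => [i _|p _|D _ DT]; first exact: dom_open.
  by exists p => //; exact: dom_center.
exists (finmap.enum_fset D); rewrite -bigcup_seq; apply/seteqP; split => // p _.
Qed.

(** The charts are indexed by all points of [M], possibly uncountably many; compactness leaves a
    finite union. *)
Lemma measurable_fun_dom (d' : measure_display) (T : measurableType d')
    (f : borel M -> T) :
  (forall i, measurable_fun (dom X i : set (borel M)) f) -> measurable_fun setT f.
Proof.
move=> H; have [s <-] := finite_chart_cover.
elim: s => [|i s IH]; first by rewrite big_nil; exact: measurable_fun_set0.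
rewrite big_cons; apply/measurable_funU => //; first exact: measurable_dom.
by apply: bigsetU_measurable => j _; exact: measurable_dom.
Qed.

Lemma fun_C_measurable f : fun_C X 0 f -> measurable_fun setT (f : borel M -> R).
Proof.
move=> fC; apply: continuous_measurable_borel; first exact: openT.
by move=> p _; exact: fun_C_continuous fC p.
Qed.

Lemma vfield_C_borel v : vfield_C X 0 v -> vfield_borel X v.
Proof.
move=> [Hv vC]; split => // i k.
apply: continuous_measurable_borel; first exact: dom_open.
move=> p ip; have := class_C_chart_continuous (vC i k) ip.
rewrite /prop_for /continuous_at /= chartK//; apply: cvg_trans.
apply: near_eq_cvg; near=> q; rewrite /= chartK//.
by near: q; apply: open_nbhs_nbhs; split => //; exact: dom_open.
Unshelve. all: by end_near. Qed.

Lemma metric_measurable i k l :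
  measurable_fun (dom X i : set (borel M)) (fun p => metric g i p k l).
Proof.
apply: continuous_measurable_borel; first exact: dom_open.
move=> p ip; have := class_C_chart_continuous (@metric_smooth _ _ _ _ g i k l 0) ip.
rewrite /prop_for /continuous_at /= chartK//; apply: cvg_trans.
apply: near_eq_cvg; near=> q; rewrite /= chartK//.
by near: q; apply: open_nbhs_nbhs; split => //; exact: dom_open.
Unshelve. all: by end_near. Qed.

Lemma measurable_vdot v w : vfield_borel X v -> vfield_borel X w ->
  measurable_fun setT (vdot g v w : borel M -> R).
Proof.
move=> [Hv mv] [Hw mw]; apply: measurable_fun_dom => i.
apply: (@eq_measurable_fun _ _ (borel M) R (dom X i) (metric_form g i v w)).
  by move=> p /set_mem ip; rewrite (vdot_form g Hv Hw ip).
apply: measurable_sum => l; apply: measurable_funM => //.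
apply: measurable_sum => k; apply: measurable_funM => //; exact: metric_measurable.
Qed.

Lemma vfield_borelB v w : vfield_borel X v -> vfield_borel X w ->
  vfield_borel X (v \- w).
Proof.
move=> [Hv mv] [Hw mw]; split => [i j p ip jp|i k].
  have E k : (v \- w) k p = v k p - w k p by [].
  by rewrite !E (Hv _ _ _ ip jp) (Hw _ _ _ ip jp) -mulmxBl.
apply: (eq_measurable_fun (fun p : borel M => v i p 0 k - w i p 0 k)).
  by move=> p _; rewrite -[RHS]/((v i p - w i p) 0 k) !mxE.
exact: measurable_funB.
Qed.

Lemma grad_borel n f : fun_C X n.+1 f -> vfield_borel X (grad g f).
Proof.
move=> /(fun_C_le (ltn0Sn n)) fC; apply: vfield_C_borel; exact: grad_vfield_C.
Qed.

Lemma fun_C_bounded f : fun_C X 0 f -> exists C : R, forall p, `|f p| <= C.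
Proof.
move=> fC; have cf : continuous (fun p => `|f p|).
  by move=> p; apply: cvg_norm; exact: fun_C_continuous fC p.
have [] := @compact_EVT_max M R (fun p => `|f p|) setT => //.
- by exists point.
- by apply: continuous_subspaceT.
- by move=> p _ H; exists `|f p| => q; apply: H; rewrite inE.
Qed.

End BorelMeasurability.

(** * Integration *)

Section FastCauchy.
Context d (T : measurableType d) (R : realType) (mu : {measure set T -> \bar R}).

(** The series of the [4 ^+ n * q n] has a finite integral, so it is finite almost everywhere, and
    its value serves as [C]. With [q] a squared distance of successive terms, the distances decay
    like 2^-n. This is common to functions and to vector fields. *)
Lemma fast_cauchy (q : nat -> T -> R) :
  (forall n, measurable_fun setT (q n)) -> (forall n x, 0 <= q n x) ->
  (forall n, (\int[mu]_x (4 ^+ n * q n x)%:E <= (1 / (2 ^ n.+1)%:R)%:E)%E) ->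
  exists E : set T, [/\ measurable E, mu (~` E) = 0%E &
    forall x, E x -> exists2 C : R, 0 <= C & forall n, q n x <= C * 4^-1 ^+ n].
Proof.
move=> mq q0 iq.
pose f n x : \bar R := (4 ^+ n * q n x)%:E.
have f0 n x : (0 <= f n x)%E by rewrite lee_fin mulr_ge0.
have mf n : measurable_fun setT (f n).
  by apply/measurable_EFinP; apply: measurable_funM => //; exact: measurable_cst.
pose S x := (\sum_(n <oo) f n x)%E.
have mS : measurable_fun setT S by apply: ge0_emeasurable_sum.
have S0 x : (0 <= S x)%E by apply: nneseries_ge0.
have iS : mu.-integrable setT S.
  apply/integrableP; split=> //.
  under eq_integral do rewrite gee0_abs//.
  rewrite integral_nneseries//.
  apply: (@le_lt_trans _ _ (\sum_(n <oo) (1 / (2 ^ n.+1)%:R)%:E)%E).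
    by apply: lee_nneseries => [n _ _|n _]; [exact: integral_ge0|exact: iq].
  apply: (@le_lt_trans _ _ 1%:E); last exact: ltry.
  (* Applied to the zero sequence, this sums the weights 1 / 2^(n+1) to at most 1. *)
  have := @epsilon_trick R (fun=> 0%E) 1 xpredT (fun=> lexx _) ler01.
  rewrite [X in (_ <= X + _)%E -> _]eseries0// add0e; apply: le_trans.
  by rewrite le_eqVlt; apply/orP; left; apply/eqP; apply: eq_eseriesr => n _; rewrite add0e.
pose E := [set x | S x \is a fin_num].
have mE : measurable E.
  by rewrite -[E]setTI; exact: emeasurable_fin_num.
exists E; split => //.
  have : mu.-negligible (~` E).
    have := integrable_ae measurableT iS.
    by apply: negligibleS => x /= Ex H; apply: Ex; exact: H.
  by move/negligibleP; apply; exact: measurableC.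
move=> x Ex; exists (fine (S x)); first exact: fine_ge0.
move=> n; rewrite exprVn ler_pdivlMr ?exprn_gt0// mulrC -lee_fin fineK//.
apply: (@le_trans _ _ (\sum_(0 <= i < n.+1) f i x)%E).
  by rewrite big_nat_recr//= leeDr// sume_ge0.
exact: nneseries_lim_ge.
Qed.

(** Fatou's lemma with convergence off a null set and with bounds valid from [N] on, handled by
    shifting the sequence. *)
Lemma fatou_le (E : set T) (F : nat -> T -> R) (G : T -> R) (e : R) (N : nat) :
  measurable E -> mu (~` E) = 0%E ->
  (forall n, measurable_fun setT (F n)) -> (forall n x, 0 <= F n x) ->
  measurable_fun setT G -> (forall x, 0 <= G x) ->
  (forall x, E x -> F ^~ x @ \oo --> G x) ->
  (forall n, (N <= n)%N -> (\int[mu]_x (F n x)%:E <= e%:E)%E) ->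
  (\int[mu]_x (G x)%:E <= e%:E)%E.
Proof.
move=> mE E0 mF F0 mG G0 FG Fe.
have TE : setT `\` ~` E = E by rewrite setTD setCK.
have mGE : measurable_fun setT (EFin \o G) by exact/measurable_EFinP.
have mFE n : measurable_fun setT (EFin \o F n) by exact/measurable_EFinP.
rewrite (@ge0_negligible_integral _ _ _ mu _ (~` E))//; last first.
- by move=> x _; rewrite lee_fin.
- exact: measurableC.
rewrite TE.
pose H n x := (F (n + N)%N x)%:E.
have HG x : E x -> limn_einf (H ^~ x) = (G x)%:E.
  move=> Ex; have [] // := @cvg_limn_einf_sup _ (H ^~ x) (G x)%:E _.
  apply: cvg_EFin; first by near=> n.
  have := FG _ Ex; rewrite -(cvg_shiftn N) => h; exact: h.
rewrite (_ : (\int[mu]_(x in E) _)%E = (\int[mu]_(x in E) limn_einf (H ^~ x))%E); last first.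
  by apply: eq_integral => x /set_mem /HG.
apply: (@le_trans _ _ (limn_einf (fun n => \int[mu]_(x in E) H n x)%E)).
  apply: fatou => // n; last by move=> x _; rewrite lee_fin.
  exact: measurable_funS (mFE _).
have He n : (\int[mu]_(x in E) H n x <= e%:E)%E.
  apply: le_trans (Fe (n + N)%N (leq_addl _ _)).
  apply: ge0_subset_integral => //; first exact: (mFE (n + N)%N).
  by move=> x _; rewrite lee_fin.
rewrite limn_einf_lim; apply: lime_le; first exact: is_cvg_einfs.
near=> n; apply: (@le_trans _ _ (\int[mu]_(x in E) H n x)%E).
  by apply: ereal_inf_lbound; exists n => //=.
exact: He.
Unshelve. all: by end_near. Qed.

End FastCauchy.

Section Sequences.
Context (R : realType).

Lemma geometric_is_cvgn (u : nat -> R) (C : R) :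
  (forall n, `|u n.+1 - u n| <= C * 2^-1 ^+ n) -> cvgn u.
Proof.
move=> H.
have cs : cvgn (series (fun n => u n.+1 - u n)).
  apply: normed_cvg.
  have C0 : 0 <= C by have := H 0; rewrite expr0 mulr1; exact: le_trans.
  apply: (@series_le_cvg _ _ (geometric C 2^-1)) => //.
  - by move=> n; exact: normr_ge0.
  - by move=> n; rewrite /= mulr_ge0// exprn_ge0.
  - by apply: is_cvg_geometric_series; rewrite ger0_norm ?invf_lt1// ltr1n.
have -> : u = (fun n => u 0 + series (fun n => u n.+1 - u n) n).
  apply/funext => n; rewrite /series/= telescope_sumr//; ring.
by apply: is_cvgD => //; exact: is_cvg_cst.
Qed.

Lemma fast_subsequence (a : nat -> nat -> R) (delta : nat -> R) :
  (forall k, 0 < delta k) ->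
  (forall e, 0 < e -> exists N, forall m n, (N <= m)%N -> (N <= n)%N -> a m n < e) ->
  exists s : nat -> nat, (forall k, (k <= s k)%N) /\
    forall k, a (s k.+1) (s k) < delta k.
Proof.
move=> d0 H.
have /choice[N HN] : forall k, exists N, forall m n, (N <= m)%N -> (N <= n)%N ->
  a m n < delta k by move=> k; exact: H.
(* The maximum includes [N k] at rank [k] and still at rank [k.+1]; the summand [k] makes the
   indices tend to infinity. *)
exists (fun k => k + \max_(j < k.+1) N j)%N; split=> [k|k]; first exact: leq_addr.
apply: HN; apply: (leq_trans _ (leq_addl _ _)).
  by apply: (@leq_bigmax_cond _ _ (fun j : 'I_k.+2 => N j) (widen_ord (leqnSn _) ord_max)).
by apply: (@leq_bigmax_cond _ _ (fun j : 'I_k.+1 => N j) ord_max).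
Qed.

End Sequences.

Lemma discriminant_le (R : realFieldType) (a b c : R) : 0 <= a -> 0 <= c ->
  (forall t, 0 <= t ^+ 2 * a + 2 * t * b + c) -> b ^+ 2 <= a * c.
Proof.
move=> a0 c0 key; have [aE|an0] := eqVneq a 0.
  rewrite aE in key *; rewrite mul0r; suff -> : b = 0 by rewrite expr0n.
  apply/eqP; apply: contraT => b0.
  (* For [a = 0] the polynomial is affine, and at this point it would equal -1. *)
  have := key (- (c + 1) / (2 * b)).
  have -> : (- (c + 1) / (2 * b)) ^+ 2 * 0 + 2 * (- (c + 1) / (2 * b)) * b + c = -1.
    by field.
  by rewrite oppr_ge0 ler10.
have ap : 0 < a by rewrite lt_neqAle eq_sym an0.
(* The minimum of the polynomial. *)
have := key (- b / a).
have -> : (- b / a) ^+ 2 * a + 2 * (- b / a) * b + c = c - b ^+ 2 / a by field.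
by rewrite subr_ge0 ler_pdivrMr// mulrC.
Qed.

(** Semidefiniteness is all that is assumed, since [inner] vanishes on functions that are zero
    almost everywhere. *)
Lemma semi_cauchy_schwarz (R : realFieldType) (V : lmodType R) (ip : V -> V -> R) :
  (forall u v, ip u v = ip v u) ->
  (forall a u v w, ip (a *: u + v) w = a * ip u w + ip v w) ->
  (forall u, 0 <= ip u u) ->
  forall u v, ip u v ^+ 2 <= ip u u * ip v v.
Proof.
move=> ipC ipP ip_ge0 u v; apply: discriminant_le => // t.
have := ip_ge0 (t *: u + v).
by rewrite ipP [ip u _]ipC [ip v _]ipC !ipP [ip v u]ipC; congr (_ <= _); ring.
Qed.

(** * The space L^2 and its completeness *)

Section L2space.
Context (R : realType) (M : ptopologicalType) (pi : probability (borel M) R).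
Local Notation L2 := (L2 pi).
Implicit Types u v w : L2.

Lemma L2P u : (u : borel M -> R) \in Lfun pi 2%:E.
Proof. exact: LfunP. Qed.

Lemma L2_measurable u : measurable_fun setT (u : borel M -> R).
Proof. by have := L2P u; rewrite inE => /andP[+ _]; rewrite inE. Qed.

Lemma L2_mul_integrable u v :
  pi.-integrable setT (fun p : borel M => (u p * v p)%:E).
Proof. by have /Lfun1_integrable := Lfun2_mul_Lfun1 (L2P u) (L2P v). Qed.

Lemma integral_inner u v : (\int[pi]_p (u p * v p)%:E)%E = (inner pi u v)%:E.
Proof.
rewrite /inner /Rintegral fineK//.
have := integrable_fin_num measurableT (L2_mul_integrable u v); exact.
Qed.

Lemma innerC u v : inner pi u v = inner pi v u.
Proof. by apply: eq_Rintegral => p _; rewrite mulrC. Qed.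

Lemma innerP (a : R) u v w : inner pi (a *: u + v) w = a * inner pi u w + inner pi v w.
Proof.
rewrite /inner -RintegralZl//; last exact: L2_mul_integrable.
rewrite -RintegralD//; last 2 first.
- exact: (integrableZl measurableT a (L2_mul_integrable u w)).
- exact: L2_mul_integrable.
apply: eq_Rintegral => p _.
by rewrite -[(a *: u + v : L2) p]/(a * u p + v p) mulrDl mulrA.
Qed.

Lemma inner_ge0 u : 0 <= inner pi u u.
Proof. by apply: Rintegral_ge0 => p _; rewrite -expr2 sqr_ge0. Qed.

Lemma inner0l w : inner pi (0 : L2) w = 0.
Proof.
have := innerP 1 0 0 w; rewrite scale1r addr0 mul1r => h.
by apply: (addrI (inner pi (0 : L2) w)); rewrite addr0 -h.
Qed.

Lemma innerDl u v w : inner pi (u + v : L2) w = inner pi u w + inner pi v w.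
Proof. by have := innerP 1 u v w; rewrite scale1r mul1r. Qed.

Lemma innerZl (a : R) u w : inner pi (a *: u : L2) w = a * inner pi u w.
Proof. by have := innerP a u 0 w; rewrite addr0 inner0l addr0. Qed.

Lemma innerNl u w : inner pi (- u : L2) w = - inner pi u w.
Proof. by rewrite -scaleN1r innerZl mulN1r. Qed.

Lemma innerBl u v w : inner pi (u - v : L2) w = inner pi u w - inner pi v w.
Proof. by rewrite innerDl innerNl. Qed.

Lemma innerDr u v w : inner pi w (u + v : L2) = inner pi w u + inner pi w v.
Proof. by rewrite innerC innerDl !(innerC w). Qed.

Lemma innerZr (a : R) u w : inner pi w (a *: u : L2) = a * inner pi w u.
Proof. by rewrite innerC innerZl innerC. Qed.

Lemma innerBr u v w : inner pi w (u - v : L2) = inner pi w u - inner pi w v.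
Proof. by rewrite innerC innerBl !(innerC w). Qed.

Lemma inner_suml (I : Type) (r : seq I) (F : I -> L2) w :
  inner pi (\sum_(i <- r) F i : L2) w = \sum_(i <- r) inner pi (F i) w.
Proof.
elim: r => [|i r IH]; first by rewrite !big_nil inner0l.
by rewrite !big_cons innerDl IH.
Qed.

Lemma cauchy_schwarz u v : inner pi u v ^+ 2 <= inner pi u u * inner pi v v.
Proof.
exact: (@semi_cauchy_schwarz _ _ (fun u v : L2 => inner pi u v) innerC innerP inner_ge0).
Qed.

Lemma Lnorm2_inner u :
  ('N[pi]_2%:E[EFin \o u])%E = (Num.sqrt (inner pi u u))%:E.
Proof.
rewrite unlock /Lnorm/= -powR12_sqrt ?inner_ge0// -poweR_EFin -integral_inner.
congr (_ `^ _)%E; apply: eq_integral => p _.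
by rewrite /= powR_mulrn// real_normK ?num_real// expr2.
Qed.

Lemma inner_eq0_ae u : inner pi u u = 0 -> (u : M -> R) = cst 0 %[ae pi].
Proof.
move=> u0.
have /= := @ae_eq_integral_abs _ (borel M) R pi setT measurableT
  (fun p => (u p * u p)%:E).
have mu2 : measurable_fun [set: borel M] (fun p : borel M => (u p * u p)%:E).
  exact: (measurable_int pi (L2_mul_integrable u u)).
move=> /(_ mu2) [H _].
have : ae_eq pi setT (fun p : borel M => (u p * u p)%:E) (cst 0%E).
  apply: H; transitivity (\int[pi]_p (u p * u p)%:E)%E.
    by apply: eq_integral => p _; rewrite ger0_norm// -expr2 sqr_ge0.
  by rewrite integral_inner u0.
case=> N [mN N0 sub]; exists N; split => // p /= h; apply: sub => /= h2; apply: h => _.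
by have [/eqP] := h2 Logic.I; rewrite mulf_eq0 orbb => /eqP.
Qed.

Lemma ae_eq_inner (f f' h : M -> R) : f = f' %[ae pi] ->
  measurable_fun setT (f : borel M -> R) -> measurable_fun setT (f' : borel M -> R) ->
  measurable_fun setT (h : borel M -> R) -> inner pi f h = inner pi f' h.
Proof.
move=> ff' mf mf' mh; rewrite /inner /Rintegral; congr fine.
apply: ae_eq_integral => //.
- by apply/measurable_EFinP; exact: measurable_funM.
- by apply/measurable_EFinP; exact: measurable_funM.
case: ff' => N [mN N0 sub]; exists N; split => // p /= hp; apply: sub => /= h2; apply: hp => _.
by rewrite h2.
Qed.

Lemma ae_inner u v w : (u : M -> R) = v %[ae pi] -> inner pi u w = inner pi v w.
Proof. by move=> uv; apply: ae_eq_inner uv _ _ _; exact: L2_measurable. Qed.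

Lemma mkL2 (f : M -> R) : measurable_fun setT (f : borel M -> R) ->
  (\int[pi]_p (f p * f p)%:E < +oo)%E -> exists u : L2, u = f :> (M -> R).
Proof.
move=> mf fi.
have fL : (f : borel M -> R) \in Lfun pi 2%:E.
  rewrite inE; apply/andP; split; first by rewrite inE.
  rewrite inE /= /finite_norm unlock /Lnorm poweR_lty//.
  apply: le_lt_trans fi; rewrite le_eqVlt; apply/orP; left; apply/eqP.
  apply: eq_integral => p _.
  by rewrite /= powR_mulrn// real_normK ?num_real// expr2.
by exists (Lfun_Sub (lee1n 2) fL); rewrite Lfun_valP.
Qed.

Lemma mkL2_bounded (f : M -> R) (C : R) : measurable_fun setT (f : borel M -> R) ->
  (forall p, `|f p| <= C) -> exists u : L2, u = f :> (M -> R).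
Proof.
move=> mf fC; apply: mkL2 => //.
apply: (@le_lt_trans _ _ (\int[pi]_p (C ^+ 2)%:E)%E).
  apply: ge0_le_integral => //.
  - by move=> p _; rewrite lee_fin -expr2 sqr_ge0.
  - by apply/measurable_EFinP; exact: measurable_funM.
  - move=> p _; rewrite lee_fin -expr2 -real_normK ?num_real//.
    by rewrite ler_sqr ?nnegrE//; apply: le_trans (fC p).
by rewrite integral_cst// [X in (_ * X)%E](probability_setT pi) mule1 ltry.
Qed.

Lemma l2cvgP (f : nat -> L2) u : l2cvg pi f u <->
  forall e : R, 0 < e -> exists N, forall n, (N <= n)%N -> inner pi (f n - u : L2) (f n - u : L2) < e.
Proof.
rewrite /l2cvg.
have -> : (fun n => 'N[pi]_2%:E[EFin \o ((f n : M -> R) \- u)%R])%E =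
   (fun n => (Num.sqrt (inner pi (f n - u : L2) (f n - u : L2)))%:E).
  by apply/funext => n; rewrite -Lnorm2_inner.
split.
  move=> /fine_cvgP[_] /cvgrPdist_lt H e e0.
  have /H[N _ HN] : 0 < Num.sqrt e by rewrite sqrtr_gt0.
  exists N => n /HN; rewrite /= sub0r normrN ger0_norm ?sqrtr_ge0//.
  by rewrite ltr_sqrt.
move=> H; apply/fine_cvgP; split; first by near=> n.
apply/cvgrPdist_lt => e e0.
have [|N HN] := H (e ^+ 2); first by rewrite exprn_gt0.
exists N => // n /= Nn; rewrite sub0r normrN ger0_norm ?sqrtr_ge0//.
by rewrite -(ger0_norm (ltW e0)) -sqrtr_sqr ltr_sqrt ?exprn_gt0//; exact: HN.
Unshelve. all: by end_near. Qed.

(** A rapidly converging subsequence has a limit almost everywhere, and Fatou's lemma turns the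
    Cauchy bounds into distances to that limit. *)
Lemma L2_complete (u : nat -> L2) :
  (forall e : R, 0 < e -> exists N, forall m n, (N <= m)%N -> (N <= n)%N ->
     inner pi (u m - u n : L2) (u m - u n : L2) < e) ->
  exists w, forall e : R, 0 < e -> exists N, forall n, (N <= n)%N ->
     inner pi (u n - w : L2) (u n - w : L2) <= e.
Proof.
move=> uC.
(* Chosen so that [4 ^+ k * delta k] is 1 / 2^(k+1), the bound required by [fast_cauchy]. *)
pose delta k : R := (4 ^+ k * (2 ^ k.+1)%:R)^-1.
have d0 k : 0 < delta k by rewrite invr_gt0 mulr_gt0// ?exprn_gt0// ltr0n expn_gt0.
have [s [sk sd]] := fast_subsequence d0 uC.
pose v k := u (s k).
pose q k (p : borel M) := (v k.+1 p - v k p) ^+ 2.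
have mv k : measurable_fun setT (v k : borel M -> R) by exact: L2_measurable.
have mq k : measurable_fun setT (q k).
  by apply: measurable_funX; exact: measurable_funB.
have q0 k p : 0 <= q k p by exact: sqr_ge0.
have iq k : (\int[pi]_p (4 ^+ k * q k p)%:E <= (1 / (2 ^ k.+1)%:R)%:E)%E.
  under eq_integral do rewrite EFinM.
  rewrite ge0_integralZl//; last 2 first.
  - exact/measurable_EFinP.
  - by move=> p _; rewrite lee_fin.
  have -> : (\int[pi]_p (q k p)%:E)%E = (inner pi (v k.+1 - v k : L2) (v k.+1 - v k : L2))%:E.
    by rewrite -integral_inner; apply: eq_integral => p _; rewrite /q expr2.
  rewrite -EFinM lee_fin mulrC -ler_pdivlMr ?exprn_gt0//.
  by rewrite mul1r -invfM mulrC ltW// sd.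
have [E [mE E0 Eq]] := fast_cauchy mq q0 iq.
have cE p : E p -> cvgn (fun k => v k p).
  move=> /Eq[C C0 HC]; apply: (@geometric_is_cvgn _ _ (Num.sqrt C)) => k.
  have := HC k; rewrite /q -ler_sqrt; last by rewrite mulr_ge0// exprn_ge0.
  rewrite sqrtr_sqr sqrtrM// => /le_trans; apply; rewrite ler_wpM2l ?sqrtr_ge0//.
  rewrite -(ger0_norm (exprn_ge0 _ (_ : 0 <= 2^-1)))// -sqrtr_sqr -exprM mulnC exprM.
  by rewrite (_ : 2^-1 ^+ 2 = 4^-1 :> R) //; field.
(* The indicator makes the sequence converge at every point, so that the limit is measurable. *)
pose w p := limn (fun k => \1_E p * v k p).
have cw p : (fun k => \1_E p * v k p) @ \oo --> w p.
  have : cvgn (fun k => \1_E p * v k p); last by [].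
  rewrite indicE; have [/set_mem pE|_] := boolP (p \in E).
    by under eq_fun do rewrite mul1r; exact: cE.
  by under eq_fun do rewrite mul0r; exact: is_cvg_cst.
have mw : measurable_fun setT (w : borel M -> R).
  apply: (@measurable_fun_cvg _ _ _ _ (fun k (p : borel M) => \1_E p * v k p)) => //.
  by move=> k; apply: measurable_funM.
have cEw p : E p -> (fun k => v k p) @ \oo --> w p.
  move=> Ep; have := cw p; rewrite indicE mem_set//.
  by under eq_fun do rewrite mul1r.
have key e : 0 < e -> exists N, forall n, (N <= n)%N ->
    (\int[pi]_p ((u n p - w p) ^+ 2)%:E <= e%:E)%E.
  move=> e0; have [N HN] := uC e e0; exists N => n Nn.
  apply: (@fatou_le _ _ _ pi E (fun k (p : borel M) => (u n p - v k p) ^+ 2) _ e N) => //.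
  - move=> k; apply: measurable_funX; apply: measurable_funB => //; exact: L2_measurable.
  - by move=> k p; exact: sqr_ge0.
  - by apply: measurable_funX; apply: measurable_funB => //; exact: L2_measurable.
  - by move=> p; exact: sqr_ge0.
  - move=> p Ep; under eq_fun do rewrite expr2; rewrite expr2.
    have h : (fun k => u n p - v k p) @ \oo --> u n p - w p.
      by apply: cvgB; [exact: cvg_cst|exact: cEw].
    exact: cvgM.
  - move=> k Nk.
    have -> : (\int[pi]_p ((u n p - v k p) ^+ 2)%:E)%E = (inner pi (u n - v k : L2) (u n - v k : L2))%:E.
      by rewrite -integral_inner; apply: eq_integral => p _; rewrite expr2.
    rewrite lee_fin ltW// HN//; exact: leq_trans (sk k).
have [N HN] := key 1 ltr01.
(* The square integrability of [w] comes from that of [u N - w], and [w] is recovered as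
   [u N - z]. *)
have [z zE] : exists z : L2, z = (fun p => u N p - w p) :> (M -> R).
  apply: mkL2; first by apply: measurable_funB => //; exact: L2_measurable.
  apply: le_lt_trans (ltry 1); apply: le_trans (HN N (leqnn _)).
  by under eq_integral do rewrite -expr2.
exists (u N - z) => e /key[N' HN']; exists N' => n /HN'.
rewrite -lee_fin -integral_inner; apply: le_trans.
rewrite le_eqVlt; apply/orP; left; apply/eqP; apply: eq_integral => p _.
rewrite -[(u n - (u N - z) : L2) p]/(u n p - (u N p - z p)) zE.
by congr (_%:E); ring.
Qed.

End L2space.

(** * Square-integrable vector fields *)

(** The error in a scalar product when its arguments are replaced by approximations at distances
    [a n] and [b n], [v] and [w] being the norms of the limits. *)
Lemma cvg0_combination (R : realType) (a b : nat -> R) (w v : R) :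
  a @ \oo --> 0 -> b @ \oo --> 0 ->
  (fun n => a n * w + a n * b n + v * b n) @ \oo --> 0.
Proof.
move=> a0 b0.
have h1 : (fun n => a n * w) @ \oo --> 0 * w by apply: cvgM => //; exact: cvg_cst.
have h2 : (fun n => a n * b n) @ \oo --> (0 * 0 : R) by exact: cvgM.
have h3 : (fun n => v * b n) @ \oo --> v * 0 by apply: cvgM => //; exact: cvg_cst.
have -> : 0 = 0 * w + 0 * 0 + v * 0 by rewrite !(mul0r, mulr0, addr0).
by apply: cvgD h3; exact: cvgD.
Qed.

Lemma cvgn_sum (R : realType) (I : Type) (r : seq I) (a : I -> nat -> R) (b : I -> R) :
  (forall i, a i @ \oo --> b i) ->
  (fun n => \sum_(i <- r) a i n) @ \oo --> \sum_(i <- r) b i.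
Proof.
move=> ab; elim: r => [|i r IH].
  by rewrite big_nil; under eq_fun do rewrite big_nil; exact: cvg_cst.
by rewrite big_cons; under eq_fun do rewrite big_cons; exact: cvgD.
Qed.

Section VectorFieldsL2.
Context (R : realType) (d : nat) (M : ptopologicalType).
Variables (X : oriented_atlas R d M) (g : riemannian_metric X).
Variable pi : probability (borel M) R.
Hypothesis M_compact : compact [set: M].
Implicit Types (V W : vfield R d M) (p : M).

Definition vL2 V := vfield_borel X V /\
  pi.-integrable setT (fun p : borel M => (vdot g V V p)%:E).

Definition vinner V W : R := (\int[pi]_p vdot g V W p)%R.

(** The squared length of tV + W. The values [t = 1] and [t = -1] give a pointwise bound on
    [vdot g V W]; integration gives the Cauchy-Schwarz inequality. *)
Lemma vdot_quadratic V W (t : R) p :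
  0 <= t ^+ 2 * vdot g V V p + 2 * t * vdot g V W p + vdot g W W p.
Proof.
have /= := vdot_ge0 g (fun i q => t *: V i q + W i q) p.
have -> : vdot g (fun i q => t *: V i q + W i q) (fun i q => t *: V i q + W i q) p =
   t * (t * vdot g V V p + vdot g W V p) + (t * vdot g V W p + vdot g W W p).
  rewrite /vdot; move: (V p p) (W p p) (metric g p p) => a b G.
  have -> : (t *: a + b)^T = t *: a^T + b^T by apply/matrixP => x y; rewrite !mxE.
  rewrite !mulmxDl -!scalemxAl !mulmxDr -!scalemxAr.
  move: (a *m G *m a^T) (b *m G *m a^T) (a *m G *m b^T) (b *m G *m b^T) => x y z z'.
  by rewrite !mxE; ring.
rewrite [vdot g W V p]vdotC.
by move: (vdot g V V p) (vdot g V W p) (vdot g W W p) => a b c; congr (_ <= _); ring.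
Qed.

Lemma vdot_le V W p : `|vdot g V W p| <= vdot g V V p + vdot g W W p.
Proof.
have := vdot_quadratic V W 1 p; have := vdot_quadratic V W (-1) p.
have := vdot_ge0 g V p; have := vdot_ge0 g W p.
move: (vdot g V V p) (vdot g V W p) (vdot g W W p) => a b c c0 a0 h1 h2.
by rewrite ler_norml; apply/andP; split; lra.
Qed.

Lemma vL2_integrable V W : vL2 V -> vL2 W ->
  pi.-integrable setT (fun p : borel M => (vdot g V W p)%:E).
Proof.
move=> [bV iV] [bW iW].
apply: (@le_integrable _ _ _ pi setT measurableT _
   (fun p : borel M => (vdot g V V p)%:E + (vdot g W W p)%:E)%E).
- by apply/measurable_EFinP; exact: measurable_vdot.
- move=> p _ /=; rewrite lee_fin [leRHS]ger0_norm; first exact: vdot_le.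
  by rewrite addr_ge0 ?vdot_ge0.
- exact: integrableD.
Qed.

Lemma vinnerC V W : vinner V W = vinner W V.
Proof. by apply: eq_Rintegral => p _; rewrite vdotC. Qed.

Lemma vinner_ge0 V : 0 <= vinner V V.
Proof. by apply: Rintegral_ge0 => p _; exact: vdot_ge0. Qed.

Lemma integral_vinner V W : vL2 V -> vL2 W ->
  (\int[pi]_p (vdot g V W p)%:E)%E = (vinner V W)%:E.
Proof.
move=> hV hW; rewrite /vinner /Rintegral fineK//.
have := integrable_fin_num measurableT (vL2_integrable hV hW); exact.
Qed.

Lemma vdot_sub_expand V W p : vdot g (V \- W) (V \- W) p =
  vdot g V V p - 2 * vdot g V W p + vdot g W W p.
Proof.
rewrite vdotBl !vdotBr [vdot g W V p]vdotC.
by move: (vdot g V V p) (vdot g V W p) (vdot g W W p) => a b c; ring.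
Qed.

Lemma vL2B V W : vL2 V -> vL2 W -> vL2 (V \- W).
Proof.
move=> hV hW; have [bV iV] := hV; have [bW iW] := hW.
split; first exact: vfield_borelB.
rewrite (_ : (fun p : borel M => _) = (fun p : borel M =>
   ((vdot g V V p)%:E + (- (2))%:E * (vdot g V W p)%:E) + (vdot g W W p)%:E)%E); last first.
  by apply/funext => p; rewrite vdot_sub_expand -EFinM -!EFinD mulNr.
apply: integrableD => //; apply: integrableD => //.
by apply: integrableZl => //; exact: vL2_integrable.
Qed.

Lemma vinnerBl V V' W : vL2 V -> vL2 V' -> vL2 W ->
  vinner (V \- V') W = vinner V W - vinner V' W.
Proof.
move=> hV hV' hW; rewrite /vinner -RintegralB//; last 2 first.
- exact: vL2_integrable.
- exact: vL2_integrable.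
by apply: eq_Rintegral => p _; rewrite vdotBl.
Qed.

Lemma vinnerBr V W W' : vL2 V -> vL2 W -> vL2 W' ->
  vinner V (W \- W') = vinner V W - vinner V W'.
Proof. by move=> *; rewrite vinnerC vinnerBl// !(vinnerC V). Qed.

Lemma vinner_sub_expand V W : vL2 V -> vL2 W ->
  vinner (V \- W) (V \- W) = vinner V V - 2 * vinner V W + vinner W W.
Proof.
move=> hV hW; rewrite vinnerBl//; last exact: vL2B.
by rewrite !vinnerBr// [vinner W V]vinnerC; ring.
Qed.

Lemma vinner_cs V W : vL2 V -> vL2 W -> vinner V W ^+ 2 <= vinner V V * vinner W W.
Proof.
move=> hV hW; apply: discriminant_le; [exact: vinner_ge0|exact: vinner_ge0|move=> t].
have [iV iW iVW] : [/\ pi.-integrable setT (fun p : borel M => (vdot g V V p)%:E),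
   pi.-integrable setT (fun p : borel M => (vdot g W W p)%:E) &
   pi.-integrable setT (fun p : borel M => (vdot g V W p)%:E)].
  by split; exact: vL2_integrable.
rewrite /vinner -RintegralZl// -(@RintegralZl _ _ _ pi _ _ (2 * t))//.
have i1 : pi.-integrable setT (fun p : borel M => (t ^+ 2 * vdot g V V p)%:E).
  exact: (integrableZl measurableT (t ^+ 2) iV).
have i2 : pi.-integrable setT (fun p : borel M => (2 * t * vdot g V W p)%:E).
  exact: (integrableZl measurableT (2 * t) iVW).
rewrite -RintegralD// -RintegralD//; last first.
  exact: (integrableD measurableT i1 i2).
by apply: Rintegral_ge0 => p _; exact: vdot_quadratic.
Qed.

Lemma vinner_norm V W : vL2 V -> vL2 W ->
  `|vinner V W| <= Num.sqrt (vinner V V) * Num.sqrt (vinner W W).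
Proof.
move=> hV hW; rewrite -sqrtrM ?vinner_ge0// -sqrtr_sqr.
by apply: ler_wsqrtr; exact: vinner_cs.
Qed.

Lemma vinner_limit (F H : nat -> vfield R d M) V W (l : R) :
  (forall n, vL2 (F n)) -> (forall n, vL2 (H n)) -> vL2 V -> vL2 W ->
  vinner (F n \- V) (F n \- V) @[n --> \oo] --> 0 ->
  vinner (H n \- W) (H n \- W) @[n --> \oo] --> 0 ->
  vinner (F n) (H n) @[n --> \oo] --> l -> vinner V W = l.
Proof.
move=> hF hH hV hW FV HW FH.
pose a n := Num.sqrt (vinner (F n \- V) (F n \- V)).
pose b n := Num.sqrt (vinner (H n \- W) (H n \- W)).
have sq0 (u : nat -> R) : u @ \oo --> 0 -> (fun n => Num.sqrt (u n)) @ \oo --> 0.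
  move=> u0; rewrite -[X in _ --> X](@sqrtr0 R).
  by apply: (@cvg_comp _ _ _ u Num.sqrt _ _ _ u0); exact: sqrt_continuous.
have a0 : a @ \oo --> 0 by exact: sq0.
have b0 : b @ \oo --> 0 by exact: sq0.
suff : vinner (F n) (H n) @[n --> \oo] --> vinner V W.
  by move=> h; apply: (cvg_unique _ h FH); exact: Rhausdorff.
pose w := Num.sqrt (vinner W W); pose v := Num.sqrt (vinner V V).
have bound n : `|vinner V W - vinner (F n) (H n)| <= a n * w + a n * b n + v * b n.
  have -> : vinner V W - vinner (F n) (H n) =
    - vinner (F n \- V) W - vinner (F n \- V) (H n \- W) - vinner V (H n \- W).
    rewrite !(vinnerBr _ (hH n) hW)//; last exact: vL2B.
    by rewrite !(vinnerBl (hF n) hV)//; ring.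
  rewrite (le_trans (ler_normB _ _))// lerD//; last by apply: vinner_norm => //; exact: vL2B.
  rewrite (le_trans (ler_normB _ _))// lerD//; last by apply: vinner_norm => //; exact: vL2B.
  by rewrite normrN; apply: vinner_norm => //; exact: vL2B.
apply/cvgrPdist_le => e e0.
have /cvgrPdist_le/(_ _ e0) := cvg0_combination w v a0 b0.
apply: filterS => n; rewrite sub0r normrN => h.
by apply: le_trans (bound n) _; apply: le_trans (ler_norm _) h.
Qed.

(** The k-th coordinate is the metric product with the vector [w] dual to it, so Cauchy-Schwarz for
    the metric applies, with [K] the squared length of [w]. *)
Lemma coord_bound i p k : dom X i p -> exists2 K : R, 0 <= K &
  forall a : 'rV[R]_d, a 0 k ^+ 2 <= K * (a *m metric g i p *m a^T) 0 0.
Proof.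
move=> ip; pose G := metric g i p.
pose w : 'rV[R]_d := delta_mx 0 k *m invmx G.
have pos (a : 'rV[R]_d) : 0 <= (a *m G *m a^T) 0 0.
  have [->|a0] := eqVneq a 0; first by rewrite !mul0mx mxE.
  by apply/ltW; exact: metric_pos.
exists ((w *m G *m w^T) 0 0) => // a.
have -> : a 0 k = (w *m G *m a^T) 0 0.
  by rewrite /w mulmxKV ?metric_unit// -rowE !mxE.
apply: (@semi_cauchy_schwarz _ 'rV[R]_d (fun u v => (u *m G *m v^T) 0 0)) => //.
- move=> u v; have E (A : 'M[R]_1) : A 0 0 = A^T 0 0 by rewrite mxE.
  by rewrite E !trmx_mul trmxK (@Defs.metric_sym _ _ _ _ g _ _ ip) mulmxA.
- by move=> t u v z; rewrite mulmxDl -scalemxAl mulmxDl -scalemxAl !mxE.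
Qed.

(** The scheme of [L2_complete], with [coord_bound] converting metric decay into convergence of
    components. The distances are extended integrals because the limit is not yet known to be
    square-integrable. *)
Lemma vfield_complete (F : nat -> vfield R d M) : (forall n, vL2 (F n)) ->
  (forall e : R, 0 < e -> exists N, forall m n, (N <= m)%N -> (N <= n)%N ->
     vinner (F m \- F n) (F m \- F n) < e) ->
  exists V, vfield_borel X V /\
    forall e : R, 0 < e -> exists N, forall n, (N <= n)%N ->
      (\int[pi]_p (vdot g (F n \- V) (F n \- V) p)%:E <= e%:E)%E.
Proof.
move=> hF FC.
pose delta k : R := (4 ^+ k * (2 ^ k.+1)%:R)^-1.
have d0 k : 0 < delta k by rewrite invr_gt0 mulr_gt0// ?exprn_gt0// ltr0n expn_gt0.
have [s [sk sd]] := fast_subsequence d0 FC.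
pose G k := F (s k).
have hG k : vL2 (G k) by exact: hF.
pose q k (p : borel M) := vdot g (G k.+1 \- G k) (G k.+1 \- G k) p.
have hGG k : vL2 (G k.+1 \- G k) by exact: vL2B.
have mq k : measurable_fun setT (q k) by have [? _] := hGG k; exact: measurable_vdot.
have q0 k p : 0 <= q k p by exact: vdot_ge0.
have iq k : (\int[pi]_p (4 ^+ k * q k p)%:E <= (1 / (2 ^ k.+1)%:R)%:E)%E.
  under eq_integral do rewrite EFinM.
  rewrite ge0_integralZl//; last 2 first.
  - exact/measurable_EFinP.
  - by move=> p _; rewrite lee_fin.
  rewrite integral_vinner// -EFinM lee_fin mulrC -ler_pdivlMr ?exprn_gt0//.
  by rewrite mul1r -invfM mulrC ltW// sd.
have [E [mE E0 Eq]] := fast_cauchy mq q0 iq.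
have cE i p k : dom X i p -> E p -> cvgn (fun n => G n i p 0 k).
  move=> ip Ep; have [C C0 HC] := Eq _ Ep; have [K K0 HK] := coord_bound k ip.
  apply: (@geometric_is_cvgn _ _ (Num.sqrt (K * C))) => n.
  have : (G n.+1 i p 0 k - G n i p 0 k) ^+ 2 <= (K * C) * 4^-1 ^+ n.
    apply: (@le_trans _ _ (K * q n p)); last by rewrite -mulrA ler_wpM2l.
    have [[vGG _] _] := hGG n.
    rewrite /q (vdot_chart g vGG vGG ip).
    by have := HK ((G n.+1 \- G n) i p); rewrite -[(G n.+1 \- G n) i p]/(G n.+1 i p - G n i p) !mxE.
  rewrite -ler_sqrt; last by rewrite mulr_ge0// ?exprn_ge0// mulr_ge0.
  rewrite sqrtr_sqr [Num.sqrt (_ * 4^-1 ^+ n)]sqrtrM ?mulr_ge0// => /le_trans; apply.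
  rewrite ler_wpM2l ?sqrtr_ge0//.
  rewrite -(ger0_norm (exprn_ge0 _ (_ : 0 <= 2^-1)))// -sqrtr_sqr -exprM mulnC exprM.
  by rewrite (_ : 2^-1 ^+ 2 = 4^-1 :> R) //; field.
(* [E] is the same set in all charts: the limit vanishes off [E] in each of them, and the
   transformation law holds at every point. *)
pose V : vfield R d M := fun i p => \row_k limn (fun n => \1_E p * G n i p 0 k).
have cV i p k : dom X i p -> (fun n => \1_E p * G n i p 0 k) @ \oo --> V i p 0 k.
  move=> ip; rewrite mxE.
  have : cvgn (fun n => \1_E p * G n i p 0 k); last by [].
  rewrite indicE; have [/set_mem pE|_] := boolP (p \in E).
    by under eq_fun do rewrite mul1r; exact: cE.
  by under eq_fun do rewrite mul0r; exact: is_cvg_cst.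
have VV : is_vfield X V.
  move=> i j p ip jp; apply/rowP => k.
  have E1 : (fun n => \1_E p * G n j p 0 k) = (fun n =>
      \sum_l (\1_E p * G n i p 0 l) * transition_jacobian X i j p l k).
    apply/funext => n; have [[vG _] _] := hG n.
    rewrite (vG i j p ip jp) mxE mulr_sumr.
    by apply: eq_bigr => l _; rewrite mulrA.
  have main : (fun n => \1_E p * G n j p 0 k) @ \oo -->
      (V i p *m transition_jacobian X i j p) 0 k.
    rewrite E1 mxE.
    by apply: cvgn_sum => l; apply: cvgM; [exact: cV|exact: cvg_cst].
  exact: (cvg_unique (@Rhausdorff R) (cV j p k jp) main).
have bV : vfield_borel X V.
  split=> // i k.
  apply: (@measurable_fun_cvg _ _ _ _ (fun n (p : borel M) => \1_E p * G n i p 0 k)).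
    by move=> n; apply: measurable_funM => //; have [[_ mG] _] := hG n; exact: mG.
  by move=> p ip; exact: cV.
exists V; split => // e e0.
have [N HN] := FC _ e0; exists N => n Nn.
have bFn : vfield_borel X (F n) by have [] := hF n.
have hFG k : vL2 (F n \- G k) by exact: vL2B.
apply: (@fatou_le _ _ _ pi E (fun k (p : borel M) => vdot g (F n \- G k) (F n \- G k) p) _ e N) => //.
- by move=> k; have [? _] := hFG k; exact: measurable_vdot.
- by move=> k p; exact: vdot_ge0.
- by apply: measurable_vdot => //; exact: vfield_borelB.
- by move=> p; exact: vdot_ge0.
- move=> p Ep; have pp := dom_center X p.
  have cVp k : (fun m => (F n \- G m) p p 0 k) @ \oo --> (F n \- V) p p 0 k.
    have E1 (W : vfield R d M) : (F n \- W) p p 0 k = F n p p 0 k - W p p 0 k.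
      by rewrite -[LHS]/((F n p p - W p p) 0 k) !mxE.
    under eq_fun do rewrite E1; rewrite E1.
    apply: cvgB; first exact: cvg_cst.
    by have := cV p p k pp; rewrite indicE mem_set//; under eq_fun do rewrite mul1r.
  have vF : is_vfield X (F n) by case: bFn.
  have vFV : is_vfield X (F n \- V) by have [] := vfield_borelB bFn bV.
  rewrite (vdot_form g vFV vFV pp).
  have E2 k : vdot g (F n \- G k) (F n \- G k) p = metric_form g p (F n \- G k) (F n \- G k) p.
    by have [[vv _] _] := hFG k; exact: vdot_form.
  under eq_fun do rewrite E2.
  have main : (fun m => \sum_l (\sum_k (F n \- G m) p p 0 k * metric g p p k l) *
      (F n \- G m) p p 0 l) @ \oo --> \sum_l (\sum_k (F n \- V) p p 0 k *
      metric g p p k l) * (F n \- V) p p 0 l.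
    apply: cvgn_sum => l; apply: cvgM; last exact: cVp.
    by apply: cvgn_sum => k; apply: cvgM; [exact: cVp|exact: cvg_cst].
  exact: main.
- move=> k Nk; rewrite integral_vinner// lee_fin ltW// HN//; exact: leq_trans (sk k).
Qed.

Lemma smooth_grad_vL2 f : fun_C X 1 f -> vL2 (grad g f).
Proof.
move=> fC; have bf := grad_borel g fC; split => //.
have [C HC] := fun_C_bounded (X := X) M_compact (vdot_fun_C g (grad_vfield_C g fC) (grad_vfield_C g fC)).
apply: (@le_integrable _ _ _ pi setT measurableT _ (cst C%:E)).
- by apply/measurable_EFinP; exact: measurable_vdot.
- by move=> p _; rewrite /= lee_fin (le_trans (HC p))// ler_norm.
- exact: finite_measure_integrable_cst.
Qed.

End VectorFieldsL2.

(** * Eigenfunction expansions *)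

Section L2Limits.
Context (R : realType) (M : ptopologicalType) (pi : probability (borel M) R).
Local Notation L2 := (L2 pi).
Implicit Types u v w : L2.

Lemma inner_norm u v :
  `|inner pi u v| <= Num.sqrt (inner pi u u) * Num.sqrt (inner pi v v).
Proof.
rewrite -sqrtrM ?inner_ge0// -sqrtr_sqr.
by apply: ler_wsqrtr; exact: cauchy_schwarz.
Qed.

Lemma inner_sub_cvg (f : nat -> L2) u :
  (forall e : R, 0 < e -> exists N, forall n, (N <= n)%N ->
     inner pi (f n - u : L2) (f n - u : L2) <= e) <->
  inner pi (f n - u : L2) (f n - u : L2) @[n --> \oo] --> 0.
Proof.
split=> [H|/cvgrPdist_le H e /H[N _ HN]].
  apply/cvgrPdist_le => e /H[N HN]; exists N => // n /= /HN h.
  have i0 : 0 <= inner pi (f n - u : L2) (f n - u : L2) := inner_ge0 _.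
  by rewrite sub0r normrN (ger0_norm i0).
exists N => n /HN /=.
have i0 : 0 <= inner pi (f n - u : L2) (f n - u : L2) := inner_ge0 _.
by rewrite sub0r normrN (ger0_norm i0).
Qed.

Lemma l2cvg_sub_cvg (f : nat -> L2) u : l2cvg pi f u ->
  inner pi (f n - u : L2) (f n - u : L2) @[n --> \oo] --> 0.
Proof.
move=> /l2cvgP H; apply/inner_sub_cvg => e /H[N HN]; exists N => n Nn.
by rewrite ltW// HN.
Qed.

Lemma sqrt_cvg0 (a : nat -> R) : a @ \oo --> 0 -> Num.sqrt (a n) @[n --> \oo] --> 0.
Proof.
move=> a0; rewrite -[X in _ --> X](@sqrtr0 R).
by apply: (@cvg_comp _ _ _ a Num.sqrt _ _ _ a0); exact: sqrt_continuous.
Qed.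

Lemma inner_cvg (f h : nat -> L2) u v :
  inner pi (f n - u : L2) (f n - u : L2) @[n --> \oo] --> 0 ->
  inner pi (h n - v : L2) (h n - v : L2) @[n --> \oo] --> 0 ->
  inner pi (f n) (h n) @[n --> \oo] --> inner pi u v.
Proof.
move=> /sqrt_cvg0 fu /sqrt_cvg0 hv; apply/cvgrPdist_le => e e0.
have /cvgrPdist_le/(_ _ e0) := cvg0_combination (Num.sqrt (inner pi v v))
  (Num.sqrt (inner pi u u)) fu hv.
apply: filterS => n; rewrite sub0r normrN => /(le_trans (ler_norm _)).
apply: le_trans.
have -> : inner pi u v - inner pi (f n) (h n) =
   - inner pi (f n - u : L2) v - inner pi (f n - u : L2) (h n - v : L2)
   - inner pi u (h n - v : L2).
  by rewrite !innerBr !innerBl; ring.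
rewrite (le_trans (ler_normB _ _))// lerD//; last exact: inner_norm.
rewrite (le_trans (ler_normB _ _))// lerD//; last exact: inner_norm.
by rewrite normrN; exact: inner_norm.
Qed.

Lemma inner_cvgl (f : nat -> L2) u v :
  inner pi (f n - u : L2) (f n - u : L2) @[n --> \oo] --> 0 ->
  inner pi (f n) v @[n --> \oo] --> inner pi u v.
Proof.
move=> fu; apply: inner_cvg fu _.
rewrite (_ : (fun _ => _) = fun=> 0); first exact: cvg_cst.
by apply/funext => n; rewrite subrr inner0l.
Qed.

End L2Limits.

Section BoundedSums.
Context (R : realType).
Implicit Types t s : nat -> R.

(** For nonnegative terms this is summability, in a form where comparison involves no limit. *)
Definition bounded_sums t := exists C, forall n, \sum_(0 <= k < n) t k <= C.

Lemma nondecreasing_sums t : (forall k, 0 <= t k) ->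
  nondecreasing_seq (fun n => \sum_(0 <= k < n) t k).
Proof.
move=> t0; apply/nondecreasing_seqP => n.
by rewrite big_nat_recr//= lerDl.
Qed.

Lemma bounded_sums_le t s : (forall k, t k <= s k) -> bounded_sums s -> bounded_sums t.
Proof.
by move=> ts [C HC]; exists C => n; apply: le_trans (HC n); exact: ler_sum.
Qed.

Lemma bounded_sumsD t s : bounded_sums t -> bounded_sums s ->
  bounded_sums (fun k => t k + s k).
Proof.
by move=> [C HC] [D HD]; exists (C + D) => n; rewrite big_split/= lerD.
Qed.

Lemma bounded_sumsZ (c : R) t : 0 <= c -> bounded_sums t -> bounded_sums (fun k => c * t k).
Proof.
by move=> c0 [C HC]; exists (c * C) => n; rewrite -mulr_sumr ler_wpM2l.
Qed.

Lemma bounded_sums_tail t : (forall k, 0 <= t k) -> bounded_sums t ->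
  forall e, 0 < e -> exists N, forall m n, (N <= m)%N -> (m <= n)%N ->
    \sum_(m <= k < n) t k <= e.
Proof.
move=> t0 [C HC] e e0; pose s n := \sum_(0 <= k < n) t k.
have nds : nondecreasing_seq s := nondecreasing_sums t0.
have cs : cvgn s.
  by apply: nondecreasing_is_cvgn => //; exists C => _ [n _ <-]; exact: HC.
have /cvgrPdist_le/(_ _ e0)[N _ HN] := cs.
exists N => m n Nm mn.
have -> : \sum_(m <= k < n) t k = s n - s m.
  by rewrite /s [in RHS](@big_cat_nat _ _ _ m)//= addrAC subrr add0r.
have sn : s n <= limn s by exact: nondecreasing_cvgn_le.
have := HN m Nm => /= /(le_trans (ler_norm _)); apply: le_trans.
by rewrite lerD2r.
Qed.

Lemma cvgn_sums_le t l : (forall k, 0 <= t k) ->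
  (fun n => \sum_(0 <= k < n) t k) @ \oo --> l -> forall n, \sum_(0 <= k < n) t k <= l.
Proof.
move=> t0 tl n; have nds := nondecreasing_sums t0.
have := nondecreasing_cvgn_le nds (cvgP _ tl) n.
by rewrite (cvg_lim _ tl)//; exact: Rhausdorff.
Qed.

Lemma cvgn_le_bound (a : nat -> R) l e : a @ \oo --> l -> (forall n, a n <= e) -> l <= e.
Proof.
move=> al ae; rewrite -(cvg_lim _ al); last exact: Rhausdorff.
by apply: limr_le; [exact: cvgP al|exact: nearW].
Qed.

End BoundedSums.

(** * Coefficients in an orthonormal basis *)

Section Basis.
Context (R : realType) (M : ptopologicalType) (pi : probability (borel M) R).
Local Notation L2 := (L2 pi).
Variable phi : nat -> L2.
Hypothesis phi_orthonormal : forall i j, inner pi (phi i) (phi j) = (i == j)%:R.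
Hypothesis phi_complete : forall u : L2,
  l2cvg pi (fun n => \sum_(0 <= k < n) inner pi u (phi k) *: phi k) u.
Implicit Types u v w : L2.

Definition coef u k := inner pi u (phi k).

Lemma coefP a u v k : coef (a *: u + v) k = a * coef u k + coef v k.
Proof. exact: innerP. Qed.

Lemma coefB u v k : coef (u - v) k = coef u k - coef v k.
Proof. exact: innerBl. Qed.

Lemma coefZ a u k : coef (a *: u) k = a * coef u k.
Proof. exact: innerZl. Qed.

Lemma coef_ae u v k : (u : M -> R) = v %[ae pi] -> coef u k = coef v k.
Proof. exact: ae_inner. Qed.

Lemma coef_sum (a : nat -> R) m n k :
  coef (\sum_(m <= i < n) a i *: phi i) k = if (m <= k < n)%N then a k else 0.
Proof.
rewrite /coef inner_suml.
rewrite (eq_bigr (fun i => if i == k then a k else 0)); last first.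
  move=> i _; rewrite innerZl phi_orthonormal.
  by case: eqVneq => [->|_]; rewrite ?mulr1 ?mulr0.
by rewrite -big_mkcond/= big_nat1_eq.
Qed.

Lemma parseval u v :
  (fun n => \sum_(0 <= k < n) coef u k * coef v k) @ \oo --> inner pi u v.
Proof.
have := @inner_cvgl _ _ _ _ _ v (l2cvg_sub_cvg (phi_complete u)).
under eq_fun do rewrite inner_suml.
rewrite (_ : (fun n => _) = (fun n => \sum_(0 <= k < n) coef u k * coef v k))//.
by apply/funext => n; apply: eq_bigr => k _; rewrite innerZl [inner pi (phi k) v]innerC.
Qed.

Lemma bessel u n : \sum_(0 <= k < n) coef u k ^+ 2 <= inner pi u u.
Proof.
apply: cvgn_sums_le => [k|]; first exact: sqr_ge0.
by have := @parseval u u; under eq_fun do under eq_bigr do rewrite -expr2.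
Qed.

Lemma coef_inj u v : (forall k, coef u k = coef v k) -> (u : M -> R) = v %[ae pi].
Proof.
move=> uv; have w0 : inner pi (u - v : L2) (u - v : L2) = 0.
  have S0 : (fun n => \sum_(0 <= k < n) coef (u - v) k * coef (u - v) k) = fun=> 0.
    by apply/funext => n; rewrite big1// => k _; rewrite coefB uv subrr mul0r.
  have := @parseval (u - v) (u - v); rewrite S0 => h.
  exact: (cvg_unique (@Rhausdorff R) h (cvg_cst _)).
have := inner_eq0_ae w0; case=> N [mN N0 sub]; exists N; split => // p /= hp.
apply: sub => /= h2; apply: hp => _.
by apply/eqP; rewrite -subr_eq0; apply/eqP; exact: h2.
Qed.

Lemma coef_lim (f : nat -> L2) u k :
  inner pi (f n - u : L2) (f n - u : L2) @[n --> \oo] --> 0 ->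
  coef (f n) k @[n --> \oo] --> coef u k.
Proof. exact: inner_cvgl. Qed.

Lemma coef_l2cvg (a : nat -> R) m u k :
  l2cvg pi (fun n => \sum_(m <= i < n) a i *: phi i) u ->
  coef u k = if (m <= k)%N then a k else 0.
Proof.
move=> /l2cvg_sub_cvg/(@coef_lim _ u k) h; apply: (cvg_unique (@Rhausdorff R) h).
apply: cvg_near_cst; exists k.+1 => // n /= kn.
by rewrite coef_sum kn andbT.
Qed.

(** This is how all diagonal operators below are built: it realises prescribed coefficients by a
    function. *)
Lemma riesz_fischer (a : nat -> R) : bounded_sums (fun k => a k ^+ 2) ->
  exists u, forall k, coef u k = a k.
Proof.
move=> ba; pose S n : L2 := \sum_(0 <= k < n) a k *: phi k.
have SS m n : (m <= n)%N -> inner pi (S n - S m : L2) (S n - S m : L2) =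
    \sum_(m <= k < n) a k ^+ 2.
  move=> mn; have -> : S n - S m = \sum_(m <= k < n) a k *: phi k.
    by rewrite /S (@big_cat_nat _ _ _ m 0 n)//= addrAC subrr add0r.
  rewrite {1}inner_suml big_nat [RHS]big_nat; apply: eq_bigr => k mk.
  rewrite innerZl innerC -/(coef _ _) coef_sum mk expr2//.
have [|w Hw] := @L2_complete _ _ pi S.
  move=> e e0; have e20 : 0 < e / 2 by rewrite divr_gt0.
  have [N HN] := bounded_sums_tail (fun k => sqr_ge0 _) ba e20.
  exists N => m n Nm Nn; apply: (@le_lt_trans _ _ (e / 2)); last first.
    by rewrite ltr_pdivrMr// ltr_pMr// ltr1n.
  wlog mn : m n Nm Nn / (n <= m)%N.
    move=> H; have [|/ltnW nm] := leqP n m; first exact: H.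
    have -> : inner pi (S m - S n : L2) (S m - S n : L2) =
       inner pi (S n - S m : L2) (S n - S m : L2).
      by rewrite -opprB innerNl innerC innerNl opprK.
    exact: H.
  by rewrite SS//; exact: HN.
exists w => k; rewrite (@coef_l2cvg a 0)//.
apply/l2cvgP => e e0; have [|N HN] := Hw (e / 2); first by rewrite divr_gt0.
exists N => n /HN h; apply: le_lt_trans h _.
by rewrite ltr_pdivrMr// ltr_pMr// ltr1n.
Qed.

Variable lambda : nat -> R.
Hypothesis lambda_ge0 : forall k, 0 <= lambda k.

(** L^2 convergence of the partial sums forces the sequence in [Hs] to be that of the coefficients
    of [u]; its start at index 1 becomes the vanishing of [coef u 0]. *)
Lemma HsP m u : Hs lambda phi m u <->
  coef u 0 = 0 /\ bounded_sums (fun k => coef u k ^+ 2 * lambda k ^+ m).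
Proof.
have pos (a : nat -> R) k : 0 <= a k ^+ 2 * lambda k ^+ m.
  by rewrite mulr_ge0 ?sqr_ge0 ?exprn_ge0.
split=> [[a [ua sa]]|[u0 [C HC]]].
  have cu k := @coef_l2cvg _ _ _ k ua.
  split; first by rewrite cu.
  exists (fine (\sum_(1 <= k <oo) (a k ^+ 2 * lambda k ^+ m)%:E)%E) => n.
  have S0 : (0 <= \sum_(1 <= k <oo) (a k ^+ 2 * lambda k ^+ m)%:E)%E.
    by apply: nneseries_ge0 => k _ _; rewrite lee_fin.
  rewrite -lee_fin fineK; last by rewrite ge0_fin_numE.
  apply: (@le_trans _ _ (\sum_(1 <= k < n) (a k ^+ 2 * lambda k ^+ m)%:E)%E); last first.
    by apply: nneseries_lim_ge => k _ _; rewrite lee_fin.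
  rewrite sumEFin lee_fin; case: n => [|n]; first by rewrite !big_geq.
  rewrite big_ltn// cu/= expr0n/= mul0r add0r big_nat [leRHS]big_nat.
  by apply: ler_sum => k /andP[k1 _]; rewrite cu k1.
exists (coef u); split.
  have := phi_complete u; rewrite /l2cvg; apply: cvg_trans; apply: near_eq_cvg.
  (* From [n = 1] on, the two sums differ by the term of index 0, which is zero. *)
  exists 1%N => // n /= n1; congr Lnorm.
  have -> // : \sum_(0 <= k < n) inner pi u (phi k) *: phi k =
      \sum_(1 <= k < n) coef u k *: phi k.
  by rewrite big_ltn// -/(coef u 0) u0 scale0r add0r.
apply: (@le_lt_trans _ _ C%:E); last exact: ltry.
apply: lime_le; first by apply: is_cvg_nneseries => k _ _; rewrite lee_fin.
apply: nearW => n; rewrite sumEFin lee_fin; apply: le_trans (HC n).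
case: n => [|n]; first by rewrite !big_geq.
by rewrite [leRHS]big_ltn// lerDr.
Qed.

End Basis.

(** * The Dirichlet energy in terms of coefficients *)

Section Energy.
Context (R : realType) (d : nat) (M : ptopologicalType).
Variables (X : oriented_atlas R d M) (g : riemannian_metric X) (U : M -> R).
Variable pi : probability (borel M) R.
Local Notation L2 := (L2 pi).
Variables (lambda : nat -> R) (phi : nat -> L2).
Hypothesis M_compact : compact [set: M].
Hypothesis U_C1 : fun_C X 1 U.
Hypothesis A_spectrum : discrete_spectrum g U lambda phi.
Implicit Types u v w f h : L2.

Lemma phi_orthonormal i j : inner pi (phi i) (phi j) = (i == j)%:R.
Proof. by case: A_spectrum. Qed.

Lemma phi_complete u : l2cvg pi (fun n => \sum_(0 <= k < n) inner pi u (phi k) *: phi k) u.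
Proof. by case: A_spectrum. Qed.

Lemma phi_friedrichs n : friedrichs g U (phi n) (- lambda n *: phi n).
Proof. by case: A_spectrum. Qed.

Lemma lambda0 : lambda 0%N = 0.
Proof. by case: A_spectrum => -[]. Qed.

Lemma lambda_gt0 k : (0 < k)%N -> 0 < lambda k.
Proof.
by case: A_spectrum => -[_ l1 homo_l _] _ _ _ _ k0; apply: lt_le_trans l1 _; exact: homo_l.
Qed.

Lemma lambda_ge0 k : 0 <= lambda k.
Proof. by case: k => [|k]; [rewrite lambda0|exact/ltW/lambda_gt0]. Qed.

Local Notation coef := (coef phi).

Lemma parseval_phi u v :
  (fun n => \sum_(0 <= k < n) coef u k * coef v k) @ \oo --> inner pi u v.
Proof. exact: parseval phi_complete _ _. Qed.

Lemma smoothM f h : smooth X f -> smooth X h -> smooth X ((f : M -> R) \* h).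
Proof. by move=> sf sh n; exact: fun_CM. Qed.

Lemma smoothB f h : smooth X f -> smooth X h -> smooth X (f - h : L2).
Proof. by move=> sf sh n; apply: fun_CD => //; exact: fun_CN. Qed.

Lemma smoothP (a : R) f h : smooth X f -> smooth X h -> smooth X (a *: f + h : L2).
Proof.
by move=> sf sh n; exact: (fun_CD (fun_CM (fun_C_cst X n a) (sf n)) (sh n)).
Qed.

Lemma smooth0 : smooth X (0 : L2).
Proof. by move=> n; exact: fun_C_cst. Qed.

Lemma mkL2_C0 (f : M -> R) : fun_C X 0 f -> exists u : L2, u = f :> (M -> R).
Proof.
move=> fC; have [C HC] := fun_C_bounded M_compact fC.
by apply: mkL2_bounded HC; exact: fun_C_measurable fC.
Qed.

(** The Friedrichs relation of [phi k], tested against [f], already moves the operator onto [phi k];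
    boundedness of [generator g U f] puts it in L^2. *)
Lemma generator_coef f : smooth X f -> exists G : L2,
  G = generator g U f :> (M -> R) /\ forall k, coef G k = - lambda k * coef f k.
Proof.
move=> sf; have [G GE] := mkL2_C0 (generator_fun_C g U_C1 (sf 2)).
exists G; split => // k; rewrite /coef innerC GE.
have [_ ->//] := phi_friedrichs k.
by rewrite innerZl [inner pi (phi k) f]innerC.
Qed.

(* [phi 0] is a.e. a nonzero constant, so testing the Friedrichs relation for it
   against [f] gives the integral of [generator g U f]. *)
Lemma generator_integral0 f (G : L2) (one : L2) : smooth X f ->
  G = generator g U f :> (M -> R) -> one = cst 1 :> (M -> R) -> inner pi G one = 0.
Proof.
move=> sf GE oneE.
have [c c0 phi0] : exists2 c : R, c != 0 & (phi 0%N : M -> R) = cst c %[ae pi].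
  by case: A_spectrum.
have c1 : (c *: one : L2) = cst c :> (M -> R).
  by apply/funext => p; rewrite -[(c *: one : L2) p]/(c * one p) oneE mulr1.
have /(ae_inner G) : (phi 0%N : M -> R) = (c *: one : L2) %[ae pi] by rewrite c1.
rewrite innerZl ![inner pi _ G]innerC.
have [_ /(_ _ sf)] := phi_friedrichs 0.
rewrite -GE lambda0 oppr0 scale0r inner0l innerC => -> /esym/eqP.
by rewrite mulf_eq0 (negbTE c0) => /eqP.
Qed.

(* The right-hand side is computed by integrating [generator g U (f * h)] to zero. *)
Lemma energy_cvg f h : smooth X f -> smooth X h ->
  (fun n => \sum_(0 <= k < n) lambda k * (coef f k * coef h k)) @ \oo -->
  vinner g pi (grad g f) (grad g h).
Proof.
move=> sf sh.
have [Gf [GfE Gfk]] := generator_coef sf; have [Gh [GhE Ghk]] := generator_coef sh.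
have sfh := smoothM sf sh.
have [P PE] := mkL2_C0 (sfh 0%N).
have sP : smooth X P by rewrite PE.
have [GP [GPE _]] := generator_coef sP.
have [one oneE] := mkL2_C0 (fun_C_cst X 0 1).
have vf : vL2 g pi (grad g f) := smooth_grad_vL2 g pi M_compact (sf 1%N).
have vh : vL2 g pi (grad g h) := smooth_grad_vL2 g pi M_compact (sh 1%N).
have key : inner pi f Gh + inner pi h Gf + 2 * vinner g pi (grad g f) (grad g h) = 0.
  rewrite -(generator_integral0 sP GPE oneE) /inner /vinner.
  rewrite -RintegralZl//; last exact: vL2_integrable.
  have i1 := L2_mul_integrable f Gh; have i2 := L2_mul_integrable h Gf.
  have i12 : pi.-integrable setT (fun p : borel M => (f p * Gh p + h p * Gf p)%:E).
    exact: (integrableD measurableT i1 i2).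
  have i3 : pi.-integrable setT (fun p : borel M => (2 * vdot g (grad g f) (grad g h) p)%:E).
    exact: (integrableZl measurableT 2 (vL2_integrable M_compact vf vh)).
  rewrite -RintegralD// -RintegralD//.
  apply: eq_Rintegral => p _; rewrite GPE oneE mulr1 PE generator_mul//.
  by rewrite GfE GhE.
have -> : vinner g pi (grad g f) (grad g h) = - 2^-1 * (inner pi f Gh + inner pi h Gf).
  move: key; move: (inner _ _ _) (inner _ _ _) (vinner _ _ _ _) => x y z; lra.
have -> : (fun n => \sum_(0 <= k < n) lambda k * (coef f k * coef h k)) =
   (fun n => - 2^-1 * (\sum_(0 <= k < n) coef f k * coef Gh k +
                       \sum_(0 <= k < n) coef h k * coef Gf k)).
  apply/funext => n; rewrite -big_split/= mulr_sumr; apply: eq_bigr => k _.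
  rewrite Gfk Ghk; move: (lambda k) (coef f k) (coef h k) => x y z; lra.
apply: cvgM; first exact: cvg_cst.
by apply: cvgD; exact: parseval_phi.
Qed.

Lemma sqr_energy_ge0 u k : 0 <= lambda k * (coef u k * coef u k).
Proof. by rewrite mulr_ge0 ?lambda_ge0// -expr2 sqr_ge0. Qed.

Lemma energy_le f K : smooth X f ->
  \sum_(0 <= k < K) lambda k * (coef f k * coef f k) <= vinner g pi (grad g f) (grad g f).
Proof.
move=> sf; apply: cvgn_sums_le; first exact: sqr_energy_ge0.
exact: energy_cvg.
Qed.

Lemma form_energy f : smooth X f ->
  inner pi (\- generator g U f) f = vinner g pi (grad g f) (grad g f).
Proof.
move=> sf; have [G [GE Gk]] := generator_coef sf.
have -> : (\- generator g U f : M -> R) = (- G : L2) by rewrite -GE.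
rewrite innerNl; apply: (cvg_unique (@Rhausdorff R) _ (energy_cvg sf sf)).
have -> : (fun n => \sum_(0 <= k < n) lambda k * (coef f k * coef f k)) =
    (fun n => - \sum_(0 <= k < n) coef G k * coef f k).
  apply/funext => n; rewrite -sumrN; apply: eq_bigr => k _.
  by rewrite Gk; ring.
by apply: cvgN; exact: parseval_phi.
Qed.

(** The squared form norm of u - v, energy plus L^2 norm, is at most [e]; bounding the partial sums
    avoids any prior assumption of finite energy. *)
Definition energy_close u v (e : R) :=
  forall K, \sum_(0 <= k < K) (lambda k + 1) * (coef u k - coef v k) ^+ 2 <= e.

Definition smooth_approximable u :=
  forall e : R, 0 < e -> exists2 f : L2, smooth X f & energy_close u f e.

(** Each partial sum has finitely many terms and passes to the L^2 limit; since the bound is uniform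
    in [K], this is Fatou's lemma for series. *)
Lemma energy_limit (f : nat -> L2) u :
  inner pi (f n - u : L2) (f n - u : L2) @[n --> \oo] --> 0 ->
  (forall e, 0 < e -> exists N, forall m n, (N <= m)%N -> (N <= n)%N ->
     forall K, \sum_(0 <= k < K) lambda k * (coef (f m) k - coef (f n) k) ^+ 2 <= e) ->
  forall e, 0 < e -> exists N, forall m, (N <= m)%N ->
     forall K, \sum_(0 <= k < K) lambda k * (coef u k - coef (f m) k) ^+ 2 <= e.
Proof.
move=> fu fC e /fC[N HN]; exists N => m Nm K.
have h : (fun n => \sum_(0 <= k < K) lambda k * (coef (f (n + N)%N) k - coef (f m) k) ^+ 2)
    @ \oo --> \sum_(0 <= k < K) lambda k * (coef u k - coef (f m) k) ^+ 2.
  apply: cvgn_sum => k; apply: cvgM; first exact: cvg_cst.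
  have h : (fun n => coef (f (n + N)%N) k - coef (f m) k) @ \oo --> coef u k - coef (f m) k.
    apply: cvgB; last exact: cvg_cst.
    have := @coef_lim _ _ _ phi _ _ k fu; rewrite -(cvg_shiftn N); exact.
  under eq_fun do rewrite expr2; rewrite expr2.
  exact: cvgM.
by apply: cvgn_le_bound h _ => n; apply: HN => //; exact: leq_addl.
Qed.

Lemma energy_close_sum u v (a b : R) :
  (forall K, \sum_(0 <= k < K) lambda k * (coef u k - coef v k) ^+ 2 <= a) ->
  inner pi (v - u : L2) (v - u : L2) <= b -> energy_close u v (a + b).
Proof.
move=> Ha Hb K; under eq_bigr do rewrite mulrDl mul1r.
rewrite big_split/= lerD//; apply: le_trans Hb.
apply: le_trans (bessel phi_complete (v - u) K).
by apply: ler_sum => k _; rewrite coefB -sqrrN opprB.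
Qed.

Lemma energy_closeW u v (e : R) K : energy_close u v e ->
  \sum_(0 <= k < K) lambda k * (coef u k - coef v k) ^+ 2 <= e.
Proof.
move=> /(_ K); apply: le_trans; apply: ler_sum => k _.
by rewrite mulrDl mul1r lerDl sqr_ge0.
Qed.

Lemma energy_close_inner u v (e : R) : energy_close u v e ->
  inner pi (v - u : L2) (v - u : L2) <= e.
Proof.
move=> H; apply: cvgn_le_bound (@parseval_phi (v - u) (v - u)) _ => n.
apply: le_trans (H n); apply: ler_sum => k _.
rewrite -expr2 coefB -sqrrN opprB mulrDl mul1r lerDr.
by rewrite mulr_ge0 ?lambda_ge0// sqr_ge0.
Qed.

Lemma form_domain_approximable u : form_domain g U u -> smooth_approximable u.
Proof.
move=> [f [sf fu fC]] e e0.
have e20 : 0 < e / 2 by rewrite divr_gt0.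
have fu0 := l2cvg_sub_cvg fu.
have [|N HN] := energy_limit fu0 _ e20.
  move=> a /fC[N HN]; exists N => m n Nm Nn K.
  have := HN m n Nm Nn; rewrite form_energy; last exact: smoothB.
  move=> /ltW; apply: le_trans; apply: le_trans (energy_le K (smoothB (sf m) (sf n))).
  by apply: ler_sum => k _; rewrite coefB -expr2.
have [N' HN'] := (inner_sub_cvg f u).2 fu0 _ e20.
exists (f (maxn N N')); first exact: sf.
have -> : e = e / 2 + e / 2 by rewrite -splitr.
apply: energy_close_sum; first by apply: HN; exact: leq_maxl.
by apply: HN'; exact: leq_maxr.
Qed.

(** The factors 2 come from (x + y)^2 <= 2 x^2 + 2 y^2, applied termwise. *)
Lemma energy_closeP (a : R) u u' v v' (e e' : R) :
  energy_close u u' e -> energy_close v v' e' ->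
  energy_close (a *: u + v) (a *: u' + v') (2 * a ^+ 2 * e + 2 * e').
Proof.
move=> H H' K.
apply: (@le_trans _ _ (\sum_(0 <= k < K) (2 * a ^+ 2 * ((lambda k + 1) * (coef u k - coef u' k) ^+ 2)
   + 2 * ((lambda k + 1) * (coef v k - coef v' k) ^+ 2)))).
  apply: ler_sum => k _; rewrite !coefP.
  have l0 : 0 <= lambda k + 1 by rewrite addr_ge0 ?lambda_ge0.
  rewrite -subr_ge0.
  have -> : 2 * a ^+ 2 * ((lambda k + 1) * (coef u k - coef u' k) ^+ 2) +
      2 * ((lambda k + 1) * (coef v k - coef v' k) ^+ 2) -
      (lambda k + 1) * (a * coef u k + coef v k - (a * coef u' k + coef v' k)) ^+ 2 =
      (lambda k + 1) * (a * (coef u k - coef u' k) - (coef v k - coef v' k)) ^+ 2.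
    by ring.
  by rewrite mulr_ge0// sqr_ge0.
rewrite big_split/= -!mulr_sumr lerD//; last by rewrite ler_wpM2l// H'.
by rewrite ler_wpM2l ?H// mulr_ge0// sqr_ge0.
Qed.

Lemma energy_close_trans u v w (e e' : R) :
  energy_close u v e -> energy_close v w e' -> energy_close u w (2 * e + 2 * e').
Proof.
move=> H H' K; have := energy_closeP 1 H H' K.
rewrite expr1n mulr1; apply: le_trans; apply: ler_sum => k _.
rewrite !coefP !mul1r le_eqVlt; apply/orP; left; apply/eqP; congr (_ * _ ^+ 2).
by ring.
Qed.

Lemma energy_closeC u v (e : R) : energy_close u v e -> energy_close v u e.
Proof.
move=> H K; have := H K; apply: le_trans; apply: ler_sum => k _.
by rewrite -sqrrN opprB.
Qed.

Lemma smooth_approximableP (a : R) u v :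
  smooth_approximable u -> smooth_approximable v -> smooth_approximable (a *: u + v).
Proof.
move=> Hu Hv e e0.
(* This denominator keeps the contribution of [u] below [e / 2]; the summand 1 covers [a = 0]. *)
have a1 : 0 < 4 * (a ^+ 2 + 1) by rewrite mulr_gt0// ltr_wpDl// sqr_ge0.
have [f sf Hf] := Hu (e / (4 * (a ^+ 2 + 1))) (divr_gt0 e0 a1).
have [h sh Hh] := Hv (e / 4) (divr_gt0 e0 (ltr0Sn _ _)).
exists (a *: f + h); first exact: smoothP.
move=> K; apply: le_trans (energy_closeP a Hf Hh K) _.
rewrite [leRHS]splitr; apply: lerD; last by lra.
rewrite mulrA ler_pdivrMr// -subr_ge0.
have -> : e / 2 * (4 * (a ^+ 2 + 1)) - 2 * a ^+ 2 * e = 2 * e by field.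
by rewrite mulr_ge0// ltW.
Qed.

Lemma smooth_approximable_sum (r : seq nat) (a : nat -> R) :
  smooth_approximable (\sum_(k <- r) a k *: phi k).
Proof.
elim: r => [|k r IH].
  rewrite big_nil => e e0; exists 0; first exact: smooth0.
  by move=> K; rewrite big1 ?ltW// => k _; rewrite subrr expr0n mulr0.
rewrite big_cons; apply: smooth_approximableP => //.
by apply: form_domain_approximable; case: (phi_friedrichs k).
Qed.

(** Density of smooth functions in H^1: the expansion is truncated where the tail of the form norm
    is small, and every eigenfunction is approximable because it lies in the form domain. *)
Lemma finite_energy_approximable u :
  bounded_sums (fun k => lambda k * coef u k ^+ 2) -> smooth_approximable u.
Proof.
move=> bu e e0; pose t k := (lambda k + 1) * coef u k ^+ 2.
have t0 k : 0 <= t k by rewrite mulr_ge0 ?sqr_ge0// addr_ge0 ?lambda_ge0.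
have bt : bounded_sums t.
  have : bounded_sums (fun k => coef u k ^+ 2).
    by exists (inner pi u u) => n; exact: (bessel phi_complete).
  move=> /(bounded_sumsD bu); apply: bounded_sums_le => k.
  by rewrite /t mulrDl mul1r.
have e40 : 0 < e / 4 by rewrite divr_gt0.
have [N HN] := bounded_sums_tail t0 bt e40.
pose S : L2 := \sum_(0 <= k < N) coef u k *: phi k.
have [f sf Sf] := smooth_approximable_sum (index_iota 0 N) (coef u) e40.
exists f => //.
have -> : e = 2 * (e / 4) + 2 * (e / 4) by field.
apply: energy_close_trans Sf => K.
have zero k : (k < N)%N -> (lambda k + 1) * (coef u k - coef S k) ^+ 2 = 0.
  by move=> kN; rewrite (coef_sum phi_orthonormal) kN subrr expr0n mulr0.
have [KN|/ltnW NK] := leqP K N.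
  rewrite big_nat big1 ?ltW// => k /andP[_ kK].
  by apply: zero; exact: leq_trans KN.
rewrite (@big_cat_nat _ _ _ N)//= [X in X + _]big_nat big1; last first.
  by move=> k /andP[_ kN]; exact: zero.
rewrite add0r; apply: le_trans (HN N K (leqnn _) NK).
rewrite big_nat [leRHS]big_nat; apply: ler_sum => k /andP[Nk _].
by rewrite (coef_sum phi_orthonormal) ltnNge Nk subr0.
Qed.

Lemma inv_nat_small (e : R) : 0 < e -> exists N, forall n, (N <= n)%N -> n.+1%:R^-1 < e.
Proof.
move=> e0; have /cvgrPdist_lt/(_ _ e0)[N _ HN] := @cvg_harmonic R.
exists N => n /HN /=; rewrite sub0r normrN ger0_norm//.
Qed.

Lemma approximating_sequence u : smooth_approximable u -> exists f : nat -> L2,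
  (forall n, smooth X (f n)) /\ forall n, energy_close u (f n) n.+1%:R^-1.
Proof.
move=> H; have /choice[f Hf] : forall n, exists f : L2, smooth X f /\
    energy_close u f n.+1%:R^-1.
  move=> n; have [|f sf uf] := H n.+1%:R^-1; first by rewrite invr_gt0.
  by exists f.
by exists f; split => n; have [] := Hf n.
Qed.

Lemma energy_sub_cvg f h : smooth X f -> smooth X h ->
  (fun n => \sum_(0 <= k < n) lambda k * (coef f k - coef h k) ^+ 2) @ \oo -->
  vinner g pi (grad g f \- grad g h) (grad g f \- grad g h).
Proof.
move=> sf sh.
have vf : vL2 g pi (grad g f) := smooth_grad_vL2 g pi M_compact (sf 1%N).
have vh : vL2 g pi (grad g h) := smooth_grad_vL2 g pi M_compact (sh 1%N).
rewrite vinner_sub_expand//.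
have -> : (fun n => \sum_(0 <= k < n) lambda k * (coef f k - coef h k) ^+ 2) =
  (fun n => \sum_(0 <= k < n) lambda k * (coef f k * coef f k)
     - 2 * (\sum_(0 <= k < n) lambda k * (coef f k * coef h k))
     + \sum_(0 <= k < n) lambda k * (coef h k * coef h k)).
  apply/funext => n; rewrite mulr_sumr -sumrB -big_split/=.
  by apply: eq_bigr => k _; ring.
apply: cvgD; last exact: energy_cvg.
apply: cvgB; first exact: energy_cvg.
by apply: cvgM; [exact: cvg_cst|exact: energy_cvg].
Qed.

Lemma approximating_l2cvg u (f : nat -> L2) :
  (forall n, energy_close u (f n) n.+1%:R^-1) -> l2cvg pi f u.
Proof.
move=> H; apply/l2cvgP => e /inv_nat_small[N HN]; exists N => n /HN.
by apply: le_lt_trans; exact: energy_close_inner.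
Qed.

Lemma approximating_cauchy u (f : nat -> L2) :
  (forall n, smooth X (f n)) -> (forall n, energy_close u (f n) n.+1%:R^-1) ->
  forall e, 0 < e -> exists N, forall m n, (N <= m)%N -> (N <= n)%N ->
    energy_close (f m) (f n) e.
Proof.
move=> sf H e e0; have [|N HN] := @inv_nat_small (e / 4); first by rewrite divr_gt0.
exists N => m n /HN hm /HN hn K.
have := energy_close_trans (energy_closeC (H m)) (H n) K.
move=> /le_trans; apply.
by move: m.+1%:R^-1 n.+1%:R^-1 hm hn => a b' h1 h2; lra.
Qed.

Lemma approximable_form_domain u : smooth_approximable u -> form_domain g U u.
Proof.
move=> /approximating_sequence[f [sf fu]]; exists f; split => //.
  exact: approximating_l2cvg.
move=> e e0; have e20 : 0 < e / 2 by rewrite divr_gt0.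
have [N HN] := approximating_cauchy sf fu e20; exists N => m n Nm Nn.
apply: (@le_lt_trans _ _ (e / 2)); last by rewrite ltr_pdivrMr// ltr_pMr// ltr1n.
have sfmn := smoothB (sf m) (sf n).
rewrite form_energy//; apply: cvgn_le_bound (energy_cvg sfmn sfmn) _ => K.
apply: le_trans (energy_closeW K (HN m n Nm Nn)).
by apply: ler_sum => k _; rewrite coefB -expr2.
Qed.

(** [weak_grad] is a choice with a default value, meaningful only once this is known. The energy
    identity makes the gradients of the smooth approximations a Cauchy sequence. *)
Lemma weak_grad_exists u : smooth_approximable u -> exists V, is_weak_grad g u V.
Proof.
move=> /approximating_sequence[f [sf fu]].
have vf n : vL2 g pi (grad g (f n)) := smooth_grad_vL2 g pi M_compact (sf n 1%N).
have [|V [bV HV]] := vfield_complete M_compact vf.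
  move=> e e0; have e20 : 0 < e / 2 by rewrite divr_gt0.
  have [N HN] := approximating_cauchy sf fu e20; exists N => m n Nm Nn.
  apply: (@le_lt_trans _ _ (e / 2)); last by rewrite ltr_pdivrMr// ltr_pMr// ltr1n.
  apply: cvgn_le_bound (energy_sub_cvg (sf m) (sf n)) _ => K.
  exact: energy_closeW (HN m n Nm Nn).
exists V; split => //; exists f; split => //; first exact: approximating_l2cvg.
have int0 n : (0 <= \int[pi]_p (vdot g (grad g (f n) \- V) (grad g (f n) \- V) p)%:E)%E.
  by apply: integral_ge0 => p _; rewrite lee_fin vdot_ge0.
apply/fine_cvgP; split.
  have [N HN] := HV 1 ltr01; exists N => // n /HN h.
  by rewrite ge0_fin_numE//; apply: le_lt_trans h (ltry _).
apply/cvgrPdist_le => e /HV[N HN]; exists N => // n /HN h.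
rewrite sub0r normrN /= ger0_norm; last exact: fine_ge0.
rewrite -lee_fin fineK// ge0_fin_numE//.
exact: le_lt_trans h (ltry _).
Qed.

Lemma weak_grad_approx u V : is_weak_grad g u V ->
  vL2 g pi V /\ exists f : nat -> L2, [/\ forall n, smooth X (f n),
    inner pi (f n - u : L2) (f n - u : L2) @[n --> \oo] --> 0 &
    vinner g pi (grad g (f n) \- V) (grad g (f n) \- V) @[n --> \oo] --> 0].
Proof.
move=> [bV [f [sf fu /fine_cvgP[fin fV]]]].
have vf n : vL2 g pi (grad g (f n)) := smooth_grad_vL2 g pi M_compact (sf n 1%N).
split; last by exists f; split => //; exact: l2cvg_sub_cvg.
have [N _ /(_ N (leqnn _)) HN] := fin.
have [bf _] := vf N.
have bfV : vfield_borel X (grad g (f N) \- V) by exact: vfield_borelB.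
have vfV : vL2 g pi (grad g (f N) \- V).
  split => //; apply/integrableP; split.
    by apply/measurable_EFinP; exact: measurable_vdot.
  under eq_integral do rewrite gee0_abs ?lee_fin ?vdot_ge0//.
  by rewrite ltey_eq HN.
(* Square integrability is inherited from a smooth gradient at finite distance from [V]. *)
have -> : V = grad g (f N) \- (grad g (f N) \- V).
  apply/funext => i; apply/funext => p.
  by rewrite -[RHS]/(grad g (f N) i p - (grad g (f N) i p - V i p)) opprB addrC subrK.
exact: vL2B.
Qed.

Lemma vinner_sub_le V W : vL2 g pi V -> vL2 g pi W ->
  vinner g pi (V \- W) (V \- W) <= 2 * vinner g pi V V + 2 * vinner g pi W W.
Proof.
move=> hV hW; rewrite vinner_sub_expand//.
have := vinner_cs M_compact hV hW; have := vinner_ge0 g pi V; have := vinner_ge0 g pi W.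
move: (vinner g pi V V) (vinner g pi V W) (vinner g pi W W) => a b c c0 a0 H.
suff : - (2 * b) <= a + c by lra.
rewrite -(ler_pM2r (_ : 0 < 1))// leNgt; apply/negP => h.
(* As b^2 <= a c, this would make (a - c)^2 negative. *)
have : (a + c) ^+ 2 < (2 * b) ^+ 2 by nra.
have := sqr_ge0 (a - c); nra.
Qed.

(** Convergence of the gradients makes them Cauchy, which the energy identity transfers to the
    coefficients; [energy_limit] then identifies the limit. *)
Lemma weak_grad_energy u V (f : nat -> L2) : vL2 g pi V ->
  (forall n, smooth X (f n)) ->
  inner pi (f n - u : L2) (f n - u : L2) @[n --> \oo] --> 0 ->
  vinner g pi (grad g (f n) \- V) (grad g (f n) \- V) @[n --> \oo] --> 0 ->
  forall e, 0 < e -> exists N, forall m, (N <= m)%N ->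
     forall K, \sum_(0 <= k < K) lambda k * (coef u k - coef (f m) k) ^+ 2 <= e.
Proof.
move=> hV sf fu fV; apply: energy_limit => // e e0.
have vf n : vL2 g pi (grad g (f n)) := smooth_grad_vL2 g pi M_compact (sf n 1%N).
have vfV n : vL2 g pi (grad g (f n) \- V) by exact: vL2B.
have e40 : 0 < e / 4 by rewrite divr_gt0.
have /cvgrPdist_le/(_ _ e40)[N _ HN] := fV.
exists N => m n Nm Nn K.
apply: le_trans (cvgn_sums_le _ (energy_sub_cvg (sf m) (sf n)) K) _.
  by move=> k; rewrite mulr_ge0 ?lambda_ge0// sqr_ge0.
have -> : grad g (f m) \- grad g (f n) = (grad g (f m) \- V) \- (grad g (f n) \- V).
  apply/funext => i; apply/funext => p.
  rewrite -[LHS]/(grad g (f m) i p - grad g (f n) i p).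
  by rewrite -[RHS]/(grad g (f m) i p - V i p - (grad g (f n) i p - V i p)) opprB addrA subrK.
apply: le_trans (vinner_sub_le (vfV m) (vfV n)) _.
have bound l : (N <= l)%N -> vinner g pi (grad g (f l) \- V) (grad g (f l) \- V) <= e / 4.
  by move=> /HN /=; rewrite sub0r normrN (ger0_norm (vinner_ge0 _ _ _)).
apply: (@le_trans _ _ (2 * (e / 4) + 2 * (e / 4))); last by lra.
by apply: lerD; rewrite ler_wpM2l// bound.
Qed.

(** Multiplying coefficients by [Num.sqrt (lambda k)] is the square root of -A and carries the
    energy to the L^2 product. Both sides are limits along smooth approximations, where they agree;
    hence the value is the same for all choices of weak gradients. *)
Lemma vinner_weak_grad u v V W : is_weak_grad g u V -> is_weak_grad g v W ->
  bounded_sums (fun k => lambda k * coef u k ^+ 2) ->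
  bounded_sums (fun k => lambda k * coef v k ^+ 2) ->
  (fun n => \sum_(0 <= k < n) lambda k * (coef u k * coef v k)) @ \oo --> vinner g pi V W.
Proof.
move=> /weak_grad_approx[hV [f [sf fu fV]]] /weak_grad_approx[hW [h [sh hv hW']]] bu bv.
have vf n : vL2 g pi (grad g (f n)) := smooth_grad_vL2 g pi M_compact (sf n 1%N).
have vh n : vL2 g pi (grad g (h n)) := smooth_grad_vL2 g pi M_compact (sh n 1%N).
have sq k (x : R) : (Num.sqrt (lambda k) * x) ^+ 2 = lambda k * x ^+ 2.
  by rewrite exprMn sqr_sqrtr// lambda_ge0.
have TP x : bounded_sums (fun k => lambda k * coef x k ^+ 2) ->
    exists y, forall k, coef y k = Num.sqrt (lambda k) * coef x k.
  move=> bx; apply: (riesz_fischer phi_orthonormal).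
  by apply: bounded_sums_le bx => k; rewrite sq.
have bs (x : L2) : smooth X x -> bounded_sums (fun k => lambda k * coef x k ^+ 2).
  move=> sx; exists (vinner g pi (grad g x) (grad g x)) => n.
  by apply: le_trans (energy_le n sx); apply: ler_sum => k _; rewrite -expr2.
have [Tu Tuk] := TP u bu; have [Tv Tvk] := TP v bv.
have /choice[Tf Tfk] : forall n, exists y, forall k, coef y k = Num.sqrt (lambda k) * coef (f n) k.
  by move=> n; exact/TP/bs.
have /choice[Th Thk] : forall n, exists y, forall k, coef y k = Num.sqrt (lambda k) * coef (h n) k.
  by move=> n; exact/TP/bs.
have prodE (a b x y : L2) : (forall k, coef a k = Num.sqrt (lambda k) * coef x k) ->
    (forall k, coef b k = Num.sqrt (lambda k) * coef y k) ->
    (fun n => \sum_(0 <= k < n) lambda k * (coef x k * coef y k)) @ \oo --> inner pi a b.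
  move=> ax by_; have := @parseval_phi a b.
  rewrite (_ : (fun n => _) = (fun n => \sum_(0 <= k < n) lambda k * (coef x k * coef y k)))//.
  apply/funext => n; apply: eq_bigr => k _; rewrite ax by_ mulrACA -expr2 sqr_sqrtr//.
  exact: lambda_ge0.
(* Convergence in energy is L^2 convergence of the images under this square root. *)
have Tlim (x Tx : L2) (y : nat -> L2) (Ty : nat -> L2) :
    (forall k, coef Tx k = Num.sqrt (lambda k) * coef x k) ->
    (forall n k, coef (Ty n) k = Num.sqrt (lambda k) * coef (y n) k) ->
    (forall e, 0 < e -> exists N, forall m, (N <= m)%N ->
     forall K, \sum_(0 <= k < K) lambda k * (coef x k - coef (y m) k) ^+ 2 <= e) ->
    inner pi (Ty n - Tx : L2) (Ty n - Tx : L2) @[n --> \oo] --> 0.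
  move=> Txk Tyk H; apply/inner_sub_cvg => e /H[N HN]; exists N => n Nn.
  apply: cvgn_le_bound (@parseval_phi (Ty n - Tx) (Ty n - Tx)) _ => K.
  apply: le_trans (HN n Nn K); apply: ler_sum => k _.
  by rewrite -expr2 coefB Txk Tyk -mulrBr sq -sqrrN opprB.
have -> : vinner g pi V W = inner pi Tu Tv; last exact: prodE.
apply: (vinner_limit M_compact vf vh hV hW fV hW').
have -> : (fun n => vinner g pi (grad g (f n)) (grad g (h n))) = (fun n => inner pi (Tf n) (Th n)).
  apply/funext => n; apply: (cvg_unique (@Rhausdorff R) (energy_cvg (sf n) (sh n))).
  exact: prodE.
apply: inner_cvg.
  by apply: Tlim Tuk Tfk _; exact: weak_grad_energy hV sf fu fV.
by apply: Tlim Tvk Thk _; exact: weak_grad_energy hW sh hv hW'.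
Qed.

Lemma h1_inner_cvg u v :
  bounded_sums (fun k => lambda k * coef u k ^+ 2) ->
  bounded_sums (fun k => lambda k * coef v k ^+ 2) ->
  (fun n => \sum_(0 <= k < n) lambda k * (coef u k * coef v k)) @ \oo --> h1_inner g u v.
Proof.
move=> bu bv; apply: vinner_weak_grad => //.
- by have [V HV] := weak_grad_exists (finite_energy_approximable bu); exact: xgetI HV.
- by have [V HV] := weak_grad_exists (finite_energy_approximable bv); exact: xgetI HV.
Qed.

End Energy.

Lemma cvgn_unique (R : realType) (a : nat -> R) (l l' : R) :
  a @ \oo --> l -> a @ \oo --> l' -> l = l'.
Proof. by move=> al al'; exact: (cvg_unique (@Rhausdorff R) al al'). Qed.

(** * Orthogonal projection onto a closed subspace of L^2 *)

Section Projection.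
Context (R : realType) (M : ptopologicalType) (pi : probability (borel M) R).
Local Notation L2 := (L2 pi).
Implicit Types u v w x y : L2.

Lemma sqr_parallelogram u x y :
  inner pi (x - y : L2) (x - y : L2) =
  2 * inner pi (u - x : L2) (u - x : L2) + 2 * inner pi (u - y : L2) (u - y : L2)
  - 4 * inner pi (u - 2^-1 *: (x + y) : L2) (u - 2^-1 *: (x + y) : L2).
Proof.
rewrite !(innerBl, innerBr, innerZl, innerZr, innerDl, innerDr).
rewrite [inner pi x u]innerC [inner pi y u]innerC [inner pi y x]innerC.
by field.
Qed.

Lemma projection_exists (K : L2 -> Prop) u :
  K 0 -> (forall a x y, K x -> K y -> K (a *: x + y)) ->
  (forall (x : nat -> L2) y, (forall n, K (x n)) ->
     inner pi (x n - y : L2) (x n - y : L2) @[n --> \oo] --> 0 -> K y) ->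
  exists2 w, K w & forall v, K v -> inner pi (u - w : L2) v = 0.
Proof.
move=> K0 KP Kcl.
pose dist w := inner pi (u - w : L2) (u - w : L2).
pose S := [set dist w | w in [set w | K w]].
have hS : has_inf S.
  split; first by exists (dist 0); exists 0.
  by exists 0 => _ [w _ <-]; exact: inner_ge0.
pose delta := inf S.
have lb w : K w -> delta <= dist w by move=> Kw; apply: ge_inf; [case: hS|exists w].
have /choice[x Hx] : forall n : nat, exists x, K x /\ dist x < delta + n.+1%:R^-1.
  move=> n; have n0 : 0 < n.+1%:R^-1 :> R by rewrite invr_gt0.
  by have [_ [x Kx <-] xd] := inf_adherent n0 hS; exists x.
have Kx n : K (x n) by have [] := Hx n.
have xd n : dist (x n) < delta + n.+1%:R^-1 by have [] := Hx n.
(* The midpoint lies in [K], so its squared distance to [u] is at least [delta]; in the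
   parallelogram identity the multiples of [delta] cancel. *)
have xy m n : inner pi (x m - x n : L2) (x m - x n : L2) <= 2 * m.+1%:R^-1 + 2 * n.+1%:R^-1.
  rewrite (sqr_parallelogram u).
  have Km : K (2^-1 *: (x m + x n)).
    have := KP 2^-1 (x m + x n) 0; rewrite addr0; apply => //.
    by have := KP 1 (x m) (x n); rewrite scale1r; exact.
  have := lb _ Km; have := xd m; have := xd n; rewrite /dist.
  move: (inner pi _ _) (inner pi _ _) (inner pi _ _) m.+1%:R^-1 n.+1%:R^-1 => a b c p q.
  lra.
have [w Hw] : exists w, forall e : R, 0 < e -> exists N, forall n, (N <= n)%N ->
    inner pi (x n - w : L2) (x n - w : L2) <= e.
  apply: L2_complete => e e0; have [|N HN] := @inv_nat_small R (e / 4); first by rewrite divr_gt0.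
  exists N => m n /HN hm /HN hn; apply: le_lt_trans (xy m n) _.
  by move: m.+1%:R^-1 n.+1%:R^-1 hm hn => p q; lra.
have xw := (inner_sub_cvg x w).1 Hw.
have Kw : K w by exact: Kcl xw.
exists w => // v Kv.
have dw : dist w <= delta.
  have h : dist (x n) @[n --> \oo] --> dist w.
    have h (z : nat -> L2) : inner pi (z n - w : L2) (z n - w : L2) @[n --> \oo] --> 0 ->
        inner pi ((u - z n) - (u - w) : L2) ((u - z n) - (u - w) : L2) @[n --> \oo] --> 0.
      move=> zw; rewrite (_ : (fun n => _) = (fun n => inner pi (z n - w : L2) (z n - w : L2)))//.
      apply/funext => n; have -> : (u - z n) - (u - w) = - (z n - w).
        by rewrite !opprB addrC addrA subrK.
      by rewrite innerNl innerC innerNl opprK.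
    by apply: inner_cvg; exact: h.
  have h2 : (fun n => delta + n.+1%:R^-1) @ \oo --> delta + 0.
    by apply: cvgD; [exact: cvg_cst|exact: cvg_harmonic].
  rewrite addr0 in h2; apply: ler_cvg_to h h2 _.
  by apply: nearW => n; exact/ltW.
(* Minimality of [w] against [w - t v]. As the constant term is 0, the discriminant bound forces the
   linear coefficient to vanish. *)
have key t : 0 <= t ^+ 2 * inner pi v v + 2 * t * inner pi (u - w : L2) v + 0.
  have Kt : K (- t *: v + w) by exact: KP.
  have := le_trans dw (lb _ Kt); rewrite /dist.
  have -> : u - (- t *: v + w) = t *: v + (u - w).
    by rewrite opprD scaleNr opprK addrCA.
  move: (u - w) => z.
  rewrite !(innerDl, innerDr, innerZl, innerZr) [inner pi v z]innerC.
  by rewrite -subr_ge0; congr (_ <= _); ring.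
have := discriminant_le (inner_ge0 v) (lexx 0) key.
by rewrite mulr0 => h; apply/eqP; rewrite -sqrf_eq0 eq_le h sqr_ge0.
Qed.

End Projection.

(** * The limiting resolvent *)

Section Resolvent.
Context (R : realType) (d : nat) (M : ptopologicalType).
Variables (X : oriented_atlas R d M) (g : riemannian_metric X) (U : M -> R).
Variable pi : probability (borel M) R.
Local Notation L2 := (L2 pi).
Variables (lambda : nat -> R) (phi : nat -> L2).
Hypothesis M_compact : compact [set: M].
Hypothesis U_C1 : fun_C X 1 U.
Hypothesis A_spectrum : discrete_spectrum g U lambda phi.
Variables (b : vfield R d M) (B : L2 -> L2).
Hypothesis B_drift : is_drift_operator g lambda phi b B.
Implicit Types u v w h x y : L2.

Local Notation coef := (coef phi).
Local Notation Hs := (Hs lambda phi).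
Let ortho := phi_orthonormal A_spectrum.
Let complete := phi_complete A_spectrum.
Let lam_ge0 := lambda_ge0 A_spectrum.

Lemma HsE m u : Hs m u <->
  coef u 0 = 0 /\ bounded_sums (fun k => coef u k ^+ 2 * lambda k ^+ m).
Proof. exact: (HsP ortho complete lam_ge0). Qed.

Lemma bounded_coef_sqr u : bounded_sums (fun k => coef u k ^+ 2).
Proof. by exists (inner pi u u) => n; exact: (bessel complete). Qed.

Lemma Hs0E u : Hs 0 u <-> coef u 0 = 0.
Proof.
split=> [/HsE[]//|u0]; apply/HsE; split => //.
by apply: bounded_sums_le (bounded_coef_sqr u) => k; rewrite expr0 mulr1.
Qed.

Lemma Hs1E u : Hs 1 u <-> coef u 0 = 0 /\ bounded_sums (fun k => lambda k * coef u k ^+ 2).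
Proof.
split=> [/HsE[u0 bu]|[u0 bu]]; [split=> //|apply/HsE; split => //].
all: by apply: bounded_sums_le bu => k; rewrite expr1 mulrC.
Qed.

Lemma Hs1_coef0 u : Hs 1 u -> coef u 0 = 0.
Proof. by move=> /Hs1E[]. Qed.

Lemma Hs1_energy u : Hs 1 u -> bounded_sums (fun k => lambda k * coef u k ^+ 2).
Proof. by move=> /Hs1E[]. Qed.

Lemma Hs2_Hs1 u : Hs 2 u -> Hs 1 u.
Proof.
move=> /HsE[u0 bu]; apply/Hs1E; split => //.
apply: bounded_sums_le (bounded_sumsD bu (bounded_coef_sqr u)) => k.
rewrite -subr_ge0.
(* The bound λ <= λ^2 + 1, by completing the square. *)
have -> : coef u k ^+ 2 * lambda k ^+ 2 + coef u k ^+ 2 - lambda k * coef u k ^+ 2 =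
  coef u k ^+ 2 * ((lambda k - 2^-1) ^+ 2 + 3 / 4) by field.
by rewrite mulr_ge0 ?sqr_ge0// addr_ge0 ?sqr_ge0// divr_ge0.
Qed.

Lemma Hs1_Hs0 u : Hs 1 u -> Hs 0 u.
Proof. by move=> /Hs1_coef0/Hs0E. Qed.

Lemma Hs1P a u v : Hs 1 u -> Hs 1 v -> Hs 1 (a *: u + v).
Proof.
move=> /Hs1E[u0 bu] /Hs1E[v0 bv]; apply/Hs1E; split.
  by rewrite coefP u0 v0 mulr0 addr0.
have bb := bounded_sumsD (bounded_sumsZ (_ : 0 <= 2 * a ^+ 2) bu) (bounded_sumsZ (_ : 0 <= 2) bv).
apply: bounded_sums_le (bb _ _) => // [k|]; last by rewrite mulr_ge0// sqr_ge0.
rewrite coefP -subr_ge0.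
have -> : 2 * a ^+ 2 * (lambda k * coef u k ^+ 2) + 2 * (lambda k * coef v k ^+ 2) -
  lambda k * (a * coef u k + coef v k) ^+ 2 = lambda k * (a * coef u k - coef v k) ^+ 2 by ring.
by rewrite mulr_ge0 ?sqr_ge0// lam_ge0.
Qed.

Lemma Hs1_0 : Hs 1 (0 : L2).
Proof.
have c0 k : coef (0 : L2) k = 0 by exact: inner0l.
apply/Hs1E; split; first exact: c0.
by exists 0 => n; rewrite big1// => k _; rewrite c0 expr0n mulr0.
Qed.

Lemma inner1_cvg l u v : Hs 1 u -> Hs 1 v ->
  (fun n => \sum_(0 <= k < n) (lambda k + l) * (coef u k * coef v k)) @ \oo --> inner1 g l u v.
Proof.
move=> /Hs1_energy bu /Hs1_energy bv; rewrite /inner1.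
have -> : (fun n => \sum_(0 <= k < n) (lambda k + l) * (coef u k * coef v k)) =
  (fun n => \sum_(0 <= k < n) lambda k * (coef u k * coef v k) +
     l * \sum_(0 <= k < n) coef u k * coef v k).
  apply/funext => n; rewrite mulr_sumr -big_split/=.
  by apply: eq_bigr => k _; rewrite mulrDl.
apply: cvgD; first exact: (h1_inner_cvg M_compact U_C1 A_spectrum).
by apply: cvgM; [exact: cvg_cst|exact: (parseval_phi A_spectrum)].
Qed.

Arguments inner1_cvg : clear implicits.

Lemma inner1P l a u v w : Hs 1 u -> Hs 1 v -> Hs 1 w ->
  inner1 g l (a *: u + v) w = a * inner1 g l u w + inner1 g l v w.
Proof.
move=> hu hv hw.
refine (cvgn_unique (inner1_cvg l _ _ (Hs1P a hu hv) hw) _).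
have -> : (fun n => \sum_(0 <= k < n) (lambda k + l) * (coef (a *: u + v) k * coef w k)) =
  (fun n => a * (\sum_(0 <= k < n) (lambda k + l) * (coef u k * coef w k)) +
    \sum_(0 <= k < n) (lambda k + l) * (coef v k * coef w k)).
  apply/funext => n; rewrite mulr_sumr -big_split/=; apply: eq_bigr => k _.
  by rewrite coefP; ring.
apply: cvgD; last exact: inner1_cvg.
by apply: cvgM; [exact: cvg_cst|exact: inner1_cvg].
Qed.

Lemma inner1C l u v : Hs 1 u -> Hs 1 v -> inner1 g l u v = inner1 g l v u.
Proof.
move=> hu hv; refine (cvgn_unique (inner1_cvg l _ _ hu hv) _).
have := inner1_cvg l _ _ hv hu.
rewrite (_ : (fun n => _) = (fun n => \sum_(0 <= k < n) (lambda k + l) * (coef u k * coef v k)))//.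
by apply/funext => n; apply: eq_bigr => k _; rewrite [coef v k * _]mulrC.
Qed.

(** For positive [l] this is coercivity, the source of both uniqueness and the operator bound. *)
Lemma inner1_ge l u : Hs 1 u -> l * inner pi u u <= inner1 g l u u.
Proof.
move=> hu; rewrite /inner1 lerDr; have bu := Hs1_energy hu.
have H := h1_inner_cvg M_compact U_C1 A_spectrum bu bu.
have := cvgn_sums_le (fun k => sqr_energy_ge0 A_spectrum u k) H 0%N.
by rewrite big_geq.
Qed.

Lemma coef_parseval u v :
  (fun n => \sum_(0 <= k < n) coef u k * coef v k) @ \oo --> inner pi u v.
Proof. exact: (parseval_phi A_spectrum). Qed.

Arguments coef_parseval : clear implicits.

(** The relation is available only against smooth functions. For [u] in H^2 the defect [z], with
    coefficients w_k + λ_k u_k, is an L^2 function; it is orthogonal to all smooth functions, hence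
    to every [phi k], an L^2 limit of such. *)
Lemma friedrichs_coef u w : Hs 2 u -> friedrichs g U u w ->
  forall k, coef w k = - lambda k * coef u k.
Proof.
move=> hu [_ fuw].
have [z zk] : exists z, forall k, coef z k = coef w k + lambda k * coef u k.
  apply: (riesz_fischer ortho).
  have /HsE[_ bu] := hu.
  have bb := bounded_sumsD (bounded_sumsZ (_ : 0 <= 2) (bounded_coef_sqr w))
    (bounded_sumsZ (_ : 0 <= 2) bu).
  apply: bounded_sums_le (bb _ _) => // k; rewrite -subr_ge0.
  have -> : 2 * coef w k ^+ 2 + 2 * (coef u k ^+ 2 * lambda k ^+ 2) -
    (coef w k + lambda k * coef u k) ^+ 2 = (coef w k - lambda k * coef u k) ^+ 2 by ring.
  exact: sqr_ge0.
have zf (f : L2) : smooth X f -> inner pi z f = 0.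
  move=> sf; have [G [GE Gk]] := generator_coef M_compact U_C1 A_spectrum sf.
  have := fuw f sf; rewrite -GE => uG.
  refine (cvgn_unique (coef_parseval z f) _).
  have -> : (fun n => \sum_(0 <= k < n) coef z k * coef f k) = (fun n =>
     \sum_(0 <= k < n) coef w k * coef f k - \sum_(0 <= k < n) coef u k * coef G k).
    apply/funext => n; rewrite -sumrB; apply: eq_bigr => k _; rewrite zk Gk; ring.
  have h := cvgB (coef_parseval w f) (coef_parseval u G).
  by rewrite uG subrr in h; exact: h.
move=> k; have [[f [sf /l2cvg_sub_cvg fk _]] _] := phi_friedrichs A_spectrum k.
have h0 : (fun n => inner pi (f n) z) = fun=> 0.
  by apply/funext => n; rewrite innerC zf.
have := @inner_cvgl _ _ _ _ _ z fk; rewrite h0 => h.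
have : inner pi (phi k) z = 0 by exact: (cvgn_unique h (cvg_cst _)).
rewrite innerC -/(coef z k) zk => /eqP.
by rewrite addr_eq0 => /eqP ->; rewrite mulNr.
Qed.

Lemma friedrichs_exists u w : Hs 1 u ->
  (forall k, coef w k = - lambda k * coef u k) -> friedrichs g U u w.
Proof.
move=> hu wk; split.
  apply: (approximable_form_domain M_compact U_C1 A_spectrum).
  apply: (finite_energy_approximable M_compact U_C1 A_spectrum); exact: Hs1_energy.
move=> f sf; have [G [GE Gk]] := generator_coef M_compact U_C1 A_spectrum sf.
rewrite -GE; refine (cvgn_unique (coef_parseval u G) _).
have -> : (fun n => \sum_(0 <= k < n) coef u k * coef G k) =
    (fun n => \sum_(0 <= k < n) coef w k * coef f k).
  apply/funext => n; apply: eq_bigr => k _; rewrite Gk wk; ring.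
exact: (parseval_phi A_spectrum).
Qed.

(** Every element of the set from which [A_inv] chooses has these properties; what remains is to
    exhibit one, found by dividing the coefficients of [h] by -(λ_k + l). *)
Lemma A_inv_spec l h : 0 < l -> Hs 0 h ->
  Hs 1 (A_inv g U lambda phi l h) /\
  forall k, (lambda k + l) * coef (A_inv g U lambda phi l h) k = - coef h k.
Proof.
move=> l0 /Hs0E h0.
have pos k : 0 < lambda k + l by rewrite ltr_wpDl// lam_ge0.
pose S := [set u : L2 | exists2 w, A_H g U lambda phi u w & (w - l *: u : M -> R) = h %[ae pi]].
have spec u : S u -> Hs 1 u /\ forall k, (lambda k + l) * coef u k = - coef h k.
  move=> [w [hu fuw] wh]; split; first exact: Hs2_Hs1.
  have wk := friedrichs_coef hu fuw.
  move=> k; have := coef_ae phi k (wh : ((w - l *: u : L2) : M -> R) = h %[ae pi]).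
  by rewrite coefB coefZ wk => <-; ring.
apply: spec.
have hb := bounded_coef_sqr h.
have [u uk] : exists u, forall k, coef u k = - (lambda k + l)^-1 * coef h k.
  apply: (riesz_fischer ortho).
  apply: bounded_sums_le (bounded_sumsZ (sqr_ge0 l^-1) hb) => k.
  rewrite exprMn sqrrN ler_wpM2r ?sqr_ge0//.
  have i0 : 0 <= (lambda k + l)^-1 by rewrite invr_ge0 ltW.
  have i1 : 0 <= l^-1 by rewrite invr_ge0 ltW.
  by rewrite ler_sqr// lef_pV2 ?posrE// lerDr lam_ge0.
(* The quotients λ_k / (λ_k + l) are at most 1. Square summability of these coefficients also puts
   [u] in H^2. *)
have [w wk] : exists w, forall k, coef w k = - lambda k * coef u k.
  apply: (riesz_fischer ortho); apply: bounded_sums_le hb => k.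
  rewrite uk mulrA exprMn ler_piMl ?sqr_ge0// mulrNN.
  have q0 : 0 <= lambda k / (lambda k + l).
    by rewrite mulr_ge0 ?lam_ge0// invr_ge0 ltW.
  by rewrite expr_le1// ler_pdivrMr// mul1r lerDl ltW.
have hu2 : Hs 2 u.
  apply/HsE; split; first by rewrite uk h0 mulr0.
  apply: bounded_sums_le (bounded_coef_sqr w) => k.
  by rewrite wk exprMn sqrrN mulrC.
have Su : S u.
  exists w; first by split => //; apply: friedrichs_exists => //; exact: Hs2_Hs1.
  suff : ((w - l *: u : L2) : M -> R) = h %[ae pi] by [].
  apply: (coef_inj complete) => k.
  rewrite coefB coefZ wk uk.
  have p0 : lambda k + l != 0 by rewrite gt_eqF.
  by field.
exact: (xgetPex 0 (ex_intro _ u Su)).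
Qed.

Lemma B_P a u v : Hs 1 u -> Hs 1 v -> (B (a *: u + v) : M -> R) = a *: B u + B v %[ae pi].
Proof. by case: B_drift => _ H _ _; exact: H. Qed.

(** Continuity of [B] on H^1 in squared form; it is what makes its kernel closed. *)
Lemma B_bound : exists2 C : R, 0 <= C & forall u, Hs 1 u ->
  inner pi (B u) (B u) <= C * h1_inner g u u.
Proof.
have [_ _ [C HC] _] := B_drift; exists (C ^+ 2); first exact: sqr_ge0.
move=> u hu; have := HC u hu; rewrite Lnorm2_inner lee_fin => H.
have bu := Hs1_energy hu.
have h0 : 0 <= h1_inner g u u.
  have := cvgn_sums_le (fun k => sqr_energy_ge0 A_spectrum u k)
    (h1_inner_cvg M_compact U_C1 A_spectrum bu bu) 0%N.
  by rewrite big_geq.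
rewrite -(sqr_sqrtr (inner_ge0 (B u))) -(sqr_sqrtr h0) -exprMn.
by rewrite ler_sqr ?nnegrE ?sqrtr_ge0//; apply: le_trans H; exact: sqrtr_ge0.
Qed.

Lemma ae_coefP (a : R) u v w : (u : M -> R) = a *: v + w %[ae pi] ->
  forall k, coef u k = a * coef v k + coef w k.
Proof.
move=> H k; have := coef_ae phi k (H : (u : M -> R) = (a *: v + w : L2) %[ae pi]).
by rewrite coefP.
Qed.

Lemma coef_eq0_ae u : (forall k, coef u k = 0) <-> (u : M -> R) = cst 0 %[ae pi].
Proof.
split=> [H|H k].
  suff : (u : M -> R) = (0 : L2) %[ae pi] by [].
  by apply: (coef_inj complete) => k; rewrite H; symmetry; exact: inner0l.
have := coef_ae phi k (H : (u : M -> R) = (0 : L2) %[ae pi]) => ->.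
exact: inner0l.
Qed.

Local Notation kerB := (kerB lambda phi B).

Lemma kerB_coef u : kerB u <-> Hs 1 u /\ forall k, coef (B u) k = 0.
Proof. by split=> -[hu Bu]; split => //; exact/coef_eq0_ae. Qed.

Lemma kerB_Hs1 u : kerB u -> Hs 1 u. Proof. by case. Qed.

Lemma kerB_P a u v : kerB u -> kerB v -> kerB (a *: u + v).
Proof.
move=> /kerB_coef[hu Bu] /kerB_coef[hv Bv]; apply/kerB_coef; split; first exact: Hs1P.
by move=> k; rewrite (ae_coefP (B_P a hu hv)) Bu Bv mulr0 addr0.
Qed.

Lemma kerB0 : kerB 0.
Proof.
apply/kerB_coef; split=> [|k]; first exact: Hs1_0.
have := ae_coefP (B_P 1 Hs1_0 Hs1_0) k; rewrite scaler0 addr0 mul1r => h.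
by apply: (addrI (coef (B 0) k)); rewrite addr0 -h.
Qed.

(* [T u] has coefficients [sqrt (lambda k + l) * coef u k]: [T] is an isometry
   from H^1 with [inner1 l] into L^2, so that projecting onto [kerB] amounts to
   projecting onto the closed subspace [T kerB] of L^2. *)
Lemma inner1_isometry l u : 0 < l -> Hs 1 u ->
  exists x, forall k, coef x k = Num.sqrt (lambda k + l) * coef u k.
Proof.
move=> l0 hu; apply: (riesz_fischer ortho).
apply: bounded_sums_le (bounded_sumsD (Hs1_energy hu)
  (bounded_sumsZ (ltW l0) (bounded_coef_sqr u))) => k.
by rewrite exprMn sqr_sqrtr ?mulrDl// addr_ge0 ?lam_ge0// ltW.
Qed.

Lemma inner1_isometryE l u v x y : 0 < l -> Hs 1 u -> Hs 1 v ->
  (forall k, coef x k = Num.sqrt (lambda k + l) * coef u k) ->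
  (forall k, coef y k = Num.sqrt (lambda k + l) * coef v k) ->
  inner1 g l u v = inner pi x y.
Proof.
move=> l0 hu hv xu yv; refine (cvgn_unique (inner1_cvg l _ _ hu hv) _).
have := coef_parseval x y.
rewrite (_ : (fun n => _) = (fun n => \sum_(0 <= k < n) (lambda k + l) * (coef u k * coef v k)))//.
apply/funext => n; apply: eq_bigr => k _; rewrite xu yv mulrACA -expr2 sqr_sqrtr//.
by rewrite addr_ge0 ?lam_ge0// ltW.
Qed.

Lemma P1_exists l u : 0 < l -> Hs 1 u ->
  exists w, kerB w /\ forall v, kerB v -> inner1 g l (u - w) v = 0.
Proof.
move=> l0 hu.
have pos k : 0 < lambda k + l by rewrite ltr_wpDl// lam_ge0.
have spos k : 0 < Num.sqrt (lambda k + l) by rewrite sqrtr_gt0.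
pose rel x y := forall k, coef x k = Num.sqrt (lambda k + l) * coef y k.
have [Tu Tuk] := inner1_isometry l0 hu.
pose K x := exists2 y, kerB y & rel x y.
have [||x y Kx xy|x [w kw xw] Kx] := @projection_exists _ _ _ K Tu.
- exists 0; first exact: kerB0.
  by move=> k; rewrite /coef !inner0l mulr0.
- move=> a x y [x' kx' xx'] [y' ky' yy']; exists (a *: x' + y'); first exact: kerB_P.
  by move=> k; rewrite !coefP xx' yy'; ring.
- have /choice[z Hz] : forall n, exists z, kerB z /\ rel (x n) z.
    by move=> n; have [z] := Kx n; exists z.
  have kz n : kerB (z n) by have [] := Hz n.
  have xz n : rel (x n) (z n) by have [] := Hz n.
  (* The limit is pulled back by the inverse multiplier, bounded because [l] is positive. *)
  have [y' yk] : exists y', forall k, coef y' k = (Num.sqrt (lambda k + l))^-1 * coef y k.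
    apply: (riesz_fischer ortho).
    have il0 : 0 <= l^-1 by rewrite invr_ge0 ltW.
    apply: bounded_sums_le (bounded_sumsZ il0 (bounded_coef_sqr y)) => k.
    rewrite exprMn exprVn (sqr_sqrtr (ltW (pos k))) ler_wpM2r ?sqr_ge0//.
    by rewrite lef_pV2 ?posrE// lerDr lam_ge0.
  have yy' : rel y y' by move=> k; rewrite yk mulVKf// gt_eqF.
  have hy' : Hs 1 y'.
    apply/Hs1E; split.
      rewrite yk; apply/eqP; rewrite mulf_eq0; apply/orP; right; apply/eqP.
      have xn0 : (fun n => coef (x n) 0) = fun=> 0.
        by apply/funext => n; rewrite xz (Hs1_coef0 (kerB_Hs1 (kz n))) mulr0.
      have := @coef_lim _ _ _ phi _ _ 0%N xy; rewrite xn0 => h.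
      exact: (cvgn_unique h (cvg_cst _)).
    apply: bounded_sums_le (bounded_coef_sqr y) => k.
    by rewrite yy' exprMn (sqr_sqrtr (ltW (pos k))) ler_wpM2r ?sqr_ge0// lerDl ltW.
  exists y' => //; apply/kerB_coef; split => //.
  have [C C0 HC] := B_bound.
  have hd n : Hs 1 (-1 *: z n + y') by apply: Hs1P => //; exact: kerB_Hs1.
  have BE n k : coef (B (-1 *: z n + y')) k = coef (B y') k.
    have /kerB_coef[hz Bz] := kz n.
    by rewrite (ae_coefP (B_P (-1) hz hy')) Bz mulr0 add0r.
  (* As [B (z n)] vanishes, [B y'] is the image of [y' - z n], whose H^1 norm is dominated by its
     [inner1 l] norm, that is by the L^2 distance of [x n] and [y]. *)
  have Bn n : inner pi (B y') (B y') <= C * inner pi (x n - y : L2) (x n - y : L2).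
    have -> : inner pi (B y') (B y') = inner pi (B (-1 *: z n + y')) (B (-1 *: z n + y')).
      have e : (B y' : M -> R) = B (-1 *: z n + y') %[ae pi].
        by apply: (coef_inj complete) => k; rewrite BE.
      by rewrite (ae_inner _ e) innerC (ae_inner _ e).
    apply: le_trans (HC _ (hd n)) _; rewrite ler_wpM2l//.
    have xnz : rel (-1 *: x n + y) (-1 *: z n + y').
      by move=> k; rewrite !coefP xz yy'; ring.
    have := inner1_isometryE l0 (hd n) (hd n) xnz xnz.
    have -> : inner pi (-1 *: x n + y : L2) (-1 *: x n + y : L2) =
        inner pi (x n - y : L2) (x n - y : L2).
      by rewrite scaleN1r addrC -opprB innerNl innerC innerNl opprK.
    by move=> <-; rewrite /inner1 lerDl mulr_ge0 ?inner_ge0// ltW.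
  have B0 : inner pi (B y') (B y') = 0.
    apply/eqP; rewrite eq_le inner_ge0 andbT.
    have h : (fun n => C * inner pi (x n - y : L2) (x n - y : L2)) @ \oo --> C * 0.
      by apply: cvgM => //; exact: cvg_cst.
    rewrite mulr0 in h; apply: ler_cvg_to (cvg_cst _) h _.
    by apply: nearW => n; exact: Bn.
  by apply/coef_eq0_ae; exact: inner_eq0_ae.
exists w; split => // v kv.
have [Tv Tvk] := inner1_isometry l0 (kerB_Hs1 kv).
have hw := kerB_Hs1 kw.
have huw : Hs 1 (u - w).
  by have := Hs1P (-1) hw hu; rewrite scaleN1r addrC.
rewrite -(Kx Tv); last by exists v.
apply: inner1_isometryE => //; first exact: kerB_Hs1.
by move=> k; rewrite !coefB Tuk xw mulrBr.
Qed.

Lemma P1_spec l u : 0 < l -> Hs 1 u -> kerB (P1 g lambda phi B l u) /\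
  forall v, kerB v -> inner1 g l (u - P1 g lambda phi B l u) v = 0.
Proof.
move=> l0 hu; have [w Hw] := P1_exists l0 hu.
exact: (xgetPex 0 (P := [set w | kerB w /\ forall v, kerB v -> inner1 g l (u - w) v = 0])
  (ex_intro _ w Hw)).
Qed.

Local Notation Rst := (Rstar g U lambda phi B).

(** The weights λ_k + l of [inner1 l] cancel the resolvent, so [A_inv l h] pairs with [v] to minus
    the L^2 product of [h] and [v]. Projecting does not change the pairing with [v] in the kernel,
    and the sign in [Rstar] restores the product. *)
Lemma Rstar_spec l h : 0 < l -> Hs 0 h -> kerB (Rst l h) /\
  forall v, kerB v -> inner1 g l (Rst l h) v = inner pi h v.
Proof.
move=> l0 hh; have [hu uk] := A_inv_spec l0 hh.
have [kw Hw] := P1_spec l0 hu.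
rewrite /Rstar; move: (A_inv g U lambda phi l h) (P1 _ _ _ _ _ _) hu uk kw Hw.
move=> u w hu uk kw Hw.
have kNw : kerB (- w) by have := kerB_P (-1) kw kerB0; rewrite scaleN1r addr0.
split=> // v kv; have hv := kerB_Hs1 kv.
have huh : inner1 g l u v = - inner pi h v.
  refine (cvgn_unique (inner1_cvg l _ _ hu hv) _).
  have -> : (fun n => \sum_(0 <= k < n) (lambda k + l) * (coef u k * coef v k)) =
    (fun n => - \sum_(0 <= k < n) coef h k * coef v k).
    by apply/funext => n; rewrite -sumrN; apply: eq_bigr => k _; rewrite mulrA uk mulNr.
  by apply: cvgN; exact: (parseval_phi A_spectrum).
have := inner1P l (-1) hu (_ : Hs 1 (u - w)) hv.
rewrite scaleN1r addrA addNr add0r (Hw _ kv) huh => ->; first by ring.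
by have := Hs1P (-1) (kerB_Hs1 kw) hu; rewrite scaleN1r addrC.
Qed.

(** The difference of two solutions lies in the kernel and may be tested against itself; coercivity
    makes it zero almost everywhere. *)
Lemma Rstar_unique l h r : 0 < l -> Hs 0 h -> kerB r ->
  (forall v, kerB v -> inner1 g l r v = inner pi h v) ->
  forall k, coef r k = coef (Rst l h) k.
Proof.
move=> l0 hh kr Hr; have [ks Hs'] := Rstar_spec l0 hh.
move: (Rst l h) ks Hs' => s ks Hs'.
have kd : kerB (-1 *: r + s) by exact: kerB_P.
have d0 : inner pi (-1 *: r + s : L2) (-1 *: r + s : L2) = 0.
  have := inner1_ge l (kerB_Hs1 kd).
  rewrite (inner1P l (-1) (kerB_Hs1 kr) (kerB_Hs1 ks) (kerB_Hs1 kd)).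
  rewrite (Hr _ kd) (Hs' _ kd) mulN1r addNr => H.
  apply/eqP; rewrite eq_le inner_ge0 andbT.
  by rewrite -(ler_pM2l l0) mulr0.
move=> k; have := (coef_eq0_ae _).2 (inner_eq0_ae d0) k.
by rewrite coefP mulN1r addrC => /eqP; rewrite subr_eq0 => /eqP.
Qed.

Lemma Rstar_selfadjoint l : 0 < l -> selfadjoint_bounded_on_H lambda phi (Rst l).
Proof.
move=> l0; split.
- by move=> u /(Rstar_spec l0)[/kerB_Hs1/Hs1_Hs0].
- move=> a u v hu hv.
  have [ku Hu] := Rstar_spec l0 hu; have [kv Hv] := Rstar_spec l0 hv.
  have huv : Hs 0 (a *: u + v).
    by apply/Hs0E; rewrite coefP !((Hs0E _).1) // mulr0 addr0.
  suff : (Rst l (a *: u + v) : M -> R) = (a *: Rst l u + Rst l v : L2) %[ae pi] by [].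
  apply: (coef_inj complete) => k; symmetry; apply: Rstar_unique => //; first exact: kerB_P.
  move: (Rst l u) (Rst l v) ku Hu kv Hv => r s kr Hr ks Hs' w kw.
  rewrite (inner1P l a (kerB_Hs1 kr) (kerB_Hs1 ks) (kerB_Hs1 kw)).
  by rewrite (Hr _ kw) (Hs' _ kw) innerDl innerZl.
(* With r = R*_l u tested against itself, l |r|^2 <= <r, r>_{1,l} = <u, r> <= |u| |r|; dividing by
   |r| requires the case |r| = 0 apart. *)
- exists l^-1 => u hu; have [ku Hu] := Rstar_spec l0 hu.
  rewrite !Lnorm2_inner -EFinM lee_fin mulrC ler_pdivlMr//.
  have := inner1_ge l (kerB_Hs1 ku); rewrite (Hu _ ku).
  move: (Rst l u) => r; have := inner_norm u r.
  move=> /(le_trans (ler_norm _)) h1 h2; have := le_trans h2 h1.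
  rewrite -{1}(sqr_sqrtr (inner_ge0 r)).
  have := sqrtr_ge0 (inner pi r r); have := sqrtr_ge0 (inner pi u u).
  move: (Num.sqrt (inner pi r r)) (Num.sqrt (inner pi u u)) => s t t0 s0 H.
  have [->|sn] := eqVneq s 0; first by rewrite mul0r.
  have sp : 0 < s by rewrite lt_neqAle eq_sym sn.
  by rewrite -(ler_pM2r sp); apply: le_trans H; rewrite expr2 mulrA [s * l]mulrC.
- move=> u v hu hv.
  have [ku Hu] := Rstar_spec l0 hu; have [kv Hv] := Rstar_spec l0 hv.
  move: (Rst l u) (Rst l v) ku Hu kv Hv => r s kr Hr ks Hs'.
  (* Each solution serves as test function in the equation of the other. *)
  rewrite [LHS]innerC -[LHS](Hs' _ kr) -[RHS](Hr _ ks).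
  by apply: inner1C; exact: kerB_Hs1.
Qed.

Lemma Rstar_resolvent l m h : 0 < l -> 0 < m -> Hs 0 h ->
  ((m - l) *: Rst l (Rst m h) : M -> R) = Rst l h - Rst m h %[ae pi].
Proof.
move=> l0 m0 hh; have [ks Hs'] := Rstar_spec m0 hh.
have hs := Hs1_Hs0 (kerB_Hs1 ks).
have [kt Ht] := Rstar_spec l0 hs.
have kx : kerB ((m - l) *: Rst l (Rst m h) + Rst m h) by exact: kerB_P.
have E k : coef ((m - l) *: Rst l (Rst m h) + Rst m h) k = coef (Rst l h) k.
  apply: (Rstar_unique l0 hh kx).
  move: (Rst m h) (Rst l (Rst m h)) ks Hs' kt Ht {hs kx} => s t ks Hs' kt Ht v kv.
  rewrite (inner1P l _ (kerB_Hs1 kt) (kerB_Hs1 ks) (kerB_Hs1 kv)) (Ht _ kv).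
  (* The pairings for [l] and [m] differ by a multiple of the L^2 product: (m - l) <s, v> + <s,
     v>_{1,l} = <s, v>_{1,m}. *)
  by rewrite -[RHS](Hs' _ kv) /inner1; ring.
move: (Rst m h) (Rst l (Rst m h)) (Rst l h) E {ks Hs' hs kt Ht kx} => s t r E.
suff : (((m - l) *: t : L2) : M -> R) = (r - s : L2) %[ae pi] by [].
apply: (coef_inj complete) => k.
by rewrite coefB coefZ -E coefP addrK.
Qed.

End Resolvent.

Theorem theorem3 (R : realType) (d : nat) (M : ptopologicalType)
  (M_hausdorff : hausdorff_space M) (M_compact : compact [set: M])
  (X : oriented_atlas R d M) (g : riemannian_metric X)
  (vol : {measure set (borel M) -> \bar R})
  (vol_riemannian : is_riemannian_volume g vol)
  (U : M -> R) (U_C1 : fun_C X 1 U)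
  (pi : probability (borel M) R) (pi_gibbs : is_gibbs vol U pi)
  (lambda : nat -> R) (phi : nat -> L2 pi)
  (A_spectrum : discrete_spectrum g U lambda phi)
  (b : vfield R d M) (b_C1 : vfield_C X 1 b)
  (b_div : forall p, divergence g (fun i q => expR (- U q) *: b i q) p = 0)
  (b_dom : forall u, Hs lambda phi 1 u -> drift_domain g b u)
  (B : L2 pi -> L2 pi) (B_drift : is_drift_operator g lambda phi b B) :
  (forall l : R, 0 < l ->
     selfadjoint_bounded_on_H lambda phi (Rstar g U lambda phi B l)) /\
  (forall l m : R, 0 < l -> 0 < m -> forall h : L2 pi, Hs lambda phi 0 h ->
     ((m - l) *: Rstar g U lambda phi B l (Rstar g U lambda phi B m h) : M -> R)
     = Rstar g U lambda phi B l h - Rstar g U lambda phi B m h %[ae pi]).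
Proof.
split=> [l l0|l m l0 m0 h hh].
  exact: (Rstar_selfadjoint M_compact U_C1 A_spectrum B_drift l0).
exact: (Rstar_resolvent M_compact U_C1 A_spectrum B_drift l0 m0 hh).
Qed.
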